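(* Let $P=\{p<q\}$ and let $S=(X,S_p)\in\mathrm{Sam}_P$ be a compact, definable stratified metric space (appropriately rescaled, so that it is cylindrically stratified). Then for any $v\in\Omega$ there exists $\varepsilon>0$ such that the structure map $$\mathcal P_v(S)(\alpha)\to\mathcal P_v(S)(\alpha')$$ is a weak equivalence for all $0\le\alpha\le\alpha'<\varepsilon$. In particular, $$\mathcal P_v(S)|_{[0,\varepsilon)}\simeq S,$$ that is, $\mathcal P_v(S)$ restricted to $[0,\varepsilon)$ is isomorphic in $\mathrm{Ho}(\mathrm{Diag}_P^{[0,\varepsilon)})$ to the constant functor with value the stratification diagram $D(S)$ of $S$. Furthermore, $\varepsilon$ can be taken to be the minimum of the weak feature sizes of the entries of $\mathcal D_v(\mathcal N(S))$, and this minimum is positive.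
   Context: Fix $\mathbb R^N$ with Euclidean norm. For $A\subset\mathbb R^N$, $\alpha\ge0$: $A_\alpha=\{y\mid\exists x\in A:\|x-y\|\le\alpha\}$. $\mathbb R_+=[0,\infty)$ as a poset. $\mathrm{Sam}_P$ is the set of pairs $(\mathbb X,\mathbb X_p)$ with $\mathbb X_p\subset\mathbb X\subset\mathbb R^N$. A stratified space over $P=\{p<q\}$ is a space $X$ with a closed subset $S_p$; $S_q=X\setminus S_p$. A stratified $X\subset\mathbb R^N$ is the element $(X,S_p)$ of $\mathrm{Sam}_P$, with the Euclidean metric. It is definable if $S_p,S_q$ are definable in some fixed o-minimal structure (expanding the real field). $\Omega$ is the set of $v=(v_l,v_u)$ with $0<v_l<v_u<1$. For $S\in\mathrm{Sam}_P$, $\mathcal N(S)=(X,s)$ with $s(x)=\min\{d(x,S_p),1\}$ ($d(x,\emptyset)=\infty$), and $\mathcal D_v(\mathcal N(S))$ is the triple of subsets (entries) $\mathcal D_p=s^{-1}[0,v_u]$, $\mathcal D_{\{p<q\}}=s^{-1}[v_l,v_u]$, $\mathcal D_q=s^{-1}[v_l,1]$, regarded as a diagram $\mathcal D_p\hookleftarrow\mathcal D_{\{p<q\}}\hookrightarrow\mathcal D_q$. $\mathrm{Top}$ is the category of $\Delta$-generated spaces. $\mathrm{Diag}_P$ is the category of diagrams of spaces $D_p\leftarrow D_{\{p<q\}}\to D_q$ (stratification diagrams); weak equivalences are morphisms that are weak homotopy equivalences at each of the three entries. For a small category $U$, $\mathrm{Ho}(\mathrm{Diag}_P^U)$ is the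 localization of the functor category $\mathrm{Diag}_P^U$ at natural transformations that are weak equivalences at each object of $U$. The stratification diagram of $S$ is $D(S)=\{S_p\leftarrow \mathrm{HoLink}(S)\to S_q\}$ where $\mathrm{HoLink}(S)=\{\gamma:[0,1]\to X\mid\gamma(0)\in S_p,\ \gamma(t)\in S_q\ \forall t>0\}$ (compact-open topology), with maps $\gamma\mapsto\gamma(0)$, $\gamma\mapsto\gamma(1)$. (The functor $D$ induces an equivalence between the homotopy category of stratified spaces over $P$, localized at maps inducing weak equivalences on strata and homotopy links, and $\mathrm{Ho}\,\mathrm{Diag}_P$; the two are identified, so the value $S$ means $D(S)$.) The persistent stratified homotopy type $\mathcal P_v(S)$ is the functor $\mathbb R_+\to\mathrm{Diag}_P$, $\alpha\mapsto\{(\mathcal D_p)_\alpha\hookleftarrow(\mathcal D_{\{p<q\}})_\alpha\hookrightarrow(\mathcal D_q)_\alpha\}$ (entries of $\mathcal D_v(\mathcal N(S))$), with structure maps the inclusions, regarded in $\mathrm{Ho}(\mathrm{Diag}_P^{\mathbb R_+})$. Cylindrically stratified (for $S$ with its metric and $s=\min\{d(-,S_p),1\}$) means: (i) there are a neighborhood $N$ of $S_p$, a space $L$, a map $r:L\to S_p$ and a stratum preserving homeomorphism $N\cong M_r$, where $M_r=L\times(0,1]\sqcup S_p$ is the mapping cylinder of $r$ (stratified with $p$-stratum $S_p$) with the teardrop topology, generated by the open subsets of $L\times(0,1]$ and the preimages of open sets under $M_r\to S_p\times[0,1]$, $(l,t)\mapsto(r(l),t)$, $y\mapsto(y,0)$;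 (ii) there is a homeomorphism $s^{-1}(0,1)\cong s^{-1}(\tfrac12)\times(0,1)$ commuting with $s$ and the projection to $(0,1)$. Every compact definably stratified space satisfies this after a linear rescaling. Weak feature size of a compact $K\subset\mathbb R^N$: $y\notin K$ is critical if $y$ lies in the convex hull of $\{x\in K\mid\|x-y\|=d(y,K)\}$; the weak feature size is $\inf\{d(y,K)\mid y\text{ critical}\}$ ($\infty$ if there is no critical point or $K=\emptyset$). *)

(* Defs.v *)
From HB Require Import structures.
From mathcomp Require Import all_boot all_order all_algebra.
From mathcomp Require Import all_classical all_reals all_analysis.

Set Implicit Arguments.
Unset Strict Implicit.
Unset Printing Implicit Defensive.

Import Order.TTheory GRing.Theory Num.Theory.
Import numFieldNormedType.Exports.

Local Open Scope classical_set_scope.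
Local Open Scope ring_scope.

(* Hom-sets carry their own equality, so that the localization can be presented
   by generators and relations without forming quotients. *)
Record category := Category {
  obj :> Type;
  mor : obj -> obj -> Type;
  mor_eq : forall X Y, mor X Y -> mor X Y -> Prop;
  idm : forall X, mor X X;
  hcomp : forall X Y Z, mor Y Z -> mor X Y -> mor X Z;
  mor_eq_refl : forall X Y (f : mor X Y), mor_eq f f;
  mor_eq_sym : forall X Y (f g : mor X Y), mor_eq f g -> mor_eq g f;
  mor_eq_trans : forall X Y (f g h : mor X Y),
    mor_eq f g -> mor_eq g h -> mor_eq f h;
  hcomp_eq : forall X Y Z (g g' : mor Y Z) (f f' : mor X Y),
    mor_eq g g' -> mor_eq f f' -> mor_eq (hcomp g f) (hcomp g' f');
  hcomp_idl : forall X Y (f : mor X Y), mor_eq (hcomp (idm Y) f) f;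
  hcomp_idr : forall X Y (f : mor X Y), mor_eq (hcomp f (idm X)) f;
  hcomp_assoc : forall W X Y Z (h : mor Y Z) (g : mor X Y) (f : mor W X),
    mor_eq (hcomp h (hcomp g f)) (hcomp (hcomp h g) f)
}.
Arguments mor {c}.
Arguments mor_eq {c X Y}.
Arguments idm {c}.
Arguments hcomp {c X Y Z}.

Definition isomorphic (C : category) (X Y : C) : Prop :=
  exists (f : mor X Y) (g : mor Y X),
    mor_eq (hcomp g f) (idm X) /\ mor_eq (hcomp f g) (idm Y).

Record functor (C D : category) := Functor {
  fobj :> C -> D;
  fmap : forall X Y, mor X Y -> mor (fobj X) (fobj Y);
  fmap_eq : forall X Y (f g : mor X Y), mor_eq f g -> mor_eq (fmap f) (fmap g);
  fmap_id : forall X, mor_eq (fmap (idm X)) (idm (fobj X));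
  fmap_comp : forall X Y Z (g : mor Y Z) (f : mor X Y),
    mor_eq (fmap (hcomp g f)) (hcomp (fmap g) (fmap f))
}.
Arguments fmap {C D} _ {X Y}.

Record nattrans (C D : category) (F G : functor C D) := NatTrans {
  ntcomp :> forall X, mor (F X) (G X);
  nt_natural : forall X Y (f : mor X Y),
    mor_eq (hcomp (ntcomp Y) (fmap F f)) (hcomp (fmap G f) (ntcomp X))
}.

Section functor_category.
Variables C D : category.

Program Definition id_nt (F : functor C D) : nattrans F F :=
  @NatTrans _ _ F F (fun X => idm (F X)) _.
Next Obligation.
move=> F X Y f; apply: mor_eq_trans (hcomp_idl _) _.
exact: mor_eq_sym (hcomp_idr _).
Qed.

Program Definition comp_nt (F G H : functor C D) (b : nattrans G H)
    (a : nattrans F G) : nattrans F H :=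
  @NatTrans _ _ F H (fun X => hcomp (b X) (a X)) _.
Next Obligation.
move=> F G H b a X Y f.
apply: mor_eq_trans (mor_eq_sym (hcomp_assoc _ _ _)) _.
apply: mor_eq_trans (hcomp_eq (mor_eq_refl _) (nt_natural a f)) _.
apply: mor_eq_trans (hcomp_assoc _ _ _) _.
apply: mor_eq_trans (hcomp_eq (nt_natural b f) (mor_eq_refl _)) _.
exact: mor_eq_sym (hcomp_assoc _ _ _).
Qed.

Program Definition functor_cat : category :=
  @Category (functor C D) (@nattrans C D)
    (fun F G a b => forall X, mor_eq (a X) (b X)) id_nt comp_nt
    _ _ _ _ _ _ _.
Next Obligation. by move=> F G a X; exact: mor_eq_refl. Qed.
Next Obligation. by move=> F G a b ab X; exact: mor_eq_sym. Qed.
Next Obligation.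
by move=> F G a b c ab bc X; exact: mor_eq_trans (ab X) (bc X).
Qed.
Next Obligation. by move=> F G H b b' a a' bb aa X; exact: hcomp_eq. Qed.
Next Obligation. by move=> F G a X; exact: hcomp_idl. Qed.
Next Obligation. by move=> F G a X; exact: hcomp_idr. Qed.
Next Obligation. by move=> F G H K c b a X; exact: hcomp_assoc. Qed.

Program Definition const_functor (Y : D) : functor C D :=
  @Functor C D (fun=> Y) (fun _ _ _ => idm Y) _ _ _.
Next Obligation. by move=> *; exact: mor_eq_refl. Qed.
Next Obligation. by move=> *; exact: mor_eq_refl. Qed.
Next Obligation. by move=> *; exact/mor_eq_sym/hcomp_idl. Qed.

End functor_category.

Program Definition comp_functor (B C D : category) (G : functor C D)
    (F : functor B C) : functor B D :=
  @Functor B D (fun X => G (F X)) (fun X Y f => fmap G (fmap F f)) _ _ _.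
Next Obligation. by move=> B C D G F X Y f g fg; do 2!apply: fmap_eq. Qed.
Next Obligation.
move=> B C D G F X; apply: mor_eq_trans (fmap_eq _ (fmap_id _ _)) _.
exact: fmap_id.
Qed.
Next Obligation.
move=> B C D G F X Y Z g f.
apply: mor_eq_trans (fmap_eq _ (fmap_comp _ _ _)) _; exact: fmap_comp.
Qed.

(* The Gabriel-Zisman localization C[W^-1]: a morphism is a formal composite of
   morphisms of C and formal inverses of morphisms in W, and equality is the
   least congruence making C -> C[W^-1] a functor that sends every w in W to an
   isomorphism with inverse the formal inverse of w. *)
Section localization.
Variables (C : category) (W : forall X Y : C, mor X Y -> Prop).

Inductive loc_hom : C -> C -> Type :=
| loc_of X Y : mor X Y -> loc_hom X Y
| loc_inv X Y (w : mor X Y) : W w -> loc_hom Y X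
| loc_comp X Y Z : loc_hom Y Z -> loc_hom X Y -> loc_hom X Z.

Inductive loc_eq : forall X Y, loc_hom X Y -> loc_hom X Y -> Prop :=
| loc_eq_refl X Y (f : loc_hom X Y) : loc_eq f f
| loc_eq_sym X Y (f g : loc_hom X Y) : loc_eq f g -> loc_eq g f
| loc_eq_trans X Y (f g h : loc_hom X Y) :
    loc_eq f g -> loc_eq g h -> loc_eq f h
| loc_comp_eq X Y Z (g g' : loc_hom Y Z) (f f' : loc_hom X Y) :
    loc_eq g g' -> loc_eq f f' -> loc_eq (loc_comp g f) (loc_comp g' f')
| loc_comp_idl X Y (f : loc_hom X Y) : loc_eq (loc_comp (loc_of (idm Y)) f) f
| loc_comp_idr X Y (f : loc_hom X Y) : loc_eq (loc_comp f (loc_of (idm X))) f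
| loc_comp_assoc X1 X2 X3 X4 (h : loc_hom X3 X4) (g : loc_hom X2 X3)
    (f : loc_hom X1 X2) :
    loc_eq (loc_comp h (loc_comp g f)) (loc_comp (loc_comp h g) f)
| loc_of_eq X Y (f g : mor X Y) : mor_eq f g -> loc_eq (loc_of f) (loc_of g)
| loc_of_comp X Y Z (g : mor Y Z) (f : mor X Y) :
    loc_eq (loc_of (hcomp g f)) (loc_comp (loc_of g) (loc_of f))
| loc_invl X Y (w : mor X Y) (ww : W w) :
    loc_eq (loc_comp (loc_inv ww) (loc_of w)) (loc_of (idm X))
| loc_invr X Y (w : mor X Y) (ww : W w) :
    loc_eq (loc_comp (loc_of w) (loc_inv ww)) (loc_of (idm Y)).

Definition localization : category :=
  @Category C loc_hom loc_eq (fun X => loc_of (idm X)) loc_comp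
    loc_eq_refl loc_eq_sym loc_eq_trans loc_comp_eq
    loc_comp_idl loc_comp_idr loc_comp_assoc.

End localization.

Section poset_category.
Context {d : Order.disp_t} {T : porderType d}.
Local Open Scope order_scope.

Program Definition poset_cat (A : set T) : category :=
  @Category A (fun a b => val a <= val b) (fun _ _ _ _ => True)
    (fun a => lexx (val a)) (fun a b c bc ab => le_trans ab bc)
    _ _ _ _ _ _ _.
Solve All Obligations with by [].

Program Definition poset_incl (A B : set T) (AB : A `<=` B) :
    functor (poset_cat A) (poset_cat B) :=
  @Functor (poset_cat A) (poset_cat B)
    (fun a => exist _ (val a) (mem_set (AB _ (set_mem (valP a)))))
    (fun a b ab => ab) _ _ _.
Solve All Obligations with by [].

End poset_category.

Lemma continuous_fun_comp (X Y Z : topologicalType) (f : X -> Y) (g : Y -> Z) :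
  continuous f -> continuous g -> continuous (fun x => g (f x)).
Proof. by move=> cf cg x; apply: continuous_comp; [exact: cf|exact: cg]. Qed.

Section set_type_maps.
Context {T : topologicalType}.

Definition set_incl (A B : set T) (AB : A `<=` B) (x : A) : B :=
  exist _ (val x) (mem_set (AB _ (set_mem (valP x)))).

Lemma continuous_to_set_type {X : topologicalType} (A : set T) (f : X -> A) :
  continuous (fun x => val (f x)) -> continuous f.
Proof.
move=> cf; apply/continuousP => _ [U oU <-].
by move/continuousP: cf => /(_ U oU).
Qed.

Lemma continuous_set_val (A : set T) : continuous (val : A -> T).
Proof. exact: initial_continuous. Qed.

Lemma set_incl_continuous (A B : set T) (AB : A `<=` B) :
  continuous (set_incl AB).
Proof. exact/continuous_to_set_type/continuous_set_val. Qed.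

End set_type_maps.

Arguments set_incl_continuous {T A B} AB.

Definition homeomorphism {X Y : topologicalType} (f : X -> Y) : Prop :=
  continuous f /\
  exists g : Y -> X, [/\ continuous g, cancel f g & cancel g f].

Section delta_generated.
Variable R : realType.

Definition std_simplex n : set 'rV[R]_n.+1 :=
  [set x | (forall i, 0 <= x 0 i) /\ \sum_i x 0 i = 1].
Arguments std_simplex : clear implicits.

Definition delta_open {X : topologicalType} (U : set X) : Prop :=
  forall n (sigma : std_simplex n -> X),
    continuous sigma -> open (sigma @^-1` U).

Definition delta_generated (X : topologicalType) : Prop :=
  forall U : set X, delta_open U -> open U.

(* The coreflection of X in Delta-generated spaces: same points, final topology
   with respect to all continuous maps from simplices; R, which fixes the
   simplices, is a phantom argument so that the topology can be inferred. *)
Definition deltaification (R : realType) (X : topologicalType) : Type := X.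

Section deltaification.
Variable X : topologicalType.

Let dopenT : @delta_open X setT.
Proof. by move=> n sigma _; rewrite preimage_setT; exact: openT. Qed.

Let dopenI : setI_closed (@delta_open X).
Proof.
by move=> U V oU oV n s cs; rewrite preimage_setI; apply: openI;
  [exact: oU|exact: oV].
Qed.

Let dopen_bigU (I : Type) (f : I -> set X) :
  (forall i, delta_open (f i)) -> delta_open (\bigcup_i f i).
Proof.
by move=> oF n s cs; rewrite preimage_bigcup; apply: bigcup_open => i _;
  exact: oF.
Qed.

HB.instance Definition _ := Choice.copy (deltaification R X) X.
HB.instance Definition _ :=
  isOpenTopological.Build (deltaification R X) dopenT dopenI dopen_bigU.

End deltaification.

Lemma deltaification_openE (X : topologicalType) (U : set X) :
  open (U : set (deltaification R X)) = delta_open U.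
Proof. by []. Qed.

Lemma continuous_simplex_deltaification (X : topologicalType) n
    (sigma : std_simplex n -> X) :
  continuous sigma -> continuous (sigma : _ -> deltaification R X).
Proof. by move=> cs; apply/continuousP => U oU; exact: oU. Qed.

Lemma deltaification_generated (X : topologicalType) :
  delta_generated (deltaification R X).
Proof.
move=> U oU; rewrite deltaification_openE => n s cs; apply: oU.
exact: continuous_simplex_deltaification.
Qed.

Lemma deltaification_continuous (X Y : topologicalType) (f : X -> Y) :
  continuous f -> continuous (f : deltaification R X -> deltaification R Y).
Proof.
move=> cf; apply/continuousP => U; rewrite !deltaification_openE => oU n s cs.
by apply: (oU n (f \o s)) => x; apply: continuous_comp; [exact: cs|exact: cf].
Qed.

(* The category of all Delta-generated spaces; any space X is sent there by the
   coreflection [dg X], which does not change its weak homotopy type. *)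
Record dgspace := DGSpace {
  dg_space :> topologicalType;
  dg_generated : delta_generated dg_space
}.

Program Definition TopCat : category :=
  @Category dgspace (fun X Y => continuousType X Y) (fun X Y f g => f =1 g)
    (fun X => mkcts (fun x => cvg_id : {for x, continuous (@id X)}))
    (fun X Y Z g f => (g \o f : continuousType X Z))
    _ _ _ _ _ _ _.
Next Obligation. by []. Qed.
Next Obligation. by move=> X Y f g fg x; rewrite fg. Qed.
Next Obligation. by move=> X Y f g h fg gh x; rewrite fg gh. Qed.
Next Obligation. by move=> X Y Z g g' f f' gg ff x /=; rewrite ff gg. Qed.
Next Obligation. by []. Qed.
Next Obligation. by []. Qed.
Next Obligation. by []. Qed.

Definition dg (X : topologicalType) : TopCat :=
  DGSpace (@deltaification_generated X).

Definition dg_map (X Y : topologicalType) (f : X -> Y) (cf : continuous f) :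
    mor (dg X) (dg Y) :=
  mkcts (deltaification_continuous cf).

Definition unitI : set R := [set t | 0 <= t <= 1].

Lemma unitI0 : unitI 0.
Proof. by rewrite /unitI /= lexx ler01. Qed.

Lemma unitI1 : unitI 1.
Proof. by rewrite /unitI /= lexx ler01. Qed.

Definition unitI_zero : unitI := exist _ 0 (mem_set unitI0).
Definition unitI_one : unitI := exist _ 1 (mem_set unitI1).

Definition path_joined {X : topologicalType} (x y : X) : Prop :=
  exists gamma : unitI -> X,
    [/\ continuous gamma, gamma unitI_zero = x & gamma unitI_one = y].

Definition cube n : set 'rV[R]_n := [set c | forall i, 0 <= c 0 i <= 1].
Arguments cube : clear implicits.

Definition cube_boundary n : set (cube n) :=
  [set c : cube n | exists i,
    (val c : 'rV[R]_n) 0 i = 0 \/ (val c : 'rV[R]_n) 0 i = 1].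

(* Representatives of elements of the n-th homotopy group of (X, x). *)
Definition cube_loop n {X : topologicalType} (x : X) (a : cube n -> X) : Prop :=
  continuous a /\ forall c, cube_boundary c -> a c = x.

Definition homotopic_rel_boundary n {X : topologicalType}
    (a b : cube n -> X) : Prop :=
  exists H : cube n * unitI -> X,
    [/\ continuous H, forall c, H (c, unitI_zero) = a c,
        forall c, H (c, unitI_one) = b c &
        forall c t, cube_boundary c -> H (c, t) = a c].

(* f is bijective on path components and, for every basepoint and every degree
   at least 1, on homotopy groups (where it is automatically a morphism). *)
Definition weak_homotopy_equivalence {X Y : topologicalType} (f : X -> Y) :
    Prop :=
  [/\ continuous f,
      (forall x x' : X, path_joined (f x) (f x') -> path_joined x x') /\
      (forall y : Y, exists x : X, path_joined (f x) y) &
      forall n (x : X),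
        (forall a b : cube n.+1 -> X, cube_loop x a -> cube_loop x b ->
           homotopic_rel_boundary (f \o a) (f \o b) ->
           homotopic_rel_boundary a b) /\
        (forall b : cube n.+1 -> Y, cube_loop (f x) b ->
           exists2 a : cube n.+1 -> X,
             cube_loop x a & homotopic_rel_boundary (f \o a) b)].

Record strat_diagram := StratDiagram {
  diag_p : TopCat;
  diag_pq : TopCat;
  diag_q : TopCat;
  diag_to_p : mor diag_pq diag_p;
  diag_to_q : mor diag_pq diag_q
}.

Record diag_mor (D E : strat_diagram) := DiagHom {
  dhom_p : mor (diag_p D) (diag_p E);
  dhom_pq : mor (diag_pq D) (diag_pq E);
  dhom_q : mor (diag_q D) (diag_q E);
  dhom_to_p :
    mor_eq (hcomp dhom_p (diag_to_p D)) (hcomp (diag_to_p E) dhom_pq);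
  dhom_to_q :
    mor_eq (hcomp dhom_q (diag_to_q D)) (hcomp (diag_to_q E) dhom_pq)
}.

Program Definition diag_id (D : strat_diagram) : diag_mor D D :=
  @DiagHom D D (idm _) (idm _) (idm _) _ _.
Solve All Obligations with by [].

Program Definition diag_comp (D E F : strat_diagram) (g : diag_mor E F)
    (f : diag_mor D E) : diag_mor D F :=
  @DiagHom D F (hcomp (dhom_p g) (dhom_p f)) (hcomp (dhom_pq g) (dhom_pq f))
    (hcomp (dhom_q g) (dhom_q f)) _ _.
Next Obligation.
by move=> D E F g f x; have /= -> := dhom_to_p f x; have /= -> := dhom_to_p g _.
Qed.
Next Obligation.
by move=> D E F g f x; have /= -> := dhom_to_q f x; have /= -> := dhom_to_q g _.
Qed.

Definition diag_mor_eq (D E : strat_diagram) (f g : diag_mor D E) : Prop :=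
  [/\ mor_eq (dhom_p f) (dhom_p g), mor_eq (dhom_pq f) (dhom_pq g) &
      mor_eq (dhom_q f) (dhom_q g)].

Program Definition DiagP : category :=
  @Category strat_diagram diag_mor diag_mor_eq diag_id diag_comp
    _ _ _ _ _ _ _.
Next Obligation. by []. Qed.
Next Obligation.
by move=> D E f g [fp fl fq]; split=> x; rewrite (fp, fl, fq).
Qed.
Next Obligation.
move=> D E f g h [fp fl fq] [gp gl gq].
by split; [exact: mor_eq_trans fp gp|exact: mor_eq_trans fl gl|
           exact: mor_eq_trans fq gq].
Qed.
Next Obligation.
move=> D E F g g' f f' [gp gl gq] [fp fl fq].
by split; [exact: hcomp_eq gp fp|exact: hcomp_eq gl fl|exact: hcomp_eq gq fq].
Qed.
Next Obligation. by []. Qed.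
Next Obligation. by []. Qed.
Next Obligation. by []. Qed.

Definition diag_weq (D E : DiagP) (f : mor D E) : Prop :=
  [/\ weak_homotopy_equivalence (dhom_p f : diag_p D -> diag_p E),
      weak_homotopy_equivalence (dhom_pq f : diag_pq D -> diag_pq E) &
      weak_homotopy_equivalence (dhom_q f : diag_q D -> diag_q E)].

Definition HoDiagP (U : category) : category :=
  @localization (functor_cat U DiagP)
    (fun (F G : functor U DiagP) (a : nattrans F G) =>
       forall X, diag_weq (a X)).

End delta_generated.
Arguments cube {R} n.
Arguments std_simplex {R} n.

Section euclidean.
Variables (R : realType) (N : nat).
Local Notation E := 'rV[R]_N.
Implicit Types (x y : E) (A K : set E).

Definition enorm x : R := Num.sqrt (\sum_i (x 0 i) ^+ 2).

(* This is +oo when A is empty. *)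
Definition set_dist x A : \bar R := ereal_inf [set (enorm (x - y))%:E | y in A].

Lemma set_dist_ge0 x A : (0 <= set_dist x A)%E.
Proof.
by apply/ereal_infP => _ [y _ <-]; rewrite lee_fin sqrtr_ge0.
Qed.

Definition thickening A (alpha : R) : set E :=
  [set y | exists2 x, A x & enorm (x - y) <= alpha].

Definition convex_hull A : set E := smallest (@convex_set R E) A.

Definition critical K y : Prop :=
  ~ K y /\ convex_hull [set x | K x /\ (enorm (x - y))%:E = set_dist y K] y.

Definition weak_feature_size K : \bar R :=
  ereal_inf [set set_dist y K | y in critical K].

End euclidean.

(* An o-minimal structure expanding the ordered field R, in the sense of
   van den Dries: Def n is the collection of definable subsets of R^n. *)
Record o_minimal_structure (R : realType) (Def : forall n, set (set 'rV[R]_n))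
    : Prop := {
  def_set0 : forall n, Def n set0;
  def_setU : forall n A B, Def n A -> Def n B -> Def n (A `|` B);
  def_setC : forall n A, Def n A -> Def n (~` A);
  def_prodl : forall n A, Def n A ->
    Def (1 + n)%N [set x : 'rV[R]_(1 + n) | A (rsubmx x)];
  def_prodr : forall n A, Def n A ->
    Def (n + 1)%N [set x : 'rV[R]_(n + 1) | A (lsubmx x)];
  def_diag : forall n, Def n.+1 [set x | x 0 ord0 = x 0 ord_max];
  def_proj : forall n (A : set 'rV[R]_(n + 1)), Def (n + 1)%N A ->
    Def n [set lsubmx x | x in A];
  def_lt : Def 2%N [set x | x 0 0 < x 0 1];
  def_add : Def 3%N [set x | x 0 0 + x 0 1 = x 0 (inord 2)];
  def_mul : Def 3%N [set x | x 0 0 * x 0 1 = x 0 (inord 2)];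
  def_omin : forall A : set 'rV[R]_1,
    Def 1%N A <-> exists s : seq (interval R),
      A = [set x | has (fun i : interval R => x 0 0 \in i) s]
}.

Record Sam (R : realType) (N : nat) := MkSam {
  total_set : set 'rV[R]_N;
  pstratum : set 'rV[R]_N;
  pstratum_sub : pstratum `<=` total_set
}.

Section teardrop.
Context {R : realType} {L T : topologicalType}.

Definition half_open_unit : set R := [set t | 0 < t <= 1].

Lemma half_open_unit_sub : half_open_unit `<=` @unitI R.
Proof. by move=> t /andP[t0 t1]; rewrite /unitI /= ltW. Qed.

Definition teardrop (r : L -> T) : Type := ((L * half_open_unit) + T)%type.

Definition teardrop_proj (r : L -> T) (z : teardrop r) : T * @unitI R :=
  match z with
  | inl (l, t) => (r l, set_incl half_open_unit_sub t)
  | inr y => (y, unitI_zero R)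
  end.

(* A subbase whose members are the open subsets of L * ]0, 1] and the preimages
   of open sets under teardrop_proj. *)
Definition teardrop_subbase (r : L -> T) : set (set (teardrop r)) :=
  [set U | (exists2 V : set (L * half_open_unit), open V & U = inl @` V) \/
           (exists2 V : set (T * @unitI R),
              open V & U = @teardrop_proj r @^-1` V)].

HB.instance Definition _ (r : L -> T) :=
  Choice.copy (teardrop r) ((L * half_open_unit) + T)%type.
HB.instance Definition _ (r : L -> T) :=
  isSubBaseTopological.Build (teardrop r) (@teardrop_subbase r) id.

End teardrop.
Arguments teardrop R {L T} r.

Section stratified.
Variables (R : realType) (N : nat).
Local Notation E := 'rV[R]_N.
Implicit Types (S : Sam R N) (v : R * R).

Definition qstratum S : set E := total_set S `\` pstratum S.

Definition stratified S : Prop :=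
  exists2 C : set E, closed C & pstratum S = total_set S `&` C.

Definition definable (Def : forall n, set (set 'rV[R]_n)) S : Prop :=
  Def N (pstratum S) /\ Def N (qstratum S).

(* The map s of N(S) = (X, s); its values outside X are irrelevant. *)
Definition strat_dist S (x : E) : R :=
  fine (Order.min (set_dist x (pstratum S)) 1%E).

Definition strat_preimage S (J : set R) : set E :=
  [set x | total_set S x /\ J (strat_dist S x)].

Definition cylinder_neighborhood S : Prop :=
  exists Nb : set E,
    [/\ Nb `<=` total_set S,
        exists O : set E,
          [/\ open O, pstratum S `<=` O & O `&` total_set S `<=` Nb] &
        exists (L : topologicalType) (r : L -> pstratum S)
               (h : Nb -> teardrop R r),
          [/\ continuous r, homeomorphism h &
              forall x : Nb, pstratum S (val x) <-> exists y, h x = inr y]].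

Definition cylinder_interior S : Prop :=
  exists h : strat_preimage S `]0, 1[%classic ->
             strat_preimage S [set 2^-1] * [set` `]0, 1[%R : interval R],
    homeomorphism h /\ forall x, (val (h x).2 : R) = strat_dist S (val x).

Definition cylindrically_stratified S : Prop :=
  cylinder_neighborhood S /\ cylinder_interior S.

Definition Omega : set (R * R) := [set v | [/\ 0 < v.1, v.1 < v.2 & v.2 < 1]].

(* The entries of D_v(N(S)). *)
Definition entry_p S v : set E := strat_preimage S `[0, v.2]%classic.
Definition entry_pq S v : set E := strat_preimage S `[v.1, v.2]%classic.
Definition entry_q S v : set E := strat_preimage S `[v.1, 1]%classic.

Lemma strat_preimageS S (J K : set R) :
  J `<=` K -> strat_preimage S J `<=` strat_preimage S K.
Proof. by move=> JK x [Xx Jx]; split=> //; exact: JK. Qed.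

Lemma thickening_setS (A B : set E) (a : R) :
  A `<=` B -> thickening A a `<=` thickening B a.
Proof. by move=> AB y [x Ax xy]; exists x => //; exact: AB. Qed.

Lemma thickening_leS (A : set E) (a b : R) :
  a <= b -> thickening A a `<=` thickening A b.
Proof. by move=> ab y [x Ax xy]; exists x => //; exact: le_trans xy ab. Qed.

Lemma strat_dist_ge0 S x : 0 <= strat_dist S x.
Proof. by rewrite fine_ge0// le_min lee01 andbT set_dist_ge0. Qed.

Lemma strat_dist_le1 S x : strat_dist S x <= 1.
Proof.
rewrite -lee_fin /strat_dist fineK ?ge_min ?lexx ?orbT//.
by rewrite ge0_fin_numE ?gt_min ?ltry ?orbT// le_min lee01 andbT set_dist_ge0.
Qed.

Lemma entry_pq_sub_p S v : entry_pq S v `<=` entry_p S v.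
Proof.
move=> x [Xx] /=; rewrite in_itv/= => /andP[_ sx]; split=> //=.
by rewrite in_itv/= strat_dist_ge0.
Qed.

Lemma entry_pq_sub_q S v : entry_pq S v `<=` entry_q S v.
Proof.
move=> x [Xx] /=; rewrite in_itv/= => /andP[sx _]; split=> //=.
by rewrite in_itv/= strat_dist_le1 andbT.
Qed.

Definition incl_map (A B : set E) (AB : A `<=` B) :
    mor (dg R (set_type A)) (dg R (set_type B)) :=
  dg_map R (set_incl_continuous AB).

Definition thickened_diagram S v (a : R) : DiagP R :=
  StratDiagram
    (incl_map (thickening_setS (a := a) (@entry_pq_sub_p S v)))
    (incl_map (thickening_setS (a := a) (@entry_pq_sub_q S v))).

Program Definition thickened_diagram_map S v (a b : R) (ab : a <= b) :
    mor (thickened_diagram S v a) (thickened_diagram S v b) :=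
  @DiagHom R (thickened_diagram S v a) (thickened_diagram S v b)
    (incl_map (thickening_leS ab)) (incl_map (thickening_leS ab))
    (incl_map (thickening_leS ab)) _ _.
Next Obligation. by move=> S v a b ab x; exact: val_inj. Qed.
Next Obligation. by move=> S v a b ab x; exact: val_inj. Qed.

Definition Rplus : set R := [set a | 0 <= a].

Program Definition persistent_type S v : functor (poset_cat Rplus) (DiagP R) :=
  @Functor (poset_cat Rplus) (DiagP R)
    (fun a => thickened_diagram S v (val a))
    (fun a b ab => thickened_diagram_map S v ab) _ _ _.
Next Obligation. by move=> S v a b f g _; split=> x; exact: val_inj. Qed.
Next Obligation. by move=> S v a; split=> x; exact: val_inj. Qed.
Next Obligation. by move=> S v a b c g f; split=> x; exact: val_inj. Qed.

Definition Rplus_below (e : \bar R) : set R := [set a | 0 <= a /\ (a%:E < e)%E].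

Lemma Rplus_below_sub e : Rplus_below e `<=` Rplus.
Proof. by move=> a []. Qed.

Definition persistent_type_below S v (e : \bar R) :
    functor (poset_cat (Rplus_below e)) (DiagP R) :=
  comp_functor (persistent_type S v) (poset_incl (@Rplus_below_sub e)).

Definition path_space S : topologicalType :=
  {compact-open, @unitI R -> set_type (total_set S)}.

Definition holink S : set (path_space S) :=
  [set gamma | [/\ continuous (gamma : unitI (R := R) -> total_set S),
     pstratum S (val (gamma (unitI_zero R))) &
     forall t : @unitI R, 0 < (val t : R) -> qstratum S (val (gamma t))]].
Arguments holink : clear implicits.

Lemma path_eval_continuous S (t : @unitI R) :
  continuous (fun gamma : path_space S => gamma t).
Proof.
apply/continuousP => U oU.
have -> : (fun gamma : path_space S => gamma t) @^-1` U =
    [set gamma : path_space S | gamma @` [set t] `<=` U].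
  by apply/seteqP; split=> gamma /=; [move=> ? _ [_ -> <-]|apply; exists t].
exact: compact_open_open (@compact_set1 _ t) oU.
Qed.

Lemma holink_start S (gamma : holink S) :
  pstratum S (val ((val gamma : path_space S) (unitI_zero R))).
Proof. by case: (set_mem (valP gamma)). Qed.

Lemma holink_end S (gamma : holink S) :
  qstratum S (val ((val gamma : path_space S) (unitI_one R))).
Proof. by case: (set_mem (valP gamma)) => _ _; apply; exact: ltr01. Qed.

Definition holink_eval0 S (gamma : holink S) : pstratum S :=
  exist _ (val ((val gamma : path_space S) (unitI_zero R)))
    (mem_set (holink_start gamma)).

Definition holink_eval1 S (gamma : holink S) : qstratum S :=
  exist _ (val ((val gamma : path_space S) (unitI_one R)))
    (mem_set (holink_end gamma)).

Lemma holink_eval0_continuous S : continuous (@holink_eval0 S).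
Proof.
apply: (@continuous_to_set_type _ _ _ (@holink_eval0 S)).
apply: (continuous_fun_comp
  (f := fun g : holink S => (val g : path_space S) _)).
  apply: (continuous_fun_comp (g := fun g : path_space S => g _)).
    exact: (@continuous_set_val _ (holink S)).
  exact: path_eval_continuous.
exact: continuous_set_val.
Qed.

Lemma holink_eval1_continuous S : continuous (@holink_eval1 S).
Proof.
apply: (@continuous_to_set_type _ _ _ (@holink_eval1 S)).
apply: (continuous_fun_comp
  (f := fun g : holink S => (val g : path_space S) _)).
  apply: (continuous_fun_comp (g := fun g : path_space S => g _)).
    exact: (@continuous_set_val _ (holink S)).
  exact: path_eval_continuous.
exact: continuous_set_val.
Qed.

Definition stratification_diagram S : DiagP R :=
  StratDiagram (dg_map R (@holink_eval0_continuous S))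
    (dg_map R (@holink_eval1_continuous S)).

Definition structure_maps_weq_below S v (e : \bar R) : Prop :=
  forall (a b : poset_cat Rplus) (ab : mor a b),
    ((val b : R)%:E < e)%E -> diag_weq (fmap (persistent_type S v) ab).

Definition persistent_type_below_recovers S v (e : \bar R) : Prop :=
  isomorphic (C := HoDiagP R (poset_cat (Rplus_below e)))
    (persistent_type_below S v e)
    (const_functor (poset_cat (Rplus_below e)) (stratification_diagram S)).

Definition min_weak_feature_size S v : \bar R :=
  Order.min (weak_feature_size (entry_p S v))
    (Order.min (weak_feature_size (entry_pq S v))
       (weak_feature_size (entry_q S v))).

End stratified.

(* Main.v *)
Require Import Defs.
From mathcomp Require Import all_boot all_order all_algebra.
From mathcomp Require Import all_classical all_reals all_analysis.
From mathcomp Require finmap.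
From mathcomp Require Import ring lra.

(** The structure maps are inclusions of thickenings of the entries, which are
compact definable sets [K]; that they are weak equivalences and that the weak feature
sizes are positive are statements about a single such [K]. Away from critical points the
distance to [K] has an ascent direction, by separation of the point from the convex
hull of its nearest points ([separation_compact], [slope_gt_noncritical]); following
such directions downwards deforms the thickening of radius [b] into that of radius
[a], for [0 < a <= b] below the weak feature size ([descent_noncritical]).

The case [a = 0] and the positivity of the weak feature size need definability. Let
[M t] be the least slope of the distance at the level [t]. The points where this
slope is attained can be chosen along a curve whose coordinates are monotone near 0,
by the monotonicity theorem of o-minimality ([monotone_germ], [monotone_selection]);
such a curve has finite length, and this bounds [M] from below as in the
Kurdyka-Lojasiewicz inequality ([distance_slope_bound]). It follows that there are no
critical points near [K], and that the descents through the levels [a / 2 ^ k] have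
summable lengths, so that they converge to a retraction onto [K] ([collapse_onto],
[collapse_small]). This gives [weak_feature_size_gt0] and
[thickening_incl_weak_equivalence]. The entries are definable because their defining
conditions on the distance to the p-stratum are first order.

For the comparison with the stratification diagram it then suffices to treat the
entries themselves. Pushing along the open cylinder identifies the q-entry and the
middle entry up to weak equivalence with the q-stratum and with the p-entry punctured
along the p-stratum ([push_up_exists], [entries_const_isomorphic]). The mapping cylinder and the open cylinder together give
a deformation of the p-entry onto the p-stratum whose tracks, run backwards, are
homotopy links ([collapse_exists]). Hence the punctured p-entry is weakly equivalent
to the space of homotopy links inside the p-entry, by evaluation at the end
([weak_equivalence_short_holink_eval1]), and these are weakly equivalent to all
homotopy links, which can be shortened ([weak_equivalence_short_holink]). Evaluation
at all times connects the inclusion of the punctured entry with evaluation at the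
starting point ([holink_const_isomorphic]).

All weak equivalences come from homotopy inverses with compatible homotopies
([weak_equivalence_of_homotopy_inverse]) and persist under the coreflection into
Delta-generated spaces ([weak_equivalence_deltaification]). *)

Set Implicit Arguments.
Unset Strict Implicit.
Unset Printing Implicit Defensive.

Import Order.TTheory GRing.Theory Num.Theory.
Import numFieldNormedType.Exports.

Local Open Scope classical_set_scope.
Local Open Scope ring_scope.

(** * Continuity rules *)

Definition set_mk (T : Type) (A : set T) (x : T) (Ax : A x) : A :=
  exist _ x (mem_set Ax).

Lemma set_mkP (T : Type) (A : set T) (x : A) : A (val x).
Proof. exact: set_mem (valP x). Qed.

Section continuity_rules.
Variables (R : realType) (Z : topologicalType).
Implicit Types f g : Z -> R.

Lemma continuous_cst (Y : topologicalType) (y : Y) :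
  continuous (fun _ : Z => y).
Proof. exact: cst_continuous. Qed.

Lemma continuous_idfun : continuous (fun z : Z => z).
Proof. by move=> z; exact: cvg_id. Qed.

Lemma continuous_add f g :
  continuous f -> continuous g -> continuous (fun z => f z + g z).
Proof. by move=> cf cg z; apply: cvgD; [exact: cf|exact: cg]. Qed.

Lemma continuous_opp f : continuous f -> continuous (fun z => - f z).
Proof. by move=> cf z; apply: cvgN; exact: cf. Qed.

Lemma continuous_mul f g :
  continuous f -> continuous g -> continuous (fun z => f z * g z).
Proof. by move=> cf cg z; apply: cvgM; [exact: cf|exact: cg]. Qed.

Lemma continuous_inv f :
  (forall z, f z != 0) -> continuous f -> continuous (fun z => (f z)^-1).
Proof. by move=> f0 cf z; apply: cvgV => //; exact: cf. Qed.

Lemma continuous_abs f : continuous f -> continuous (fun z => `|f z|).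
Proof. by move=> cf z; apply: cvg_norm; exact: cf. Qed.

Lemma continuous_max f g :
  continuous f -> continuous g -> continuous (fun z => Num.max (f z) (g z)).
Proof.
move=> cf cg; under eq_fun do rewrite maxr_absE.
apply: continuous_mul; last exact: continuous_cst.
apply: continuous_add; first exact: continuous_add.
by apply: continuous_abs; apply: continuous_add => //; exact: continuous_opp.
Qed.

Lemma continuous_min f g :
  continuous f -> continuous g -> continuous (fun z => Num.min (f z) (g z)).
Proof.
move=> cf cg; under eq_fun do rewrite minr_absE.
apply: continuous_mul; last exact: continuous_cst.
apply: continuous_add; first exact: continuous_add.
apply: continuous_opp.
by apply: continuous_abs; apply: continuous_add => //; exact: continuous_opp.
Qed.

Lemma continuous_sum (I : finType) (F : I -> Z -> R) :
  (forall i, continuous (F i)) -> continuous (fun z => \sum_i F i z).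
Proof.
move=> cF; elim: (index_enum I) => [|i r IH].
  by under eq_fun do rewrite big_nil; exact: continuous_cst.
by under eq_fun do rewrite big_cons; exact: continuous_add.
Qed.

Lemma continuous_row n (F : Z -> 'rV[R]_n) :
  (forall i, continuous (fun z => F z 0 i)) -> continuous F.
Proof.
move=> cF z; apply/cvg_ballP => e e0.
have : \forall y \near z, forall i, ball (F z 0 i) e (F y 0 i).
  apply: filter_forall => i; have /cvg_ballP := cF i z; exact.
apply: filterS => y Fy; split => // i j; rewrite ord1; exact: Fy.
Qed.

Lemma continuous_coord n (F : Z -> 'rV[R]_n) i :
  continuous F -> continuous (fun z => F z 0 i).
Proof. by move=> cF; apply: continuous_fun_comp cF (@coord_continuous _ _ _ 0 i). Qed.

End continuity_rules.

Section general_continuity.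
Variables (Z X Y : topologicalType).

Lemma continuous_pair (f : Z -> X) (g : Z -> Y) :
  continuous f -> continuous g -> continuous (fun z => (f z, g z)).
Proof. by move=> cf cg z; apply: cvg_pair; [exact: cf|exact: cg]. Qed.

Lemma continuous_fst (f : Z -> X * Y) :
  continuous f -> continuous (fun z => (f z).1).
Proof. by move=> cf; apply: continuous_fun_comp cf _ => z; exact: cvg_fst. Qed.

Lemma continuous_snd (f : Z -> X * Y) :
  continuous f -> continuous (fun z => (f z).2).
Proof. by move=> cf; apply: continuous_fun_comp cf _ => z; exact: cvg_snd. Qed.

Lemma continuous_open_cover (f : Z -> X) :
  (forall z, exists2 U : set Z, open U /\ U z &
     continuous (fun u : U => f (val u))) -> continuous f.
Proof.
move=> cf; apply/continuousP => V oV; rewrite openE => z Vfz.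
have [U [oU Uz] cfU] := cf z.
have /continuousP/(_ V oV) [W oW WE] := cfU.
apply: (filterS (P := W `&` U)).
  move=> y [Wy Uy]; have : (set_val @^-1` W) (exist _ y (mem_set Uy)) by [].
  by rewrite WE.
apply: filterI; last exact: open_nbhs_nbhs.
apply: open_nbhs_nbhs; split => //.
have : [set u : U | V (f (val u))] (exist _ z (mem_set Uz)) by [].
by rewrite -[X in X _]WE.
Qed.

Lemma continuous_closed_cover (A B : set Z) (f : Z -> X) :
  closed A -> closed B -> (forall z, A z \/ B z) ->
  continuous (fun u : A => f (val u)) ->
  continuous (fun u : B => f (val u)) -> continuous f.
Proof.
move=> cA cB AB fA fB; apply/continuous_closedP => V cV.
have H (C : set Z) : closed C -> continuous (fun u : C => f (val u)) ->
    closed (C `&` f @^-1` V).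
  move=> cC fC; move/continuousP: fC => /(_ (~` V)) /(_ (closed_openC cV)) [W oW WE].
  suff -> : C `&` f @^-1` V = C `&` ~` W by apply: closedI => //; exact: open_closedC.
  apply/seteqP; split => y [Cy fy]; split => //.
    move=> Wy; have : (set_val @^-1` W) (exist _ y (mem_set Cy)) by [].
    by rewrite WE /=.
  apply: contrapT => nV; apply: fy.
  have : [set u : C | (~` V) (f (val u))] (exist _ y (mem_set Cy)) by [].
  by rewrite -[X in X _]WE.
have -> : f @^-1` V = (A `&` f @^-1` V) `|` (B `&` f @^-1` V).
  apply/seteqP; split => [y fy|y [[]|[]]//].
  by case: (AB y); [left|right].
by apply: closedU; apply: H.
Qed.

Lemma continuous_set_mk (A : set X) (f : Z -> X) (Af : forall z, A (f z)) :
  continuous f -> continuous (fun z => set_mk (Af z)).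
Proof. by move=> cf; apply: continuous_to_set_type. Qed.

End general_continuity.

Lemma continuous_if (R : realType) (Z X : topologicalType) (m : Z -> R) (c : R)
    (f g : Z -> X) :
  continuous m -> continuous f -> continuous g ->
  (forall z, m z = c -> f z = g z) ->
  continuous (fun z => if m z <= c then f z else g z).
Proof.
move=> cm cf cg fg.
apply: (@continuous_closed_cover _ _ [set z | m z <= c] [set z | c <= m z]).
- by apply: preimage_closed (@closed_le _ c) => z _; exact: cm.
- by apply: preimage_closed (@closed_ge _ c) => z _; exact: cm.
- by move=> z; case: (leP (m z) c) => h; [left|right; exact: ltW].
- have -> : (fun u : [set z | m z <= c] =>
      if m (val u) <= c then f (val u) else g (val u)) = fun u => f (val u).
    by apply/funext => -[u /= hu]; have := set_mem hu => /= ->.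
  apply: continuous_fun_comp cf; exact: continuous_set_val.
- have -> : (fun u : [set z | c <= m z] =>
      if m (val u) <= c then f (val u) else g (val u)) = fun u => g (val u).
    apply/funext => -[u /= hu]; have /= cu := set_mem hu; case: ifPn => // mc.
    by rewrite fg//; apply/eqP; rewrite eq_le mc cu.
  apply: continuous_fun_comp cg; exact: continuous_set_val.
Qed.

(** A head symbol for the tactics below to match on: [continuous] is a notation
for a quantification, in which the function no longer appears as an argument. *)
Definition cts (X Y : topologicalType) (f : X -> Y) : Prop := continuous f.

Lemma ctsP (X Y : topologicalType) (f : X -> Y) : cts f -> continuous f.
Proof. by []. Qed.

Lemma ctsI (X Y : topologicalType) (f : X -> Y) : continuous f -> cts f.
Proof. by []. Qed.

(** Continuity by structural recursion on the expression. Addition and opposite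
are ambiguous between scalars and vectors, and inner products, norms and scaling
belong to vectors only; these are passed on to the tactic [vec]. *)
Ltac cont_step vec := cbv beta; lazymatch goal with
  | |- cts (fun z => z) => apply: ctsI; exact: continuous_idfun
  | |- cts (fun _ => ?y) => apply: ctsI; exact: continuous_cst
  | |- cts (fun z => Algebra.add (@?f z) (@?g z)) =>
      first [apply: (@continuous_add _ _ f g); apply: ctsP | vec f g]
  | |- cts (fun z => Algebra.opp (@?f z)) =>
      first [apply: (@continuous_opp _ _ f); apply: ctsP | vec f f]
  | |- cts (fun z => GRing.mul (@?f z) (@?g z)) =>
      apply: (@continuous_mul _ _ f g); apply: ctsP
  | |- cts (fun z => Num.max (@?f z) (@?g z)) =>
      apply: (@continuous_max _ _ f g); apply: ctsP
  | |- cts (fun z => Num.min (@?f z) (@?g z)) =>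
      apply: (@continuous_min _ _ f g); apply: ctsP
  | |- cts (fun z => `|@?f z|) => apply: (@continuous_abs _ _ f); apply: ctsP
  | |- cts (fun z => (@?f z, @?g z)) =>
      apply: (@continuous_pair _ _ _ f g); apply: ctsP
  | |- cts (fun z => (@?f z).1) =>
      first [apply: ctsI; assumption | apply: (@continuous_fst _ _ _ f); apply: ctsP]
  | |- cts (fun z => (@?f z).2) =>
      first [apply: ctsI; assumption | apply: (@continuous_snd _ _ _ f); apply: ctsP]
  | |- cts (fun z => fun_of_matrix (@?f z) _ _) =>
      apply: (@continuous_coord _ _ _ f); apply: ctsP
  | |- cts (pair ?x) => apply: ctsI;
      exact: (continuous_pair (@continuous_cst _ _ x) (@continuous_idfun _))
  | |- cts fst => apply: ctsI; apply: continuous_fst; exact: continuous_idfun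
  | |- cts snd => apply: ctsI; apply: continuous_snd; exact: continuous_idfun
  | |- @cts ?X ?Y ?f => first [ apply: ctsI; assumption
      | apply: ctsI; exact: continuous_set_val | vec f f
      | apply: ctsI; apply: continuous_fun_comp _ (@continuous_set_val _ _);
        apply: ctsP ]
  end.

Ltac no_vec f g := fail.
Ltac cont := apply: ctsP; repeat cont_step no_vec.

(** The tube lemma. *)
Lemma compact_forall_near (X Y : topologicalType) (K : set X) (y : Y)
    (P : X -> Y -> Prop) : compact K ->
  (forall x, K x -> nbhs (x, y) [set q | P q.1 q.2]) ->
  nbhs y [set z | forall x, K x -> P x z].
Proof.
move=> /compact_near_coveringP cK h.
have := cK Y (nbhs y) (fun z x => P x z) (nbhs_filter y) h.
by apply: filterS => z hz x Kx; exact: hz.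
Qed.

Lemma continuous_dominated (R : realType) (Z : topologicalType) (f : Z -> R)
    (m : Z -> Z -> R) : (forall y, continuous (m y)) -> (forall y, m y y = 0) ->
  (forall y z, `|f y - f z| <= m y z) -> continuous f.
Proof.
move=> cm m0 fm y; apply/cvgrPdist_lt => e e0.
have /cvgrPdist_lt/(_ e e0) := cm y y; apply: filterS => z.
rewrite m0 sub0r normrN => h.
exact: le_lt_trans (fm y z) (le_lt_trans (ler_norm _) h).
Qed.

Lemma nbhs_preimage (Z X : topologicalType) (f : Z -> X) (U : set X)
    (Q : set Z) (z : Z) : continuous f -> open U -> U (f z) ->
  (forall z', U (f z') -> Q z') -> nbhs z Q.
Proof.
move=> cf oU Uz h; apply: (filterS (P := f @^-1` U)) => //.
by apply: cf; exact: open_nbhs_nbhs.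
Qed.

(** * Homotopies of cubes relative to the boundary *)

Section homotopy.
Variable R : realType.
Local Notation I := (@unitI R).
Local Notation i0 := (unitI_zero R).
Local Notation i1 := (unitI_one R).

Lemma unitIP (t : I) : 0 <= (val t : R) <= 1.
Proof. exact: set_mem (valP t). Qed.

Lemma clamp_unitI (t : R) : unitI (Num.max 0 (Num.min 1 t)).
Proof. by rewrite /unitI /= le_max lexx /= ge_max ler01 ge_min lexx. Qed.

Definition clamp (t : R) : I := set_mk (clamp_unitI t).

Lemma val_clamp t : 0 <= t <= 1 -> val (clamp t) = t.
Proof. by move=> /andP[t0 t1] /=; rewrite (min_idPr t1) (max_idPr t0). Qed.

Lemma clamp_val (t : I) : clamp (val t) = t.
Proof. by apply: val_inj; apply: val_clamp; exact: unitIP. Qed.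

Lemma clamp_le0 t : t <= 0 -> clamp t = i0.
Proof.
move=> t0; apply: val_inj => /=.
by apply/max_idPl; rewrite ge_min t0 orbT.
Qed.

Lemma clamp_ge1 t : 1 <= t -> clamp t = i1.
Proof.
move=> t1; apply: val_inj => /=.
by rewrite (min_idPl t1); apply/max_idPr; exact: ler01.
Qed.

Lemma continuous_clamp (Z : topologicalType) (f : Z -> R) :
  continuous f -> continuous (fun z => clamp (f z)).
Proof. by move=> cf; apply: continuous_to_set_type => /=; cont. Qed.

Lemma path_joined_sym (X : topologicalType) (x y : X) :
  path_joined R x y -> path_joined R y x.
Proof.
move=> [g [cg g0 g1]]; exists (fun t : I => g (clamp (1 - val t))); split.
- by apply: continuous_fun_comp cg; apply: continuous_clamp; cont.
- by rewrite clamp_ge1//= subr0.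
- by rewrite clamp_le0//= subrr.
Qed.

Lemma path_joined_trans (X : topologicalType) (x y z : X) :
  path_joined R x y -> path_joined R y z -> path_joined R x z.
Proof.
move=> [f [cf f0 f1]] [g [cg g0 g1]].
exists (fun t : I => if val t <= 2^-1 :> R then f (clamp (2 * val t))
                 else g (clamp (2 * val t - 1))); split.
- apply: continuous_if.
  + by cont.
  + by apply: continuous_fun_comp cf; apply: continuous_clamp; cont.
  + by apply: continuous_fun_comp cg; apply: continuous_clamp; cont.
  + move=> t ->; rewrite mulfV ?pnatr_eq0// subrr clamp_ge1// clamp_le0//.
    by rewrite f1 g0.
- by rewrite /= invr_ge0 ler0n mulr0 clamp_le0.
- rewrite /= ifF ?clamp_ge1 ?mulr1//; first lra.
  by apply/negbTE; rewrite -ltNge; lra.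
Qed.

(** Radial coordinates on the cube: [cube_radius] is the distance to the centre
in the supremum norm, scaled to be 1 on the boundary. *)
Section radial.
Variable n : nat.
Local Notation Q := (@cube R n).

Definition recenter (c : 'rV[R]_n) : 'rV[R]_n := \row_i (2 * c 0 i - 1).

Definition cube_radius (c : Q) : R := `|recenter (val c)|.

Lemma continuous_cube_radius : continuous cube_radius.
Proof.
apply: (continuous_fun_comp (g := fun x : 'rV[R]_n => `|x|));
  last exact: norm_continuous.
apply: continuous_row => i; under eq_fun do rewrite mxE; cont.
Qed.

Lemma cube_radius_ge (c : Q) i : `|2 * val c 0 i - 1| <= cube_radius c.
Proof.
rewrite /cube_radius /Num.Def.normr/= mx_normrE.
by apply/bigmax_geP; right; exists (ord0, i) => //=; rewrite mxE.
Qed.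

Lemma cubeP (c : Q) i : 0 <= val c 0 i <= 1.
Proof. exact: (set_mkP c i). Qed.

Lemma cube_radius_le1 (c : Q) : cube_radius c <= 1.
Proof.
rewrite /cube_radius /Num.Def.normr/= mx_normrE; apply/bigmax_leP; split => //= -[j i] _.
by rewrite mxE ler_norml /=; have := cubeP c i; lra.
Qed.

Lemma cube_radius_attained (c : Q) : cube_radius c != 0 ->
  exists i, `|2 * val c 0 i - 1| = cube_radius c.
Proof.
move=> c0; have [[j i] /= E] := mx_norm_neq0 c0.
by exists i; rewrite [cube_radius c]E mxE.
Qed.

Lemma cube_radius_boundary (c : Q) : cube_boundary c -> cube_radius c = 1.
Proof.
move=> [i ci]; apply/eqP; rewrite eq_le cube_radius_le1/=.
apply: le_trans (cube_radius_ge c i).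
by case: ci => ->; rewrite ?mulr0 ?sub0r ?normrN ?mulr1 ?normr1//
  (_ : 2 - 1 = 1) ?normr1//; lra.
Qed.

Definition stretch_factor (c : Q) : R := Num.max (cube_radius c) 2^-1.

Lemma stretch_factor_gt0 c : 0 < stretch_factor c.
Proof. by rewrite /stretch_factor lt_max invr_gt0 ltr0n orbT. Qed.

Lemma stretch_subproof (c : Q) :
  cube n (\row_i (((2 * val c 0 i - 1) / stretch_factor c + 1) / 2)).
Proof.
move=> i; rewrite mxE.
have : `|(2 * val c 0 i - 1) / stretch_factor c| <= 1.
  rewrite normrM normfV [X in _ / X]gtr0_norm ?stretch_factor_gt0//.
  rewrite ler_pdivrMr ?stretch_factor_gt0// mul1r /stretch_factor le_max.
  by rewrite cube_radius_ge.
by rewrite ler_norml => /andP[]; lra.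
Qed.

(** Doubles the inner half of the cube and retracts the outer collar radially
onto the boundary. *)
Definition stretch (c : Q) : Q := set_mk (stretch_subproof c).

Lemma continuous_stretch : continuous stretch.
Proof.
apply: continuous_to_set_type; apply: continuous_row => i /=.
under eq_fun do rewrite mxE.
have cs : continuous (fun c => (stretch_factor c)^-1).
  apply: continuous_inv => [c|]; first by rewrite gt_eqF// stretch_factor_gt0.
  by apply: continuous_max; [exact: continuous_cube_radius|cont].
by cont.
Qed.

Lemma stretch_boundary (c : Q) : cube_boundary c -> stretch c = c.
Proof.
move=> /cube_radius_boundary c1; apply: val_inj; apply/rowP => i /=.
have -> : stretch_factor c = 1 by rewrite /stretch_factor c1 max_l//; lra.
by rewrite mxE divr1; lra.
Qed.

Lemma stretch_collar (c : Q) : 2^-1 <= cube_radius c -> cube_boundary (stretch c).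
Proof.
move=> cc; have c0 : 0 < cube_radius c by lra.
have [i ci] : exists i, `|2 * val c 0 i - 1| = cube_radius c.
  by apply: cube_radius_attained; rewrite gt_eqF.
exists i => /=; rewrite mxE /stretch_factor max_l//.
have [h|h] := leP 0 (2 * val c 0 i - 1).
  by right; rewrite -ci ger0_norm// divff; [lra|rewrite -(ger0_norm h) ci gt_eqF].
left; rewrite -ci ltr0_norm// invrN mulrN divff; [lra|by rewrite lt_eqF].
Qed.

(** The time at which a homotopy runs on the collar: it starts on the boundary of
the cube and is complete on the inner half. *)
Definition collar_time (c : Q) : I := clamp (2 * (1 - cube_radius c)).

Lemma continuous_collar_time : continuous collar_time.
Proof.
by apply: continuous_clamp; have := continuous_cube_radius; move=> ?; cont.
Qed.

Lemma collar_time_boundary (c : Q) : cube_boundary c -> collar_time c = i0.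
Proof. by move=> /cube_radius_boundary c1; apply: clamp_le0; lra. Qed.

Lemma collar_time_inner (c : Q) : cube_radius c <= 2^-1 -> collar_time c = i1.
Proof. by move=> ?; apply: clamp_ge1; lra. Qed.

Lemma cube_convex (t : I) (c d : Q) :
  cube n (\row_i ((1 - val t) * val c 0 i + val t * val d 0 i)).
Proof.
move=> i; rewrite mxE; have := unitIP t; have := cubeP c i; have := cubeP d i.
by move=> /andP[d0 d1] /andP[c0 c1] /andP[t0 t1]; nra.
Qed.

Definition cube_mix (c d : Q) (t : I) : Q := set_mk (cube_convex t c d).

Lemma continuous_cube_mix (Z : topologicalType) (c d : Z -> Q) (t : Z -> I) :
  continuous c -> continuous d -> continuous t ->
  continuous (fun z => cube_mix (c z) (d z) (t z)).
Proof.
move=> cc cd ct; apply: continuous_to_set_type; apply: continuous_row => i /=.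
under eq_fun do rewrite mxE.
have ccv : continuous (fun z => val (c z)) by apply: continuous_fun_comp cc _; exact: continuous_set_val.
have cdv : continuous (fun z => val (d z)) by apply: continuous_fun_comp cd _; exact: continuous_set_val.
have ctv : continuous (fun z => val (t z)) by apply: continuous_fun_comp ct _; exact: continuous_set_val.
by cont.
Qed.

Lemma cube_mix0 c d : cube_mix c d i0 = c.
Proof. by apply: val_inj; apply/rowP => i; rewrite mxE/=; lra. Qed.

Lemma cube_mix1 c d : cube_mix c d i1 = d.
Proof. by apply: val_inj; apply/rowP => i; rewrite mxE/=; lra. Qed.

Lemma cube_mixx c t : cube_mix c c t = c.
Proof. by apply: val_inj; apply/rowP => i; rewrite mxE/=; lra. Qed.

Section rel_boundary.
Variable X : topologicalType.
Implicit Types a b : Q -> X.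

Lemma homotopic_sym a b :
  homotopic_rel_boundary a b -> homotopic_rel_boundary b a.
Proof.
move=> [H [cH H0 H1 Hb]]; exists (fun p : Q * I => H (p.1, clamp (1 - val p.2))); split.
- apply: continuous_fun_comp cH; apply: continuous_pair; first by cont.
  apply: continuous_clamp; apply: continuous_add; first by cont.
  by apply: continuous_opp; apply: continuous_fun_comp _ (@continuous_set_val _ _); cont.
- by move=> c /=; rewrite subr0 clamp_ge1.
- by move=> c /=; rewrite subrr clamp_le0.
- by move=> c t bc /=; rewrite Hb// -H1 (Hb c i1).
Qed.

Lemma homotopic_trans a b (c : Q -> X) : homotopic_rel_boundary a b ->
  homotopic_rel_boundary b c -> homotopic_rel_boundary a c.
Proof.
move=> [H [cH H0 H1 Hb]] [K [cK K0 K1 Kb]].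
have cv : continuous (fun p : Q * I => val p.2 : R).
  by apply: continuous_fun_comp _ (@continuous_set_val _ _); cont.
exists (fun p : Q * I => if val p.2 <= 2^-1 :> R then H (p.1, clamp (2 * val p.2))
                 else K (p.1, clamp (2 * val p.2 - 1))); split.
- apply: continuous_if => //.
  + apply: continuous_fun_comp cH; apply: continuous_pair; first by cont.
    by apply: continuous_clamp; cont.
  + apply: continuous_fun_comp cK; apply: continuous_pair; first by cont.
    by apply: continuous_clamp; cont.
  + move=> t ->; rewrite mulfV ?pnatr_eq0// subrr clamp_ge1// clamp_le0//.
    by rewrite H1 K0.
- by move=> d; rewrite /= invr_ge0 ler0n mulr0 clamp_le0.
- move=> d; rewrite /= ifF ?clamp_ge1 ?mulr1//; first lra.
  by apply/negbTE; rewrite -ltNge; lra.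
- move=> d t bd /=; case: ifP => _; first exact: Hb.
  by rewrite Kb// -H1 Hb.
Qed.

Lemma homotopic_stretch a : continuous a ->
  homotopic_rel_boundary a (fun c => a (stretch c)).
Proof.
move=> ca; exists (fun p : Q * I => a (cube_mix p.1 (stretch p.1) p.2)); split.
- apply: continuous_fun_comp ca; apply: continuous_cube_mix; try by cont.
  by apply: continuous_fun_comp _ continuous_stretch; cont.
- by move=> c; rewrite cube_mix0.
- by move=> c; rewrite cube_mix1.
- by move=> c t bc; rewrite stretch_boundary// cube_mixx.
Qed.

(** Running a homotopy [F] on the collar only: the boundary stays put. *)
Lemma homotopic_collar (F : X * I -> X) a : continuous F -> continuous a ->
  (forall x, F (x, i0) = x) ->
  homotopic_rel_boundary a (fun c => F (a (stretch c), collar_time c)).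
Proof.
move=> cF ca F0; apply: homotopic_trans (homotopic_stretch ca) _.
exists (fun p : Q * I => F (a (stretch p.1), clamp (val p.2 * val (collar_time p.1)))).
have cv : continuous (fun p : Q * I => val p.2 : R).
  by apply: continuous_fun_comp _ (@continuous_set_val _ _); cont.
split.
- apply: continuous_fun_comp cF; apply: continuous_pair.
    apply: continuous_fun_comp ca; apply: continuous_fun_comp _ continuous_stretch.
    by cont.
  apply: continuous_clamp; apply: continuous_mul => //.
  apply: continuous_fun_comp _ (@continuous_set_val _ _).
  by apply: continuous_fun_comp _ continuous_collar_time; cont.
- by move=> c; rewrite /= mul0r clamp_le0.
- by move=> c; rewrite /= mul1r -[X in clamp X]/(val (collar_time c)) clamp_val.
- by move=> c t bc; rewrite collar_time_boundary//= mulr0 clamp_le0.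
Qed.

End rel_boundary.
End radial.
End homotopy.

(** * A criterion for weak homotopy equivalences *)

Section weak_equivalence_criterion.
Variable R : realType.
Local Notation I := (@unitI R).
Local Notation i0 := (unitI_zero R).
Local Notation i1 := (unitI_one R).

Lemma path_of_homotopy (X : topologicalType) (F : X * I -> X) x :
  continuous F -> path_joined R (F (x, i0)) (F (x, i1)).
Proof.
move=> cF; exists (fun t => F (x, t)); split => //.
by apply: continuous_fun_comp cF; cont.
Qed.

Section criterion.
Variables (X Y : topologicalType) (f : X -> Y) (g : Y -> X).
Variables (HX : X * I -> X) (HY : Y * I -> Y).
Hypotheses (cf : continuous f) (cg : continuous g).
Hypotheses (cHX : continuous HX) (cHY : continuous HY).
Hypotheses (HX0 : forall x, HX (x, i0) = x) (HX1 : forall x, HX (x, i1) = g (f x)).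
Hypotheses (HY0 : forall y, HY (y, i0) = y) (HY1 : forall y, HY (y, i1) = f (g y)).
Hypothesis fH : forall x t, f (HX (x, t)) = HY (f x, t).

Section lift.
Variables (n : nat) (Z : topologicalType).
Local Notation Q := (@cube R n).

(** A family of cubes in Y whose boundaries are all at [f x] lifts along [g],
with the collar running back from [g (f x)] to [x]. *)
Definition collar_lift (x : X) (b : Q * Z -> Y) (p : Q * Z) : X :=
  if cube_radius p.1 <= 2^-1 then g (b (stretch p.1, p.2))
  else HX (x, collar_time p.1).

Lemma continuous_collar_lift x b : continuous b ->
  (forall c z, cube_boundary c -> b (c, z) = f x) ->
  continuous (collar_lift x b).
Proof.
move=> cb bx; apply: continuous_if.
- by apply: continuous_fun_comp (@continuous_cube_radius _ _); cont.
- apply: continuous_fun_comp cg; apply: continuous_fun_comp cb.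
  apply: continuous_pair; last by cont.
  by apply: continuous_fun_comp (@continuous_stretch _ _); cont.
- apply: continuous_fun_comp cHX; apply: continuous_pair; first by cont.
  by apply: continuous_fun_comp (@continuous_collar_time _ _); cont.
- move=> [c z] /= cc; rewrite bx; last by apply: stretch_collar; rewrite cc.
  by rewrite collar_time_inner ?cc.
Qed.

Lemma collar_lift_boundary x b c z : cube_boundary c ->
  collar_lift x b (c, z) = x.
Proof.
move=> bc; rewrite /collar_lift /= (cube_radius_boundary bc) ifF.
  by rewrite collar_time_boundary.
by apply/negbTE; rewrite -ltNge; lra.
Qed.

End lift.

(** The inverse [g] moves basepoints, so that cubes cannot simply be carried back
by it: a cube in [Y] based at [f x] becomes one based at [g (f x)], and the track
of [x] under [HX] is attached to it as a collar. The compatibility [fH] makes [f]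
send this collar to the corresponding collar of [HY], which can be contracted;
hence no change of basepoint enters the statement. *)
Lemma weak_equivalence_of_homotopy_inverse : weak_homotopy_equivalence R f.
Proof.
have gX x : path_joined R x (g (f x)).
  by rewrite -{1}(HX0 x) -HX1; exact: path_of_homotopy.
have gY y : path_joined R y (f (g y)).
  by rewrite -{1}(HY0 y) -HY1; exact: path_of_homotopy.
split => //.
  split=> [x x' [p [cp p0 p1]]|y]; last first.
    by exists (g y); exact: path_joined_sym.
  apply: path_joined_trans (gX x) _; apply: path_joined_trans (path_joined_sym (gX x')).
  exists (g \o p); rewrite /= p0 p1; split => //; exact: continuous_fun_comp cp cg.
move=> n x; split=> [a b [ca ax] [cb bx] [K [cK K0 K1 Kb]]|b [cb bx]].
  have Kx c t : cube_boundary c -> K (c, t) = f x.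
    by move=> bc; rewrite Kb//= ax.
  have aE (a' : cube n.+1 -> X) t : (forall c, cube_boundary c -> a' c = x) ->
      (forall c, K (c, t) = f (a' c)) ->
      (fun c => HX (a' (stretch c), collar_time c)) =
      (fun c => collar_lift x K (c, t)).
    move=> a'x Ka'; apply/funext => c; rewrite /collar_lift /=.
    case: ifPn => [h|]; first by rewrite collar_time_inner// HX1 Ka'.
    by rewrite -ltNge => /ltW h; rewrite a'x//; exact: stretch_collar.
  apply: homotopic_trans (homotopic_collar cHX ca HX0) _.
  apply/homotopic_sym; apply: homotopic_trans (homotopic_collar cHX cb HX0) _.
  apply/homotopic_sym; rewrite (aE a i0)// (aE b i1)//.
  exists (collar_lift x K); split => //; first exact: continuous_collar_lift.
  by move=> c t bc; rewrite !collar_lift_boundary.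
pose a c := collar_lift x (fun p : cube n.+1 * I => b p.1) (c, i0).
have cb' : continuous (fun p : cube n.+1 * I => b p.1).
  by apply: continuous_fun_comp cb; cont.
have ca : continuous a.
  apply: continuous_fun_comp (continuous_collar_lift (x := x) cb' _); first by cont.
  by move=> c t bc /=; rewrite bx.
exists a; first by split => // c bc; exact: collar_lift_boundary.
suff -> : f \o a = fun c => HY (b (stretch c), collar_time c).
  by apply/homotopic_sym; exact: homotopic_collar.
apply/funext => c; rewrite /= /a /collar_lift /=.
case: ifPn => [h|]; first by rewrite collar_time_inner// HY1.
by rewrite -ltNge => /ltW h; rewrite fH bx//; exact: stretch_collar.
Qed.

End criterion.

(** The coreflection does not change weak homotopy types: cubes and their
cylinders are retracts of simplices, so they do not see the difference. *)
Section coreflection.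

Lemma delta_generated_retract n (Z : topologicalType)
    (r : @std_simplex R n -> Z) (s : Z -> @std_simplex R n) :
  continuous r -> continuous s -> cancel s r -> delta_generated R Z.
Proof.
move=> cr cs srK U oU; have := oU n r cr.
move/continuousP : cs => /[apply].
by congr open; apply/seteqP; split => z; rewrite /= srK.
Qed.

Lemma continuous_to_deltaification (Z X : topologicalType) (f : Z -> X) :
  delta_generated R Z -> continuous f ->
  continuous (f : Z -> deltaification R X).
Proof.
move=> dZ cf; apply/continuousP => U oU; apply: dZ => n s cs.
by apply: (oU n (f \o s)); exact: continuous_fun_comp cs cf.
Qed.

Lemma continuous_of_deltaification (Z X : topologicalType) (f : Z -> X) :
  continuous (f : Z -> deltaification R X) -> continuous f.
Proof.
move=> /continuousP cf; apply/continuousP => U oU; apply: cf.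
by change (delta_open R U) => n s /continuousP; exact.
Qed.

(** Scaled by [1 / n], the cube embeds in the simplex by the last [n] barycentric
coordinates; scaling back and truncating retracts the simplex onto it. *)
Lemma simplex_of_cube_subproof n (c : @cube R n) : @std_simplex R n
  (\row_(i < n.+1) if unlift ord0 i is Some j then val c 0 j / n%:R
                   else 1 - \sum_j val c 0 j / n%:R).
Proof.
have s1 : \sum_j val c 0 j / n%:R <= 1.
  case: n c => [|n] c; first by rewrite big_ord0.
  rewrite -mulr_suml ler_pdivrMr ?ltr0n// mul1r.
  rewrite -[X in _ <= X%:R]card_ord -sumr_const; apply: ler_sum => i _.
  by have /andP[] := cubeP c i.
split=> [i|]; first rewrite mxE.
  case: unliftP => [j _|_]; last by rewrite subr_ge0.
  by apply: divr_ge0 => //; have /andP[] := cubeP c j.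
rewrite big_ord_recl mxE unlift_none.
under [X in _ + X]eq_bigr do rewrite mxE liftK.
by rewrite subrK.
Qed.

Definition simplex_of_cube n (c : @cube R n) : @std_simplex R n :=
  set_mk (simplex_of_cube_subproof c).

Lemma cube_of_simplex_subproof n (x : @std_simplex R n) :
  @cube R n (\row_j val (clamp (n%:R * val x 0 (lift ord0 j)))).
Proof. by move=> i; rewrite mxE; exact: unitIP. Qed.

Definition cube_of_simplex n (x : @std_simplex R n) : @cube R n :=
  set_mk (cube_of_simplex_subproof x).

Lemma simplex_of_cubeK n : cancel (@simplex_of_cube n) (@cube_of_simplex n).
Proof.
move=> c; apply: val_inj; apply/rowP => j.
rewrite [LHS]mxE [val (simplex_of_cube c)]/= mxE liftK.
rewrite mulrC divfK; last by case: n c j => [c []|? ? ?] //; rewrite pnatr_eq0.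
by rewrite val_clamp//; exact: cubeP.
Qed.

Lemma continuous_simplex_of_cube n : continuous (@simplex_of_cube n).
Proof.
apply: continuous_to_set_type; apply: continuous_row => i /=.
under eq_fun do rewrite mxE.
have cc j : continuous (fun c : @cube R n => val c 0 j / n%:R) by cont.
case: unliftP => [j _|_]; first exact: cc.
by apply: continuous_add; [cont|apply: continuous_opp; exact: continuous_sum].
Qed.

Lemma continuous_cube_of_simplex n : continuous (@cube_of_simplex n).
Proof.
apply: continuous_to_set_type; apply: continuous_row => i /=.
by under eq_fun do rewrite mxE; cont.
Qed.

Lemma delta_generated_cube n : delta_generated R (@cube R n).
Proof.
exact: delta_generated_retract (@continuous_cube_of_simplex n)
  (@continuous_simplex_of_cube n) (@simplex_of_cubeK n).
Qed.

Lemma delta_generated_via_cube n (Z : topologicalType) (r : @cube R n -> Z) s :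
  continuous r -> continuous s -> cancel s r -> delta_generated R Z.
Proof.
move=> cr cs srK.
apply: (@delta_generated_retract n _ (r \o @cube_of_simplex n) (@simplex_of_cube n \o s)).
- exact: continuous_fun_comp (@continuous_cube_of_simplex n) cr.
- exact: continuous_fun_comp cs (@continuous_simplex_of_cube n).
- by move=> z /=; rewrite simplex_of_cubeK srK.
Qed.

Lemma cube_snoc_subproof n (p : @cube R n * I) : @cube R n.+1
  (\row_(i < n.+1) if unlift ord0 i is Some j then val p.1 0 j else val p.2).
Proof.
move=> i; rewrite mxE; case: unliftP => [j _|_]; first exact: cubeP.
exact: unitIP.
Qed.

Lemma delta_generated_cube_cylinder n :
  delta_generated R (@cube R n * I)%type.
Proof.
pose s p : @cube R n.+1 := set_mk (@cube_snoc_subproof n p).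
have tP (c : @cube R n.+1) : @cube R n (\row_j val c 0 (lift ord0 j)).
  by move=> i; rewrite mxE; exact: cubeP.
pose r (c : @cube R n.+1) : @cube R n * I :=
  (set_mk (tP c), set_mk (cubeP c ord0 : unitI _)).
apply: (@delta_generated_via_cube n.+1 _ r s).
- apply: continuous_pair; apply: continuous_to_set_type => /=; last by cont.
  by apply: continuous_row => i; under eq_fun do rewrite mxE; cont.
- apply: continuous_to_set_type; apply: continuous_row => i /=.
  under eq_fun do rewrite mxE.
  case: unliftP => [j _|_].
    by apply: continuous_coord; apply: continuous_fun_comp _ (@continuous_set_val _ _); cont.
  by apply: continuous_fun_comp _ (@continuous_set_val _ _); cont.
- move=> [c t]; congr pair; apply: val_inj; last first.
    by rewrite /= mxE unlift_none.
  by apply/rowP => j; rewrite /= mxE mxE liftK.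
Qed.

Lemma delta_generated_unitI : delta_generated R I.
Proof.
have sP (t : I) : @cube R 1 (\row_j val t) by move=> i; rewrite mxE; exact: unitIP.
apply: (@delta_generated_via_cube 1 _
   (fun c => set_mk (cubeP c ord0 : unitI _)) (fun t => set_mk (sP t))).
- by apply: continuous_to_set_type => /=; cont.
- by apply: continuous_to_set_type; apply: continuous_row => i /=;
    under eq_fun do rewrite mxE; cont.
- by move=> t; apply: val_inj; rewrite /= mxE.
Qed.

Lemma deltaification_path_joined (X : topologicalType) (x y : X) :
  path_joined R (x : deltaification R X) y <-> path_joined R x y.
Proof.
split=> -[p [cp p0 p1]]; exists p; split => //.
  exact: continuous_of_deltaification.
by apply: continuous_to_deltaification cp; exact: delta_generated_unitI.
Qed.

Lemma deltaification_homotopic (X : topologicalType) n (a b : @cube R n -> X) :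
  homotopic_rel_boundary (X := deltaification R X) a b <->
  homotopic_rel_boundary a b.
Proof.
split=> -[H [cH H0 H1 Hb]]; exists H; split => //.
  exact: continuous_of_deltaification.
by apply: continuous_to_deltaification cH; exact: delta_generated_cube_cylinder.
Qed.

Lemma deltaification_cube_loop (X : topologicalType) n (x : X)
    (a : @cube R n -> X) :
  cube_loop (X := deltaification R X) x a <-> cube_loop x a.
Proof.
split=> -[ca ax]; split => //; first exact: continuous_of_deltaification.
by apply: continuous_to_deltaification ca; exact: delta_generated_cube.
Qed.

Lemma weak_equivalence_deltaification (X Y : topologicalType) (f : X -> Y) :
  weak_homotopy_equivalence R f ->
  weak_homotopy_equivalence R (f : deltaification R X -> deltaification R Y).
Proof.
move=> [cf [inj0 surj0] pin]; split; first exact: deltaification_continuous.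
  split=> [x x' /deltaification_path_joined p|y].
    by apply/deltaification_path_joined/inj0.
  by have [x p] := surj0 y; exists x; apply/deltaification_path_joined.
move=> n x; have [injn surjn] := pin n x; split.
  move=> a b /deltaification_cube_loop la /deltaification_cube_loop lb.
  by move=> /deltaification_homotopic h; apply/deltaification_homotopic/injn.
move=> b /deltaification_cube_loop lb; have [a la h] := surjn b lb.
by exists a; [exact/deltaification_cube_loop|exact/deltaification_homotopic].
Qed.

End coreflection.
End weak_equivalence_criterion.

(** * The distance to a compact set *)

Section euclidean_norm.
Variables (R : realType) (N : nat).
Local Notation E := 'rV[R]_N.
Implicit Types x y w : E.

Definition dot x y : R := \sum_i x 0 i * y 0 i.

Lemma dotC x y : dot x y = dot y x.
Proof. by apply: eq_bigr => i _; rewrite mulrC. Qed.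

Lemma dotDl x y w : dot (x + y) w = dot x w + dot y w.
Proof. by rewrite -big_split; apply: eq_bigr => i _; rewrite mxE mulrDl. Qed.

Lemma dotZl k x y : dot (k *: x) y = k * dot x y.
Proof. by rewrite mulr_sumr; apply: eq_bigr => i _; rewrite mxE mulrA. Qed.

Lemma dotNl x y : dot (- x) y = - dot x y.
Proof. by rewrite -scaleN1r dotZl mulN1r. Qed.

Lemma dotDr x y w : dot w (x + y) = dot w x + dot w y.
Proof. by rewrite dotC dotDl !(dotC w). Qed.

Lemma dotZr k x y : dot x (k *: y) = k * dot x y.
Proof. by rewrite dotC dotZl dotC. Qed.

Lemma dotNr x y : dot x (- y) = - dot x y.
Proof. by rewrite dotC dotNl dotC. Qed.

Definition dotE := (dotDl, dotDr, dotNl, dotNr, dotZl, dotZr).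

Lemma dot_ge0 x : 0 <= dot x x.
Proof. by apply: sumr_ge0 => i _; rewrite -expr2 sqr_ge0. Qed.

Lemma dot_eq0 x : dot x x = 0 -> x = 0.
Proof.
move=> /eqP; rewrite psumr_eq0 => [/allP h|i _]; last by rewrite -expr2 sqr_ge0.
apply/rowP => i; rewrite mxE; have := h i (mem_index_enum _).
by rewrite -expr2 sqrf_eq0 => /eqP.
Qed.

Lemma sqr_enorm x : enorm x ^+ 2 = dot x x.
Proof.
rewrite sqr_sqrtr; last by apply: sumr_ge0 => i _; rewrite sqr_ge0.
by apply: eq_bigr => i _; rewrite expr2.
Qed.

Lemma enorm_ge0 x : 0 <= enorm x.
Proof. exact: sqrtr_ge0. Qed.

Lemma enormE x : enorm x = Num.sqrt (dot x x).
Proof. by rewrite -sqr_enorm sqrtr_sqr ger0_norm// enorm_ge0. Qed.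

Lemma enormN x : enorm (- x) = enorm x.
Proof. by rewrite !enormE !dotE opprK. Qed.

Lemma enormB x y : enorm (x - y) = enorm (y - x).
Proof. by rewrite -enormN opprB. Qed.

Lemma enorm0 : enorm (0 : E) = 0.
Proof. by rewrite enormE -(scale0r 0) dotZl mul0r sqrtr0. Qed.

Lemma enorm_eq0 x : enorm x = 0 -> x = 0.
Proof. by move=> x0; apply: dot_eq0; rewrite -sqr_enorm x0 expr0n. Qed.

Lemma ler_enorm x y : (enorm x <= enorm y) = (dot x x <= dot y y).
Proof. by rewrite -!sqr_enorm ler_sqr// nnegrE enorm_ge0. Qed.

Lemma enorm_le x r : 0 <= r -> (enorm x <= r) = (dot x x <= r ^+ 2).
Proof. by move=> r0; rewrite -sqr_enorm ler_sqr// nnegrE enorm_ge0. Qed.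

Lemma dot_le_enorm x y : dot x y <= enorm x * enorm y.
Proof.
have [y0|y0] := eqVneq (enorm y) 0.
  have {1}-> := enorm_eq0 y0.
  by rewrite y0 mulr0 -(scale0r 0) dotZr mul0r.
have yp : 0 < enorm y by rewrite lt_def y0 enorm_ge0.
suff : (dot x y) ^+ 2 <= (enorm x * enorm y) ^+ 2.
  move=> h; have [d0|d0] := leP 0 (dot x y).
    by move: h; rewrite ler_sqr// nnegrE mulr_ge0// enorm_ge0.
  by apply: (le_trans (ltW d0)); rewrite mulr_ge0// enorm_ge0.
have := dot_ge0 (dot y y *: x - dot x y *: y).
rewrite !dotE (dotC y x) exprMn !sqr_enorm.
have : 0 < dot y y by rewrite -sqr_enorm exprn_gt0.
set a := dot x x; set b := dot x y; set c := dot y y => c0.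
move=> h; suff : 0 <= c * (a * c - b ^+ 2) by rewrite pmulr_rge0// subr_ge0.
by apply: le_trans h _; rewrite le_eqVlt; apply/orP; left; apply/eqP; ring.
Qed.

Lemma enorm_triangle x y : enorm (x + y) <= enorm x + enorm y.
Proof.
rewrite enorm_le; last by rewrite addr_ge0// enorm_ge0.
rewrite !dotE (dotC y x) sqrrD !sqr_enorm.
by have := dot_le_enorm x y; lra.
Qed.

Lemma enormZ k x : enorm (k *: x) = `|k| * enorm x.
Proof.
by rewrite !enormE !dotE mulrA -expr2 sqrtrM ?sqr_ge0// sqrtr_sqr.
Qed.

Lemma coord_le_enorm x i : `|x 0 i| <= enorm x.
Proof.
rewrite -sqrtr_sqr ler_wsqrtr// (bigD1 i)//= lerDl.
by apply: sumr_ge0 => j _; rewrite sqr_ge0.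
Qed.

Lemma norm_le_enorm x : `|x| <= enorm x.
Proof.
rewrite /Num.Def.normr/= mx_normrE; apply/bigmax_leP; split => [|[j i] _ /=].
  exact: enorm_ge0.
by rewrite ord1 coord_le_enorm.
Qed.

Lemma enorm_sum (T : Type) (s : seq T) (F : T -> E) :
  enorm (\sum_(i <- s) F i) <= \sum_(i <- s) enorm (F i).
Proof.
elim: s => [|i s IH]; first by rewrite !big_nil enorm0.
by rewrite !big_cons; apply: le_trans (enorm_triangle _ _) _; rewrite lerD2l.
Qed.

Section continuity.
Variable Z : topologicalType.

Lemma continuous_dot (f g : Z -> E) :
  continuous f -> continuous g -> continuous (fun z => dot (f z) (g z)).
Proof.
by move=> cf cg; apply: continuous_sum => i; apply: continuous_mul;
  apply: continuous_coord.
Qed.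

Lemma continuous_enorm (f : Z -> E) :
  continuous f -> continuous (fun z => enorm (f z)).
Proof.
move=> cf; under eq_fun do rewrite enormE.
by apply: continuous_fun_comp (@sqrt_continuous R); exact: continuous_dot.
Qed.

Lemma continuous_vadd (f g : Z -> E) :
  continuous f -> continuous g -> continuous (fun z => f z + g z).
Proof.
by move=> cf cg; apply: continuous_row => i; under eq_fun do rewrite mxE;
  apply: continuous_add; exact: continuous_coord.
Qed.

Lemma continuous_vopp (f : Z -> E) :
  continuous f -> continuous (fun z => - f z).
Proof.
by move=> cf; apply: continuous_row => i; under eq_fun do rewrite mxE;
  apply: continuous_opp; exact: continuous_coord.
Qed.

Lemma continuous_vscale (k : Z -> R) (f : Z -> E) :
  continuous k -> continuous f -> continuous (fun z => k z *: f z).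
Proof.
by move=> ck cf; apply: continuous_row => i; under eq_fun do rewrite mxE;
  apply: continuous_mul => //; exact: continuous_coord.
Qed.

Lemma continuous_vsum (s : seq E) (F : E -> Z -> E) :
  (forall i, continuous (F i)) -> continuous (fun z => \sum_(i <- s) F i z).
Proof.
move=> cF; elim: s => [|i r IH].
  by under eq_fun do rewrite big_nil; exact: continuous_cst.
by under eq_fun do rewrite big_cons; exact: continuous_vadd.
Qed.

Lemma continuous_rsum (s : seq E) (F : E -> Z -> R) :
  (forall i, continuous (F i)) -> continuous (fun z => \sum_(i <- s) F i z).
Proof.
move=> cF; elim: s => [|i r IH].
  by under eq_fun do rewrite big_nil; exact: continuous_cst.
by under eq_fun do rewrite big_cons; exact: continuous_add.
Qed.

End continuity.
End euclidean_norm.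

Ltac vec_step f g := lazymatch goal with
  | |- cts (fun z => Algebra.add _ _) => apply: (@continuous_vadd _ _ _ f g); apply: ctsP
  | |- cts (fun z => Algebra.opp _) => apply: (@continuous_vopp _ _ _ f); apply: ctsP
  | |- cts (fun z => (@?k z *: @?h z)%R) => apply: (@continuous_vscale _ _ _ k h); apply: ctsP
  | |- cts (fun z => dot (@?h z) (@?k z)) => apply: (@continuous_dot _ _ _ h k); apply: ctsP
  | |- cts (fun z => enorm (@?h z)) => apply: (@continuous_enorm _ _ _ h); apply: ctsP
  end.

Ltac vcont := apply: ctsP; repeat cont_step vec_step.

Section distance.
Variables (R : realType) (N : nat).
Local Notation E := 'rV[R]_N.
Implicit Types (x y w : E) (K : set E).

Definition edist K y : R := inf [set enorm (x - y) | x in K].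

Section nonempty_compact.
Variable K : set E.
Hypotheses (cK : compact K) (K0 : K !=set0).

Lemma edist_has_inf y : has_inf [set enorm (x - y) | x in K].
Proof.
split; first by have [x Kx] := K0; exists (enorm (x - y)), x.
by exists 0 => _ [x _ <-]; exact: enorm_ge0.
Qed.

Lemma edist_le y x : K x -> edist K y <= enorm (x - y).
Proof. by move=> Kx; apply: ge_inf; [have [] := edist_has_inf y|exists x]. Qed.

Lemma edist_attained y : exists2 x, K x & enorm (x - y) = edist K y.
Proof.
have cf : {within K, continuous (fun x => enorm (x - y))}.
  by apply: continuous_subspaceT; vcont.
have [x /set_mem Kx xmin] := compact_EVT_min K0 cK cf.
exists x => //; apply/eqP; rewrite eq_le edist_le// andbT.
apply: lb_le_inf; first by have [] := edist_has_inf y.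
by move=> _ [z Kz <-]; apply: xmin; exact: mem_set.
Qed.

Lemma edist_ge0 y : 0 <= edist K y.
Proof. by have [x _ <-] := edist_attained y; exact: enorm_ge0. Qed.

Lemma edist_lipschitz y z : edist K y <= edist K z + enorm (y - z).
Proof.
have [x Kx <-] := edist_attained z; apply: le_trans (edist_le y Kx) _.
have -> : x - y = (x - z) + (z - y) by rewrite addrA subrK.
by rewrite (enormB y z); exact: enorm_triangle.
Qed.

Lemma edist_mem y : K y -> edist K y = 0.
Proof.
move=> Ky; apply/eqP; rewrite eq_le edist_ge0 andbT.
by rewrite (le_trans (edist_le y Ky))// subrr enorm0.
Qed.

Lemma edist_eq0 y : edist K y <= 0 -> K y.
Proof.
have [x Kx <-] := edist_attained y => xy.
suff <- : x = y by [].
apply/eqP; rewrite -subr_eq0; apply/eqP/enorm_eq0/eqP.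
by rewrite eq_le xy enorm_ge0.
Qed.

Lemma edist_gt0 y : ~ K y -> 0 < edist K y.
Proof. by move=> nKy; rewrite ltNge; apply/negP => /edist_eq0. Qed.

Lemma continuous_edist : continuous (edist K).
Proof.
apply: (continuous_dominated (m := fun y z => enorm (z - y))).
- by move=> y; vcont.
- by move=> y; rewrite subrr enorm0.
- move=> y z; rewrite ler_norml.
  by have := edist_lipschitz y z; have := edist_lipschitz z y;
    rewrite (enormB y z); lra.
Qed.

Lemma set_distE y : set_dist y K = (edist K y)%:E.
Proof.
have [x Kx xy] := edist_attained y; apply/eqP; rewrite eq_le; apply/andP; split.
  by apply: ereal_inf_lbound; exists x => //; rewrite -xy enormB.
apply/ereal_infP => _ [z Kz <-]; rewrite lee_fin enormB; exact: edist_le.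
Qed.

Lemma thickeningE a y : thickening K a y <-> edist K y <= a.
Proof.
split=> [[x Kx]|]; first exact: le_trans (edist_le y Kx).
by have [x Kx <-] := edist_attained y; exists x.
Qed.

Lemma compact_edist_band a b : compact [set y | a <= edist K y <= b].
Proof.
apply: bounded_closed_compact.
  have [M [Mr hM]] := compact_bounded cK.
  exists (M + 1 + b); split; first exact: num_real.
  move=> r hr y /= /andP[_ yb]; have [x Kx xy] := edist_attained y.
  have -> : y = x - (x - y) by rewrite opprB addrC subrK.
  apply: le_trans (ler_normB _ _) _; apply: le_trans (ltW hr).
  apply: lerD; first by apply: hM => //; rewrite ltrDl.
  by apply: le_trans yb; rewrite -xy; exact: norm_le_enorm.
have -> : [set y | a <= edist K y <= b] =
    edist K @^-1` [set z | a <= z] `&` edist K @^-1` [set z | z <= b].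
  by apply/seteqP; split => y /=; [move=> /andP[]|move=> [-> ->]].
apply: closedI; apply: preimage_closed => [? _|]; try exact: continuous_edist.
  exact: closed_ge.
exact: closed_le.
Qed.

Definition nearest y x := K x /\ enorm (x - y) = edist K y.

(** [w] points away from all the nearest points of [K], at rate more than [c]:
for [c >= 0] this is a quantitative form of [y] not being critical. *)
Definition ascent y c w := dot w w <= 1 /\ forall x, nearest y x -> c < dot w (y - x).

Definition slope_gt y c := exists w, ascent y c w.

Lemma slope_gtW y c c' : c' <= c -> slope_gt y c -> slope_gt y c'.
Proof.
by move=> cc [w [w1 h]]; exists w; split => // x /h; exact: le_lt_trans.
Qed.

(** A point [x] of [K] satisfies the condition at [(y, c)] because it is not nearest
to [y], or because its rate exceeds [c]; both are open conditions on [x] and [(y, c)],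
so that compactness of [K] gives a neighbourhood of [(y, c)]. *)
Lemma ascent_near y c w : ascent y c w ->
  \forall p \near (y, c), ascent p.1 p.2 w.
Proof.
move=> [w1 h].
have near_P x : K x -> nbhs (x, (y, c)) [set q : E * (E * R) |
    enorm (q.1 - q.2.1) = edist K q.2.1 -> q.2.2 < dot w (q.2.1 - q.1)].
  move=> Kx; have [xy|xy] := eqVneq (enorm (x - y)) (edist K y).
    apply: (@nbhs_preimage _ _ (fun q : E * (E * R) => dot w (q.2.1 - q.1) - q.2.2)
      [set r | 0 < r]); [by vcont|exact: open_gt| |].
      by rewrite /= subr_gt0; exact: h.
    by move=> q /=; rewrite subr_gt0.
  apply: (@nbhs_preimage _ _ (fun q : E * (E * R) => enorm (q.1 - q.2.1) - edist K q.2.1)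
      [set r | r != 0]); [|exact: open_neq|by rewrite /= subr_eq0|].
    apply: continuous_add; first by vcont.
    apply: continuous_opp; apply: (@continuous_fun_comp _ _ _
      (fun q : E * (E * R) => q.2.1) (edist K)); [by vcont|exact: continuous_edist].
  by move=> q /=; rewrite subr_eq0 => /eqP h1 /h1.
have := compact_forall_near (P := fun x (p : E * R) =>
  enorm (x - p.1) = edist K p.1 -> p.2 < dot w (p.1 - x)) cK near_P.
by apply: filterS => p hp; split => // x [Kx xp]; exact: hp.
Qed.

End nonempty_compact.
End distance.

(** * Ascent fields *)

Lemma compact_finite_cover (T : ptopologicalType) (C : set T) (U : T -> set T) :
  compact C -> (forall y, C y -> nbhs y (U y)) ->
  exists s : seq T, (forall i, i \in s -> C i) /\
    forall y, C y -> exists2 i, i \in s & U i y.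
Proof.
rewrite compact_cover => cC CU.
have [|D DC cov] := cC T C (fun y => (U y)^°) (fun _ _ => @open_interior _ _).
  by move=> y Cy; exists y => //; exact: CU.
exists (finmap.enum_fset D); split=> [i iD|y Cy]; first exact/set_mem/DC.
have [i iD Ui] := cov y Cy; exists i => //.
exact: interior_subset Ui.
Qed.

Section field.
Variables (R : realType) (N : nat).
Local Notation E := 'rV[R]_N.
Variable K : set E.
Hypotheses (cK : compact K) (K0 : K !=set0).
Implicit Types (x y w : E) (C : set E).

Lemma uniform_slope C c : compact C -> (forall y, C y -> slope_gt K y c) ->
  exists2 e, 0 < e & forall y, C y -> slope_gt K y (c + e).
Proof.
move=> cC sC.
have : nbhs c [set c' | forall y, C y -> slope_gt K y c'].
  apply: (compact_forall_near (P := fun y c' => slope_gt K y c') cC) => y Cy.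
  have [w aw] := sC y Cy; have := ascent_near cK K0 aw.
  by apply: filterS => p ap; exists w.
move=> /nbhs_ballP[e /= e0 he]; exists (e / 2); first by rewrite divr_gt0.
apply: he; rewrite /ball /= opprD addNKr normrN gtr0_norm ?divr_gt0//.
by rewrite ltr_pdivrMr// ltr_pMr// ltr1n.
Qed.

(** Ascent directions at given points remain so nearby and can be averaged: a
partition of unity over finitely many balls glues them. *)
Lemma continuous_ascent_field C c : compact C -> 0 <= c ->
  (forall y, C y -> slope_gt K y c) ->
  exists W : E -> E, [/\ continuous W, forall y, dot (W y) (W y) <= 1 &
    forall y, C y -> ascent K y c (W y)].
Proof.
move=> cC c0 sC.
have loc y : exists p : E * R, C y -> [/\ 0 < p.2, dot p.1 p.1 <= 1 &
    forall z, enorm (z - y) < p.2 -> ascent K z c p.1].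
  have [Cy|nCy] := pselect (C y); last by exists (0, 0).
  have [w aw] := sC y Cy.
  have [[A B] /= [nA nB] AB] := ascent_near cK K0 aw.
  have /nbhs_ballP[r /= r0 hr] := nA.
  exists (w, r) => _; split => //=; first by have [] := aw.
  move=> z zr; apply: (AB (z, c)); split; last exact: nbhs_singleton.
  apply: hr; rewrite -ball_normE /= -normrN opprB.
  by apply: le_lt_trans zr; exact: norm_le_enorm.
have [p hp] := choice loc.
pose tau i y := Num.max 0 ((p i).2 - enorm (y - i)).
have tau0 i y : 0 <= tau i y by rewrite /tau le_max lexx.
have [s [sC' sU]] : exists s : seq E, (forall i, i \in s -> C i) /\
    forall y, C y -> exists2 i, i \in s & enorm (y - i) < (p i).2.
  apply: (compact_finite_cover (U := fun i => [set y | enorm (y - i) < (p i).2]) cC).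
  move=> y Cy; have [p0 _ _] := hp y Cy.
  apply: (@nbhs_preimage _ _ (fun z => enorm (z - y)) [set r | r < (p y).2]).
  - by vcont.
  - exact: open_lt.
  - by rewrite /= subrr enorm0.
  - by [].
pose tot y := \sum_(i <- s) tau i y.
have ctau i : continuous (tau i) by rewrite /tau; vcont.
have ctot : continuous tot by exact: continuous_rsum.
have tot_gt0 y : C y -> 0 < tot y.
  move=> Cy; have [i si yi] := sU y Cy.
  rewrite /tot (big_rem i)//=; apply: ltr_pwDl; last exact: sumr_ge0.
  by rewrite lt_max subr_gt0 yi orbT.
have [d d0 hd] : exists2 d, 0 < d & forall y, C y -> d <= tot y.
  have [[y Cy]|nC] := pselect (C !=set0); last first.
    by exists 1 => // y Cy; case: nC; exists y.
  have [z /set_mem Cz zmin] := compact_EVT_min (ex_intro _ y Cy) cC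
    (continuous_subspaceT ctot).
  by exists (tot z); [exact: tot_gt0|move=> t Ct; apply: zmin; exact: mem_set].
have den0 y : 0 < Num.max d (tot y) by rewrite lt_max d0.
(* On [C] the total weight is at least [d], so that the maximum is the total weight
there; elsewhere it keeps the denominator away from 0. *)
pose W y := (Num.max d (tot y))^-1 *: \sum_(i <- s) tau i y *: (p i).1.
have W1 y : enorm (W y) <= 1.
  rewrite enormZ gtr0_norm ?invr_gt0// mulrC ler_pdivrMr// mul1r.
  apply: le_trans (enorm_sum _ _) _; rewrite le_max; apply/orP; right.
  rewrite /tot big_seq [leRHS]big_seq; apply: ler_sum => i si.
  rewrite enormZ ger0_norm//; apply: ler_piMr => //.
  have [_ wi _] := hp i (sC' i si).
  by rewrite enorm_le// expr1n.
exists W; split.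
- rewrite /W; apply: continuous_vscale.
    by apply: continuous_inv => [y|]; [rewrite gt_eqF|cont].
  by apply: continuous_vsum => i; vcont.
- by move=> y; rewrite -(expr1n R 2) -enorm_le.
- move=> y Cy; split; first by rewrite -(expr1n R 2) -enorm_le.
  move=> x nx; rewrite /W dotZl (max_idPr (hd y Cy)) ltr_pdivlMl ?tot_gt0//.
  have -> : dot (\sum_(i <- s) tau i y *: (p i).1) (y - x) =
      \sum_(i <- s) tau i y * dot (p i).1 (y - x).
    elim: (s) => [|i r IH]; first by rewrite !big_nil -(scale0r 0) dotZl mul0r.
    by rewrite !big_cons dotDl dotZl IH.
  have [i si yi] := sU y Cy.
  have le1 j : j \in s -> c * tau j y <= tau j y * dot (p j).1 (y - x).
    move=> sj; have [_ _ hj] := hp j (sC' j sj).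
    have [yj|yj] := ltP (enorm (y - j)) (p j).2.
      by rewrite mulrC ler_wpM2l// ltW//; have [_] := hj y yj; apply.
    by rewrite /tau (max_idPl _) ?subr_le0// mulr0 mul0r.
  rewrite mulrC /tot mulr_sumr (big_rem i)//= [ltRHS](big_rem i)//=.
  apply: ltr_leD.
    rewrite mulrC ltr_pM2l; last by rewrite lt_max subr_gt0 yi orbT.
    by have [_ _ hi] := hp i (sC' i si); have [_] := hi y yi; apply.
  rewrite big_seq [leRHS]big_seq; apply: ler_sum => j jr.
  by apply: le1; exact: mem_rem jr.
Qed.

(** A step against an ascent direction decreases the squared distance, because
that function is bounded above by the squared distance to one nearest point. *)
Lemma descent_step y w c k : 0 < c -> 0 <= k <= c -> ascent K y c w ->
  edist K (y - k *: w) ^+ 2 <= edist K y ^+ 2 - k * c.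
Proof.
move=> c0 /andP[k0 kc] [w1 aw]; have [x Kx xy] := edist_attained cK K0 y.
have := aw x (conj Kx xy) => cw.
have : edist K (y - k *: w) ^+ 2 <= enorm (x - (y - k *: w)) ^+ 2.
  rewrite ler_sqr ?nnegrE ?enorm_ge0 ?edist_ge0//; exact: edist_le.
move=> /le_trans; apply; rewrite -xy !sqr_enorm opprB addrCA addrC.
move: cw; rewrite !dotE (dotC w x) (dotC w y) (dotC y x) => cw.
set a := dot x x in w1 cw *; set b := dot x w in cw *.
set d := dot y w in cw *; set e := dot w w in w1 *; set f := dot x y; set g := dot y y.
nra.
Qed.

End field.

(** * Descents *)

Section descent.
Variables (R : realType) (N : nat).
Local Notation E := 'rV[R]_N.
Local Notation I := (@unitI R).
Local Notation i0 := (unitI_zero R).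
Local Notation i1 := (unitI_one R).
Variable K : set E.
Hypotheses (cK : compact K) (K0 : K !=set0).
Implicit Types (x y w : E).

Let edist0 y : 0 <= edist K y. Proof. exact: edist_ge0. Qed.

(** Euler's method for the descent along an ascent field: finitely many steps of
length at most [c], each of which lowers the squared distance by [c ^ 2] as long as
the distance lies between [a] and [b]. All steps share the time parameter of the
homotopy instead of being run one after the other. The displacement is bounded by
the number of steps times [c]. *)
Lemma descent_stage (a' a b b' c : R) :
  a' < a -> a <= b -> b < b' -> 0 <= a -> 0 < c ->
  (forall y, a' <= edist K y <= b' -> slope_gt K y c) ->
  exists G : E * I -> E,
    [/\ continuous G, forall y, G (y, i0) = y,
        forall y t, edist K y <= a' -> G (y, t) = y,
        forall y t, edist K (G (y, t)) <= edist K y &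
        (forall y, edist K y <= b -> edist K (G (y, i1)) <= a) /\
        forall y t, enorm (G (y, t) - y) <= (b ^+ 2 - a ^+ 2) / c + c].
Proof.
move=> a'a ab bb' a0 c0 sl.
have [W [cW W1 aW]] := continuous_ascent_field cK K0
  (compact_edist_band cK K0 (a := a') (b := b')) (ltW c0) sl.
pose cut z : R := Num.max 0 (Num.min 1 z).
have cut01 z : 0 <= cut z <= 1 by rewrite /cut le_max lexx ge_max ler01 ge_min lexx.
have cut0 z : z <= 0 -> cut z = 0.
  by move=> z0; apply/max_idPl; rewrite ge_min z0 orbT.
have cut1 z : 1 <= z -> cut z = 1.
  by move=> z1; rewrite /cut (min_idPl z1) (max_idPr ler01).
(* Cut-off: equal to 1 where the distance lies in [a, b], to 0 outside [a', b']. *)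
pose chi y := cut ((edist K y - a') / (a - a')) * cut ((b' - edist K y) / (b' - b)).
have chi01 y : 0 <= chi y <= 1.
  by rewrite mulr_ge0 ?mulr_ile1//=; have /andP[] := cut01 ((edist K y - a') / (a - a'));
    have /andP[] := cut01 ((b' - edist K y) / (b' - b)).
have chi0 y : edist K y <= a' -> chi y = 0.
  by move=> ya; rewrite /chi cut0 ?mul0r// pmulr_lle0 ?subr_le0// invr_gt0 subr_gt0.
have chi0' y : b' <= edist K y -> chi y = 0.
  move=> ya; rewrite /chi [X in _ * X]cut0 ?mulr0//.
  by rewrite pmulr_lle0 ?subr_le0// invr_gt0 subr_gt0.
have chi1 y : a <= edist K y <= b -> chi y = 1.
  move=> /andP[ya yb]; rewrite /chi !cut1 ?mulr1//.
    by rewrite ler_pdivlMr ?mul1r ?lerD2l ?lerN2// subr_gt0.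
  by rewrite ler_pdivlMr ?mul1r ?lerD2r// subr_gt0.
have cchi : continuous chi.
  by have ce := continuous_edist cK K0; rewrite /chi /cut; cont.
clearbody chi.
pose step (p : E * I) := p.1 - (val p.2 * c * chi p.1) *: W p.1.
have cstep : continuous step.
  have c1 : continuous (fun p : E * I => W p.1).
    by apply: continuous_fun_comp cW; cont.
  have c2 : continuous (fun p : E * I => chi p.1).
    by apply: continuous_fun_comp cchi; cont.
  by rewrite /step; vcont.
have k01 y (t : I) : 0 <= val t * c * chi y <= c.
  have /andP[t0 t1] := unitIP t; have /andP[h0 h1] := chi01 y.
  rewrite !mulr_ge0 ?(ltW c0)//= mulrAC ler_piMl ?(ltW c0)//.
  exact: mulr_ile1.
have step_le y t : edist K (step (y, t)) <= edist K y.
  have [ya|/ltW ya] := leP (edist K y) a'.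
    by rewrite /step chi0// mulr0 scale0r subr0.
  have [yb|/ltW yb] := leP b' (edist K y).
    by rewrite /step chi0'// mulr0 scale0r subr0.
  rewrite -ler_sqr ?nnegrE//.
  apply: le_trans (descent_step cK K0 c0 (k01 y t) (aW y _)) _.
    by rewrite /= ya yb.
  by rewrite gerBl mulr_ge0 ?(ltW c0)//; have /andP[] := k01 y t.
have step_lt y : a <= edist K y <= b ->
    edist K (step (y, i1)) ^+ 2 <= edist K y ^+ 2 - c ^+ 2.
  move=> /andP[ya yb].
  apply: le_trans (descent_step cK K0 c0 (k01 y i1) (aW y _)) _.
    by rewrite /=; apply/andP; split; lra.
  by rewrite chi1 ?ya//= mul1r mulr1 expr2.
have step_dist p : enorm (step p - p.1) <= c.
  rewrite /step addrC addKr enormN enormZ ger0_norm; last by have /andP[] := k01 p.1 p.2.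
  have /andP[h0 h1] := k01 p.1 p.2.
  have : enorm (W p.1) <= 1 by rewrite enorm_le// expr1n.
  have := enorm_ge0 (W p.1); nra.
pose G n (p : E * I) := iter n (fun y => step (y, p.2)) p.1.
have cG n : continuous (G n).
  elim: n => [|n IH]; first by rewrite /G /=; cont.
  rewrite /G /=; apply: continuous_fun_comp cstep.
  by apply: continuous_pair; [exact: IH|cont].
have G_le n y t : edist K (G n (y, t)) <= edist K y.
  by elim: n => [|n IH] //=; exact: le_trans (step_le _ _) IH.
have G_lt n y : edist K y <= b ->
    edist K (G n (y, i1)) <= a \/
    edist K (G n (y, i1)) ^+ 2 <= b ^+ 2 - n%:R * c ^+ 2.
  move=> yb; elim: n => [|n IH].
    by right; rewrite mul0r subr0 /= ler_sqr ?nnegrE//; exact: le_trans yb.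
  have Gb : edist K (G n (y, i1)) <= b by exact: le_trans (G_le n y i1) yb.
  have [ya|ya] := leP (edist K (G n (y, i1))) a.
    by left; exact: le_trans (step_le _ _) ya.
  case: IH => [h|h]; first by move: ya; rewrite ltNge h.
  right; apply: le_trans (step_lt _ _) _; first by rewrite (ltW ya).
  by rewrite -natr1 mulrDl mul1r; lra.
have G_dist n p : enorm (G n p - p.1) <= n%:R * c.
  elim: n => [|n IH]; first by rewrite /G /= subrr enorm0 mul0r.
  have -> : G n.+1 p - p.1 = (G n p - p.1) + (step (G n p, p.2) - G n p).
    by rewrite [RHS]addrC addrA subrK.
  apply: le_trans (enorm_triangle _ _) _; rewrite -natr1 mulrDl mul1r.
  by apply: lerD => //; exact: (step_dist (G n p, p.2)).
(* The number of steps that bring the squared distance from [b ^ 2] to [a ^ 2]. *)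
pose X := (b ^+ 2 - a ^+ 2) / c ^+ 2.
have X0 : 0 <= X.
  by rewrite divr_ge0 ?sqr_ge0// subr_ge0 ler_sqr ?nnegrE//; exact: le_trans ab.
have /andP[X1 X2] := truncn_itv X0.
exists (G (Num.truncn X).+1); split; [exact: cG| | |exact: G_le|].
- move=> y; elim: (Num.truncn X).+1 => // n IH.
  have -> : G n.+1 (y, i0) = step (G n (y, i0), i0) by [].
  by rewrite IH /step /= !mul0r scale0r subr0.
- move=> y t ya; elim: (Num.truncn X).+1 => // n IH.
  have -> : G n.+1 (y, t) = step (G n (y, t), t) by [].
  by rewrite IH /step /= chi0// mulr0 scale0r subr0.
- split=> [y yb|y t].
    have [//|h] := G_lt (Num.truncn X).+1 y yb.
    rewrite -ler_sqr ?nnegrE//; apply: le_trans h _.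
    have : (b ^+ 2 - a ^+ 2) < (Num.truncn X).+1%:R * c ^+ 2.
      by rewrite -ltr_pdivrMr ?exprn_gt0.
    by lra.
  apply: le_trans (G_dist _ _) _; rewrite -natr1 mulrDl mul1r lerD2r.
  rewrite ler_pdivlMr// -mulrA -expr2 -ler_pdivlMr ?exprn_gt0//.
Qed.

Lemma descent_noncritical (a b b' : R) : 0 < a -> a <= b -> b < b' ->
  (forall y, 0 < edist K y <= b' -> slope_gt K y 0) ->
  exists G : E * I -> E,
    [/\ continuous G, forall y, G (y, i0) = y,
        forall y t, edist K (G (y, t)) <= edist K y &
        forall y, edist K y <= b -> edist K (G (y, i1)) <= a].
Proof.
move=> a0 ab bb' sl.
have [e e0 he] : exists2 e, 0 < e &
    forall y, a / 2 <= edist K y <= b' -> slope_gt K y (0 + e).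
  apply: (uniform_slope cK K0 (C := [set y | a / 2 <= edist K y <= b']) (c := 0)).
    exact: compact_edist_band.
  by move=> y /= /andP[ya yb]; apply: sl; rewrite yb andbT; lra.
have a2 : a / 2 < a by lra.
rewrite add0r in he.
have [G [cG G0 _ Gle [G1 _]]] := descent_stage a2 ab bb' (ltW a0) e0 he.
by exists G; split.
Qed.

(** Weierstrass M-test, with a bound on the partial sums. *)
Lemma uniform_limit_of_summable (Z : topologicalType) (F : nat -> Z -> R)
    (l : nat -> R) (B : R) : (forall k, continuous (F k)) -> (forall k, 0 <= l k) ->
  (forall k z, `|F k.+1 z - F k z| <= l k) ->
  (forall n, \sum_(k < n) l k <= B) ->
  exists f : Z -> R, continuous f /\ forall z, (fun k => F k z) @ \oo --> f z.
Proof.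
move=> cF l0 Fl lB.
pose S n := \sum_(k < n) l k.
have ndS : nondecreasing_seq S.
  by apply/nondecreasing_seqP => n; rewrite /S big_ord_recr /= lerDl.
have cvS : S @ \oo --> limn S.
  apply: nondecreasing_is_cvgn ndS _; exists B => _ [n _ <-]; exact: lB.
have SL n : S n <= limn S by apply: nondecreasing_cvgn_le.
have FS m n z : (m <= n)%N -> `|F n z - F m z| <= S n - S m.
  move=> /subnK <-; elim: (n - m)%N => [|k IH]; first by rewrite add0n !subrr normr0.
  rewrite addSn -(subrK (F (k + m)%N z) (F _ z)) -addrA.
  apply: le_trans (ler_normD _ _) _; rewrite {1}/S big_ord_recr /= -/(S _).
  by have := Fl (k + m)%N z; move: IH; lra.
have tail e : 0 < e -> \forall m \near \oo, limn S - S m < e.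
  move=> e0; have /cvgrPdist_lt/(_ e e0) := cvS; apply: filterS => m.
  exact: le_lt_trans (ler_norm _).
have Fc z : cvgn (fun k => F k z).
  apply: cauchy_cvg; apply/cauchy_exP => e e0.
  have [m _ hm] := tail e e0.
  exists (F m z); exists m => // n /= mn.
  rewrite -ball_normE /= distrC; apply: le_lt_trans (FS m n z mn) _.
  by apply: le_lt_trans (hm m (leqnn m)); rewrite lerD2r.
pose f z := limn (fun k => F k z).
have Ff m z : `|f z - F m z| <= limn S - S m.
  have c1 : (fun k => `|F k z - F m z|) @ \oo --> `|f z - F m z|.
    by apply: cvg_norm; apply: cvgB; [exact: Fc|exact: cvg_cst].
  apply: (cvgr_to_le c1); exists m => // n /= mn.
  by apply: le_trans (FS m n z mn) _; rewrite lerD2r.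
exists f; split=> [z|z]; last exact: Fc.
apply/cvgrPdist_lt => e e0.
have e3 : 0 < e / 3 by lra.
have [m _ hm] := tail _ e3.
have {}hm := hm m (leqnn m).
have /cvgrPdist_lt/(_ _ e3) := cF m z; apply: filterS => y yz.
have := Ff m z; have := Ff m y; rewrite (distrC (f y)) => fy fz.
have -> : f z - f y = (f z - F m z) + (F m z - F m y) + (F m y - f y) by ring.
apply: le_lt_trans (ler_normD _ _) _; apply: le_lt_trans (lerD (ler_normD _ _) (lexx _)) _.
by lra.
Qed.

End descent.

(** * Descents onto the compact set *)

Section inclusion.
Variables (R : realType) (T : topologicalType).
Local Notation I := (@unitI R).
Local Notation i0 := (unitI_zero R).
Local Notation i1 := (unitI_one R).

(** The deformation has to preserve [A] but not to fix its points: its restriction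
to [A] is the homotopy that the criterion requires on the subspace. *)
Lemma weak_equivalence_incl (A B : set T) (AB : A `<=` B) (H : B * I -> T) :
  continuous H -> (forall b t, B (H (b, t))) -> (forall b, H (b, i0) = val b) ->
  (forall b, A (H (b, i1))) -> (forall (b : B) t, A (val b) -> A (H (b, t))) ->
  weak_homotopy_equivalence R (set_incl AB).
Proof.
move=> cH HB H0 H1 HA.
pose HY (p : B * I) : B := set_mk (HB p.1 p.2).
have HXA (p : A * I) : A (H (set_incl AB p.1, p.2)).
  exact: (HA (set_incl AB p.1) p.2 (set_mkP p.1)).
have cH' : continuous (fun p : B * I => H (p.1, p.2)).
  by apply: continuous_fun_comp cH; cont.
apply: (@weak_equivalence_of_homotopy_inverse R _ _ (set_incl AB)
  (fun b => set_mk (H1 b)) (fun p => set_mk (HXA p)) HY).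
- exact: set_incl_continuous.
- by apply: continuous_set_mk; apply: continuous_fun_comp cH; cont.
- apply: continuous_set_mk; apply: continuous_fun_comp cH; apply: continuous_pair.
    apply: (continuous_fun_comp (f := fst) (g := set_incl AB)).
      by cont.
    exact: set_incl_continuous.
  by cont.
- exact: continuous_set_mk.
- by move=> x; apply: val_inj; rewrite /= H0.
- by move=> x; apply: val_inj.
- by move=> x; apply: val_inj; rewrite /= H0.
- by move=> x; apply: val_inj.
- by move=> x t; apply: val_inj.
Qed.

End inclusion.

Section collapse.
Variables (R : realType) (N : nat).
Local Notation E := 'rV[R]_N.
Local Notation I := (@unitI R).
Local Notation i0 := (unitI_zero R).
Local Notation i1 := (unitI_one R).

Lemma cvg_row (u : nat -> E) (l : E) :
  (forall i, (fun k => u k 0 i) @ \oo --> l 0 i) -> u @ \oo --> l.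
Proof.
move=> h; apply/cvg_ballP => e e0.
have : \forall k \near \oo, forall i, ball (l 0 i) e (u k 0 i).
  apply: filter_forall => i; have /cvg_ballP := h i; exact.
by apply: filterS => k hk; split => // i j; rewrite ord1; exact: hk.
Qed.

Section nonempty.
Variable K : set E.
Hypotheses (cK : compact K) (K0 : K !=set0).
Implicit Types (x y w : E).

Let edist0 y : 0 <= edist K y. Proof. exact: edist_ge0. Qed.

(** Descending through the levels [b / 2 ^ k], all stages sharing the same time
parameter; if the lengths of the stages are summable the descent reaches [K]. *)
Lemma collapse_onto (b B : R) (c : nat -> R) : 0 < b -> (forall k, 0 < c k) ->
  (forall k y, b / 2 ^+ k.+2 <= edist K y <= 2 * (b / 2 ^+ k) -> slope_gt K y (c k)) ->
  (forall n, \sum_(k < n)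
     (((b / 2 ^+ k) ^+ 2 - (b / 2 ^+ k.+1) ^+ 2) / c k + c k) <= B) ->
  exists G : E * I -> E,
    [/\ continuous G, forall y, G (y, i0) = y,
        forall y t, edist K (G (y, t)) <= edist K y &
        forall y, edist K y <= b -> edist K (G (y, i1)) <= 0].
Proof.
move=> b0 c0 sl lB.
pose a k := b / 2 ^+ k.
have a_gt0 k : 0 < a k by rewrite divr_gt0// exprn_gt0.
have aS k : a k.+1 = a k / 2 by rewrite /a exprS invfM mulrCA mulrC.
have a_le k : a k.+1 <= a k by rewrite aS; have := a_gt0 k; lra.
have a_lt k : a k.+2 < a k.+1 by rewrite (aS k.+1); have := a_gt0 k.+1; lra.
have a_lt2 k : a k < 2 * a k by have := a_gt0 k; lra.
pose l k := (a k ^+ 2 - a k.+1 ^+ 2) / c k + c k.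
have l0 k : 0 <= l k.
  rewrite addr_ge0 ?(ltW (c0 k))// divr_ge0 ?(ltW (c0 k))// subr_ge0.
  by rewrite ler_sqr ?nnegrE// ltW.
have stage k := descent_stage cK K0 (a_lt k) (a_le k) (a_lt2 k) (ltW (a_gt0 k.+1))
  (c0 k) (sl k).
have [G hG] := choice stage.
pose H := fix H k (p : E * I) := if k is k'.+1 then G k' (H k' p, p.2) else p.1.
have cH k : continuous (H k).
  elim: k => [|k IH] /=; first by cont.
  have [cG _ _ _ _] := hG k.
  by apply: continuous_fun_comp cG; apply: continuous_pair; [exact: IH|cont].
have H0 k y : H k (y, i0) = y.
  by elim: k => //= k ->; have [_ ->] := hG k.
have H_le k y t : edist K (H k (y, t)) <= edist K y.
  elim: k => //= k IH; apply: le_trans IH.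
  by have [_ _ _ + _] := hG k; apply.
have H_1 k y : edist K y <= b -> edist K (H k (y, i1)) <= a k.
  move=> yb; elim: k => [|k IH] /=; first by rewrite /a expr0 divr1.
  by have [_ _ _ _ [+ _]] := hG k; apply.
have H_dist k p i : `|H k.+1 p 0 i - H k p 0 i| <= l k.
  have [_ _ _ _ [_ hd]] := hG k.
  apply: le_trans (hd (H k p) p.2).
  by have := coord_le_enorm (G k (H k p, p.2) - H k p) i; rewrite !mxE.
have lim i : exists f : E * I -> R, continuous f /\
    forall p, (fun k => H k p 0 i) @ \oo --> f p.
  apply: (uniform_limit_of_summable (l := l) (B := B)) => //.
  by move=> k; apply: continuous_coord; exact: cH.
have [f hf] := choice lim.
pose F p : E := \row_i f i p.
have HF p : (fun k => H k p) @ \oo --> F p.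
  by apply: cvg_row => i; rewrite mxE; have [_] := hf i; apply.
have eF p : (fun k => edist K (H k p)) @ \oo --> edist K (F p).
  by apply: continuous_cvg (HF p); exact: continuous_edist.
exists F; split.
- apply: continuous_row => i; rewrite /F; under eq_fun do rewrite mxE.
  by have [] := hf i.
- move=> y; have := HF (y, i0).
  have -> : (fun k => H k (y, i0)) = fun=> y by apply/funext => k; exact: H0.
  by move=> /cvg_unique; apply => //; exact: cvg_cst.
- move=> y t; apply: (cvgr_to_le (eF _)); apply: nearW => k; exact: H_le.
- move=> y yb; apply/ler_addgt0Pr => e e0; rewrite add0r.
  have a_cvg : (fun k => a k) @ \oo --> (0 : R).
    rewrite -(mulr0 b); apply: cvgM; first exact: cvg_cst.
    under eq_fun do rewrite -exprVn; apply: cvg_expr.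
    by rewrite gtr0_norm ?invr_gt0// invf_lt1// ltr1n.
  have /cvgrPdist_lt/(_ e e0)[m _ hm] := a_cvg.
  apply: (cvgr_to_le (eF _)); exists m => // k /= mk.
  apply: le_trans (H_1 k y yb) _; have := hm k mk.
  by rewrite /= sub0r normrN gtr0_norm// => /ltW.
Qed.

End nonempty.
End collapse.

(** * Separation of a point from a compact set *)

Section caratheodory.
Variables (R : realType) (N : nat).
Local Notation E := 'rV[R]_N.
Variable G : set E.
Implicit Types (x y w : E).

Definition conv_comb m x := exists (l : 'I_m -> R) (p : 'I_m -> E),
  [/\ forall i, 0 <= l i, \sum_i l i = 1, forall i, G (p i) &
      x = \sum_i l i *: p i].

Lemma conv_comb_sub_hull m : conv_comb m `<=` convex_hull G.
Proof.
move=> x cx A [cA GA]; elim: m x cx => [|m IH] x [l [p [l0 l1 Gp ->]]].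
  by move: l1; rewrite big_ord0 => /esym/eqP; rewrite oner_eq0.
rewrite big_ord_recl /=; rewrite big_ord_recl /= in l1.
set s := \sum_(i < m) l (lift ord0 i) in l1.
have s0 : 0 <= s by apply: sumr_ge0.
have [s00|s_neq0] := eqVneq s 0.
  rewrite (_ : l ord0 = 1); last by rewrite -l1 s00 addr0.
  rewrite big1 ?addr0 ?scale1r; first exact: GA.
  move=> i _; have /eqP := s00.
  by rewrite psumr_eq0// => /allP/(_ i (mem_index_enum _))/eqP ->; rewrite scale0r.
have le1 : l ord0 <= 1 by rewrite -l1 lerDl.
pose q := \sum_(i < m) (l (lift ord0 i) / s) *: p (lift ord0 i).
have Aq : A q.
  apply: IH; exists (fun i => l (lift ord0 i) / s), (fun i => p (lift ord0 i)); split => //.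
    by move=> i; rewrite divr_ge0.
  by rewrite -mulr_suml divff.
have := cA (p ord0) q (Itv01 (l0 ord0) le1) (mem_set (GA _ (Gp ord0))) (mem_set Aq).
move=> /set_mem; congr A; rewrite /conv /=.
congr (_ + _); rewrite /q scaler_sumr; apply: eq_bigr => i _.
rewrite scalerA; congr (_ *: _).
have -> : unstable.onem (l ord0) = s by rewrite /unstable.onem -l1 addrAC subrr add0r.
by rewrite mulrCA divff// mulr1.
Qed.

(** Caratheodory: the rows [(p i, 1)] are linearly dependent; moving along a
dependency until some coefficient vanishes discards a point. *)
Lemma conv_comb_reduce : conv_comb N.+2 `<=` conv_comb N.+1.
Proof.
move=> x [l [p [l0 l1 Gp xE]]].
pose M : 'M[R]_(N.+2, N + 1) := \matrix_i row_mx (p i) 1%:M.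
have [mu [i0 mu0] [mup mu1]] : exists2 mu : 'I_N.+2 -> R, exists i, mu i != 0 &
    \sum_i mu i *: p i = 0 /\ \sum_i mu i = 0.
  have : ~~ row_free M.
    by rewrite -row_leq_rank -ltnNge (leq_ltn_trans (rank_leq_col M))// addn1.
  rewrite -kermx_eq0 => /rowV0Pn[u /sub_kermxP uM u0].
  exists (fun i => u 0 i); first by have /rV0Pn := u0.
  have uE : u *m M = row_mx (\sum_i u 0 i *: p i) (\sum_i u 0 i)%:M.
    apply/rowP => j; rewrite !mxE.
    case: (splitP j) => k jk.
      rewrite summxE; apply: eq_bigr => i _; rewrite !mxE.
      by case: (splitP j) => k' jk'; [have -> : k = k' by apply: val_inj; rewrite /= -jk -jk'|
        have := ltn_ord k; rewrite -jk jk' ltnNge leq_addr].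
    rewrite !ord1 mxE eqxx mulr1n; apply: eq_bigr => i _; rewrite !mxE.
    case: (splitP j) => k' jk'.
      by have := ltn_ord k'; rewrite -jk' jk ltnNge leq_addr.
    by rewrite !ord1 mxE eqxx mulr1.
  have := uM; rewrite uE -row_mx0 => /eq_row_mx[-> h]; split => //.
  by have := congr1 (fun A : 'M[R]_1 => A 0 0) h; rewrite !mxE eqxx mulr1n.
have [i1 i1p] : exists i, 0 < mu i.
  apply: contrapT => /forallNP h.
  have : \sum_i - mu i = 0 by rewrite sumrN mu1 oppr0.
  move=> /eqP; rewrite psumr_eq0 => [/allP/(_ i0 (mem_index_enum _))|i _].
    by rewrite /= oppr_eq0 (negbTE mu0).
  by rewrite oppr_ge0 leNgt; apply/negP/h.
have [j jp jmin] : exists2 j, 0 < mu j & forall i, 0 < mu i -> l j / mu j <= l i / mu i.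
  case: (@Order.TotalTheory.arg_minP _ _ _ i1 (fun i => 0 < mu i) (fun i => l i / mu i) i1p).
  by move=> j jp jmin; exists j.
pose t := l j / mu j; have t0 : 0 <= t by rewrite divr_ge0// ltW.
pose l' i := l i - t * mu i.
have l'0 i : 0 <= l' i.
  rewrite subr_ge0; have [mi|mi] := ltP 0 (mu i).
    by rewrite -ler_pdivlMr// jmin.
  by apply: le_trans (l0 i); rewrite mulr_ge0_le0.
have l'j : l' j = 0 by rewrite /l' /t divfK ?subrr// gt_eqF.
have sum_l' : \sum_i l' i = 1 by rewrite sumrB -mulr_sumr mu1 mulr0 subr0.
have sum_l'p : \sum_i l' i *: p i = x.
  under eq_bigr do rewrite scalerBl -scalerA.
  by rewrite sumrB -scaler_sumr mup scaler0 subr0 xE.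
exists (fun i => l' (lift j i)), (fun i => p (lift j i)); split => //.
  by rewrite -sum_l' (bigD1_ord j)//= l'j add0r.
by rewrite -sum_l'p (bigD1_ord j)//= l'j scale0r add0r.
Qed.

Lemma conv_comb_segment m x y (s : R) : G x -> conv_comb m y -> 0 <= s <= 1 ->
  conv_comb m.+1 (s *: x + (1 - s) *: y).
Proof.
move=> Gx [l [p [l0 l1 Gp ->]]] /andP[s0 s1].
exists (fun i => if unlift ord0 i is Some j then (1 - s) * l j else s),
  (fun i => if unlift ord0 i is Some j then p j else x); split.
- by move=> i; case: unliftP => [j _|_] //; rewrite mulr_ge0// subr_ge0.
- rewrite big_ord_recl unlift_none; under eq_bigr do rewrite liftK.
  by rewrite -mulr_sumr l1 mulr1 addrC subrK.
- by move=> i; case: unliftP.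
- rewrite big_ord_recl unlift_none scaler_sumr; congr (_ + _).
  by apply: eq_bigr => i _; rewrite liftK scalerA.
Qed.

Lemma conv_comb_compact m : compact G -> compact (conv_comb m).
Proof.
move=> cG.
pose L := [set l : 'rV[R]_m | (forall i, l 0 i \in `[0, 1]) /\ \sum_i l 0 i = 1].
pose P := [set p : 'rV[E]_m | forall i, G (p 0 i)].
have cP : compact P by exact: (@rV_compact _ m (fun=> G) (fun=> cG)).
have cL : compact L.
  pose L' := [set l : 'rV[R]_m | forall i, l ord0 i \in `[0, 1]%R].
  have cL' : compact L'.
    exact: (@rV_compact R m (fun=> [set` `[0, 1]%R]) (fun=> @segment_compact R 0 1)).
  have -> : L = L' `&` [set l | \sum_i l 0 i = 1] by [].
  apply: compact_closedI cL' _.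
  have : closed ((fun l : 'rV[R]_m => \sum_i l 0 i) @^-1` [set 1]).
    apply: preimage_closed; last exact: closed_eq.
    by move=> l _; apply: continuous_sum => i; apply: continuous_coord; exact: continuous_idfun.
  by [].
have cPi i : continuous (fun p : 'rV[E]_m => p 0 i).
  move=> p A nA; exists (fun _ j => if j == i then A else setT).
    by move=> i' j; case: eqP => [->|_]; [rewrite ord1|exact: filterT].
  by move=> q /= /(_ 0 i); rewrite eqxx.
have -> : conv_comb m = (fun q => \sum_i q.1 0 i *: q.2 0 i) @` (L `*` P).
  apply/seteqP; split => [x [l [p [l0 l1 Gp ->]]]|_ [[l p] [/= [l0 l1] Gp] <-]].
    exists (\row_i l i, \row_i p i).
      split=> [|i]; last by rewrite /= mxE.
      split=> [i|]; last by rewrite /=; under eq_bigr do rewrite mxE.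
      rewrite /= mxE in_itv/= l0 /= -l1 (bigD1 i)//= lerDl; exact: sumr_ge0.
    by apply: eq_bigr => i _; rewrite !mxE.
  by exists (l 0), (p 0); split => // i; have := l0 i; rewrite in_itv => /andP[].
apply: continuous_compact (compact_setX cL cP).
apply: continuous_subspaceT; apply: continuous_row => j.
under eq_fun do rewrite summxE.
apply: continuous_sum => i; under eq_fun do rewrite mxE.
apply: continuous_mul.
  by apply: continuous_coord; cont.
by apply: continuous_coord; apply: continuous_fun_comp (cPi i); cont.
Qed.

(** By Caratheodory's theorem the convex hull is compact, so that it has a point
[z] nearest to [y]; moving from [z] towards a point of [G] cannot come closer to
[y], which says that [y - z] separates. *)
Lemma separation_compact y : compact G -> G !=set0 -> ~ convex_hull G y ->
  exists w, dot w w <= 1 /\ forall x, G x -> 0 < dot w (y - x).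
Proof.
move=> cG [x0 Gx0] nhull.
have C0 : conv_comb N.+1 !=set0.
  exists x0; exists (fun i => if i == ord0 then 1 else 0), (fun=> x0); split => //.
  - by move=> i; case: ifP.
  - by rewrite big_ord_recl big1 ?addr0.
  - by rewrite big_ord_recl big1 ?addr0 ?scale1r// => i _; rewrite scale0r.
have cC := conv_comb_compact (m := N.+1) cG.
have [z Cz zy] := edist_attained cC C0 y.
have yz : y - z != 0.
  apply: contra_notN nhull; rewrite subr_eq0 => /eqP ->.
  exact: conv_comb_sub_hull Cz.
have n0 : 0 < enorm (y - z).
  by rewrite lt_def enorm_ge0 andbT; apply: contraNneq yz => /enorm_eq0 ->.
have key x : G x -> dot (y - z) (x - z) <= 0.
  move=> Gx; rewrite leNgt; apply/negP => d0.
  pose D := dot (x - z) (x - z).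
  have D0 : 0 <= D := dot_ge0 _.
  pose d := dot (y - z) (x - z).
  have [s [s0 s1 sD]] : exists s : R, [/\ 0 < s, s <= 1 & s * D <= d].
    exists (Num.min 1 (d / (D + 1))); split.
    - by rewrite lt_min ltr01 divr_gt0// ltr_wpDl.
    - by rewrite ge_min lexx.
    - have : Num.min 1 (d / (D + 1)) <= d / (D + 1) by rewrite ge_min lexx orbT.
      have : 0 < Num.min 1 (d / (D + 1)) by rewrite lt_min ltr01 divr_gt0// ltr_wpDl.
      by rewrite ler_pdivlMr ?ltr_wpDl//; nra.
  have Cs : conv_comb N.+1 (s *: x + (1 - s) *: z).
    by apply: conv_comb_reduce; apply: conv_comb_segment => //; rewrite ltW.
  have := edist_le C0 y Cs; rewrite -zy enormB [leRHS]enormB ler_enorm.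
  have -> : y - (s *: x + (1 - s) *: z) = (y - z) - s *: (x - z).
    by apply/rowP => i; rewrite !mxE; ring.
  set u := y - z in d d0 sD *; set w := x - z in d D D0 d0 sD *.
  clearbody u w.
  rewrite !dotE (dotC w u) -/d -/D.
  rewrite -/d in d0; clearbody d D.
  by have := mulr_gt0 s0 d0; have := ler_wpM2l (ltW s0) sD; lra.
exists ((enorm (y - z))^-1 *: (y - z)); split.
  rewrite -(expr1n R 2) -enorm_le// enormZ gtr0_norm ?invr_gt0// mulVf ?gt_eqF//.
move=> x Gx; rewrite dotZl mulr_gt0 ?invr_gt0//.
have -> : y - x = (y - z) - (x - z) by apply/rowP => i; rewrite !mxE; ring.
rewrite dotDr dotNr -sqr_enorm.
have n2 : 0 < enorm (y - z) ^+ 2 by rewrite exprn_gt0.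
by have := key x Gx; lra.
Qed.

End caratheodory.

(** * First-order definability *)

Section definability.
Variables (R : realType) (Def : forall n, set (set 'rV[R]_n)).
Hypothesis omin : o_minimal_structure Def.

(** Definability in terms of sequences: reading [x : 'rV_n] as a sequence that is
zero from [n] on removes the dependency of coordinates on the dimension. *)
Definition seq_of n (x : 'rV[R]_n) (k : nat) : R :=
  if insub k is Some i then x 0 i else 0.

Lemma seq_of_ord n (x : 'rV[R]_n) (i : 'I_n) : seq_of x i = x 0 i.
Proof. by rewrite /seq_of valK. Qed.

Lemma seq_of_lt n (x : 'rV[R]_n) k (kn : (k < n)%N) :
  seq_of x k = x 0 (Ordinal kn).
Proof. by rewrite -seq_of_ord. Qed.

Lemma seq_of_ge n (x : 'rV[R]_n) k : (n <= k)%N -> seq_of x k = 0.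
Proof. by move=> nk; rewrite /seq_of insubF// ltnNge nk. Qed.

Definition seq_definable n (P : (nat -> R) -> Prop) :=
  Def [set x : 'rV[R]_n | P (seq_of x)].

Local Notation DN := seq_definable.

Lemma DN_eq n P Q :
  (forall s, (forall k, (n <= k)%N -> s k = 0) -> P s <-> Q s) ->
  DN n P -> DN n Q.
Proof.
move=> PQ; congr Def; apply/seteqP; split => x /=; apply PQ => k; exact: seq_of_ge.
Qed.

Lemma DN_not n P : DN n P -> DN n (fun s => ~ P s).
Proof. by move=> /(def_setC omin). Qed.

Lemma DN_or n P Q : DN n P -> DN n Q -> DN n (fun s => P s \/ Q s).
Proof. by move=> dP dQ; exact: (def_setU omin). Qed.

Lemma DN_and n P Q : DN n P -> DN n Q -> DN n (fun s => P s /\ Q s).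
Proof.
move=> dP dQ; apply: (@DN_eq n (fun s => ~ (~ P s \/ ~ Q s))).
  move=> s _; split=> [h|[p q] [/(_ p)|/(_ q)]//].
  by split; apply: contrapT => k; apply: h; [left|right].
by apply: DN_not; apply: DN_or; exact: DN_not.
Qed.

Lemma DN_true n : DN n (fun=> True).
Proof.
apply: (@DN_eq n (fun=> ~ False)); first by move=> s _; split => // _ [].
by apply: DN_not; exact: (def_set0 omin).
Qed.

Lemma DN_forall_lt n m (P : nat -> (nat -> R) -> Prop) :
  (forall k, (k < m)%N -> DN n (P k)) -> DN n (fun s => forall k, (k < m)%N -> P k s).
Proof.
elim: m => [|m IH] dP; first by apply: (@DN_eq n (fun=> True)) (DN_true n).
apply: (@DN_eq n (fun s => (forall k, (k < m)%N -> P k s) /\ P m s)).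
  move=> s _; split=> [[h hm] k|h]; last by split=> [k km|]; apply: h => //; exact: ltnW.
  by rewrite ltnS leq_eqVlt => /orP[/eqP ->|/h].
by apply: DN_and; [apply: IH => k km; apply: dP; exact: ltnW|exact: dP].
Qed.

Lemma DN_prodl n P : DN n P -> DN n.+1 (fun s => P (fun k => s k.+1)).
Proof.
move=> /(def_prodl omin); congr Def.
have key (x : 'rV[R]_(1 + n)) : seq_of (rsubmx x) = fun k => seq_of x k.+1.
  apply/funext => k; have [kn|kn] := ltnP k n; last by rewrite !seq_of_ge.
  rewrite (seq_of_lt _ kn) mxE -seq_of_ord; congr seq_of.
by apply/seteqP; split => x /=; rewrite key.
Qed.

Lemma DN_prodr n P : DN n P ->
  DN n.+1 (fun s => P (fun k => if (k < n)%N then s k else 0)).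
Proof.
move=> /(def_prodr omin); rewrite -(addn1 n); congr Def.
have key (x : 'rV[R]_(n + 1)) :
    seq_of (lsubmx x) = fun k => if (k < n)%N then seq_of x k else 0.
  apply/funext => k; have [kn|kn] := ltnP k n; last by rewrite seq_of_ge.
  by rewrite (seq_of_lt _ kn) mxE -seq_of_ord.
by apply/seteqP; split => x /=; rewrite key.
Qed.

Lemma DN_proj n P : DN n.+1 P ->
  DN n (fun s => exists r, P (fun k => if k == n then r else s k)).
Proof.
rewrite -(addn1 n) => /(def_proj omin); congr Def.
have key (x : 'rV[R]_(n + 1)) :
    seq_of x = fun k => if k == n then x 0 (rshift n ord0) else seq_of (lsubmx x) k.
  apply/funext => k; case: eqP => [->|/eqP kn].
    by rewrite -seq_of_ord /= addn0.
  have [kn'|kn'] := ltnP k n.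
    by rewrite (seq_of_lt _ kn') mxE -seq_of_ord.
  by rewrite !seq_of_ge// addn1 ltn_neqAle eq_sym kn.
apply/seteqP; split => [_ [x /= + <-]|y [r Pr]].
  by rewrite key => Px; exists (x 0 (rshift n ord0)).
exists (row_mx y r%:M); last by rewrite row_mxKl.
by rewrite /= key row_mxKl row_mxEr mxE eqxx.
Qed.

Lemma DN_diag n : DN n.+1 (fun s => s 0%N = s n).
Proof.
have := def_diag omin n; congr Def; apply/seteqP; split => x /=;
  by rewrite -(seq_of_ord x ord0) -(seq_of_ord x ord_max).
Qed.

Lemma DN_shift d n P : DN n P -> DN (d + n) (fun s => P (fun k => s (d + k)%N)).
Proof.
by move=> dP; elim: d => [//|d IH]; have := DN_prodl IH.
Qed.

Lemma DN_widen d n P : DN n P ->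
  DN (n + d) (fun s => P (fun k => if (k < n)%N then s k else 0)).
Proof.
move=> dP; elim: d => [|d IH].
  rewrite addn0; apply: DN_eq dP => s s0.
  suff -> : (fun k => if (k < n)%N then s k else 0) = s by [].
  by apply/funext => k; case: ltnP => // /s0.
rewrite addnS; apply: DN_eq (DN_prodr IH) => s s0.
suff -> : (fun k => if (k < n)%N then if (k < n + d)%N then s k else 0 else 0) =
    (fun k => if (k < n)%N then s k else 0) by [].
by apply/funext => k; case: ltnP => // kn; rewrite ltn_addr.
Qed.

Lemma DN_equal_lt m i j : (i < j)%N -> (j < m)%N -> DN m (fun s => s i = s j).
Proof.
move=> ij jm; have := DN_widen (m - j.+1) (DN_shift i (DN_diag (j - i))).
have -> : (i + (j - i).+1)%N = j.+1 by rewrite addnS subnKC// ltnW.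
rewrite subnKC//; apply: DN_eq => s _.
by rewrite addn0 subnKC ?(ltnW ij)// ltnSn (ltn_trans ij).
Qed.

Lemma DN_equal m i j : (i < m)%N -> (j < m)%N -> DN m (fun s => s i = s j).
Proof.
move=> im jm; have [ij|ji|->] := ltngtP i j; first exact: DN_equal_lt.
  by apply: DN_eq (DN_equal_lt ji im) => s _; split.
by apply: DN_eq (DN_true m) => s _.
Qed.

Lemma DN_projs d n P : DN (n + d) P ->
  DN n (fun s => exists t : nat -> R,
    P (fun k => if (k < n)%N then s k else if (k < n + d)%N then t k else 0)).
Proof.
elim: d P => [|d IH] P.
  rewrite addn0; apply: DN_eq => s s0.
  have E t : (fun k => if (k < n)%N then s k else if (k < n)%N then t k else 0 : R) = s.
    by apply/funext => k; case: ltnP => // /s0.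
  by split=> [Ps|[t]]; rewrite ?E//; exists (fun=> 0); rewrite E.
rewrite addnS => /DN_proj/IH; apply: DN_eq => s s0; split.
  move=> [t [r h]]; exists (fun k => if k == (n + d)%N then r else t k).
  move: h; congr P; apply/funext => k; case: eqP => [->|/eqP kn].
    by rewrite ltnNge leq_addr/= ltnSn.
  by rewrite ltnS (leq_eqVlt k) (negbTE kn).
move=> [t h]; exists t, (t (n + d)%N).
move: h; congr P; apply/funext => k; case: eqP => [->|/eqP kn].
  by rewrite ltnNge leq_addr/= ltnSn.
by rewrite ltnS (leq_eqVlt k) (negbTE kn).
Qed.

(** The substituted values are taken as new coordinates, equated with the old ones,
and the old context is projected away; this covers permutation, duplication and
weakening of variables at once. *)
Lemma DN_subst n m (g : nat -> nat) P : (forall k, (k < n)%N -> (g k < m)%N) ->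
  DN n P -> DN m (fun s => P (fun k => if (k < n)%N then s (g k) else 0)).
Proof.
move=> gm dP.
have dE : DN (m + n) (fun s => forall k, (k < n)%N -> s (m + k)%N = s (g k)).
  apply: DN_forall_lt => k kn; apply: DN_equal; first by rewrite ltn_add2l.
  by rewrite ltn_addr// gm.
apply: DN_eq (DN_projs (DN_and (DN_shift m dP) dE)) => s s0.
have E (t : nat -> R) : (forall k, (k < n)%N -> t (m + k)%N = s (g k)) ->
    (fun k => if (m + k < m)%N then s (m + k)%N
              else if (m + k < m + n)%N then t (m + k)%N else 0) =
    (fun k => if (k < n)%N then s (g k) else 0).
  move=> h; apply/funext => k; rewrite ltnNge leq_addr /= ltn_add2l.
  by case: ltnP => // kn; exact: h.
split=> [[t [Pt ht]]|Ps].
  rewrite -(E t)// => k kn; have := ht k kn.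
  by rewrite ltnNge leq_addr/= ltn_add2l kn gm.
exists (fun k => s (g (k - m)%N)); split.
  by move: Ps; rewrite -(E (fun k => s (g (k - m)%N))) // => k kn; rewrite addKn.
move=> k kn; rewrite ltnNge leq_addr/= ltn_add2l kn gm//.
by rewrite addKn.
Qed.

(** Definable predicates, terms and vectors in a context of [n] variables; a
quantifier over vectors extends the context on the right. *)
Definition dterm n (f : 'rV[R]_n -> R) :=
  Def [set z : 'rV[R]_(n + 1) | rsubmx z 0 0 = f (lsubmx z)].

Definition dvector n N (h : 'rV[R]_n -> 'rV[R]_N) :=
  forall i, dterm (fun x => h x 0 i).

Lemma def_eq n (P Q : 'rV[R]_n -> Prop) : (forall x, P x <-> Q x) ->
  Def [set x | P x] -> Def [set x | Q x].
Proof. by move=> PQ; congr Def; apply/seteqP; split => x /= /PQ. Qed.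

Lemma def_not n (P : 'rV[R]_n -> Prop) :
  Def [set x | P x] -> Def [set x | ~ P x].
Proof. exact: (def_setC omin). Qed.

Lemma def_or n (P Q : 'rV[R]_n -> Prop) : Def [set x | P x] -> Def [set x | Q x] ->
  Def [set x | P x \/ Q x].
Proof. exact: (def_setU omin). Qed.

Lemma def_and n (P Q : 'rV[R]_n -> Prop) : Def [set x | P x] -> Def [set x | Q x] ->
  Def [set x | P x /\ Q x].
Proof.
move=> dP dQ; apply: (@def_eq n (fun x => ~ (~ P x \/ ~ Q x))).
  move=> s; split=> [h|[p q] [/(_ p)|/(_ q)]//].
  by split; apply: contrapT => k; apply: h; [left|right].
by apply: def_not; apply: def_or; exact: def_not.
Qed.

Lemma def_imp n (P Q : 'rV[R]_n -> Prop) : Def [set x | P x] -> Def [set x | Q x] ->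
  Def [set x | P x -> Q x].
Proof.
move=> dP dQ; apply: (@def_eq n (fun x => ~ P x \/ Q x)).
  by move=> s; split=> [[h /h|//]|h] //; have [/h|] := pselect (P s); [right|left].
by apply: def_or => //; exact: def_not.
Qed.

Lemma def_subst m n (g : 'I_m -> 'I_n) (A : set 'rV[R]_m) : Def A ->
  Def [set x : 'rV[R]_n | A (\row_i x 0 (g i))].
Proof.
move=> dA.
have dP : DN m (fun s => A (\row_i s (val i))).
  move: dA; congr Def; apply/seteqP; split => x /=;
  suff -> : \row_(i < m) seq_of x i = x by [];
  by apply/rowP => i; rewrite mxE seq_of_ord.
pose g' k := if insub k is Some i then val (g i) else 0%N.
have g'E (i : 'I_m) : g' i = g i by rewrite /g' valK.
have g'm k : (k < m)%N -> (g' k < n)%N.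
  by move=> km; rewrite (g'E (Ordinal km)).
have := DN_subst g'm dP; congr Def; apply/seteqP; split => x /=; congr A;
  by apply/rowP => i; rewrite !mxE ltn_ord g'E seq_of_ord.
Qed.

Lemma def_ex n N (P : 'rV[R]_n -> 'rV[R]_N -> Prop) :
  Def [set z : 'rV[R]_(n + N) | P (lsubmx z) (rsubmx z)] ->
  Def [set x | exists y, P x y].
Proof.
move=> dP.
have dQ : DN (n + N) (fun s => P (\row_i s (val i)) (\row_i s (n + val i)%N)).
  move: dP; congr Def; apply/seteqP; split => x /=; congr P;
  by apply/rowP => i; rewrite !mxE -seq_of_ord.
have := DN_projs dQ; congr Def; apply/seteqP; split => x /=.
  move=> [t h]; exists (\row_i t (n + val i)%N); move: h; congr P;
    apply/rowP => i; rewrite !mxE.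
    by rewrite ltn_ord seq_of_ord.
  by rewrite ltnNge leq_addr/= ltn_add2l ltn_ord.
move=> [y Pxy]; exists (fun k => seq_of y (k - n)%N); move: Pxy; congr P;
  apply/rowP => i; rewrite !mxE.
  by rewrite ltn_ord seq_of_ord.
by rewrite ltnNge leq_addr/= ltn_add2l ltn_ord addKn seq_of_ord.
Qed.

Lemma def_all n N (P : 'rV[R]_n -> 'rV[R]_N -> Prop) :
  Def [set z : 'rV[R]_(n + N) | P (lsubmx z) (rsubmx z)] ->
  Def [set x | forall y, P x y].
Proof.
move=> dP; apply: (@def_eq n (fun x => ~ exists y, ~ P x y)).
  move=> x; split=> [h y|h [y]]; last by apply.
  by apply: contrapT => k; apply: h; exists y.
by apply: def_not; apply: def_ex; exact: def_not.
Qed.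

Lemma def_forall_ord n m (P : 'I_m -> 'rV[R]_n -> Prop) :
  (forall i, Def [set x | P i x]) -> Def [set x | forall i, P i x].
Proof.
move=> dP; suff : forall s : seq 'I_m, Def [set x | forall i, i \in s -> P i x].
  move=> /(_ (enum 'I_m)); apply: def_eq => x.
  by split=> [h i|h i _]; [apply: h; rewrite mem_enum|].
elim=> [|i s IH]; first by apply: def_eq (DN_true n) => x; split.
apply: def_eq (def_and (dP i) IH) => x; split=> [[hi hs] j|h].
  by rewrite inE => /orP[/eqP ->|/hs].
by split=> [|j js]; apply: h; rewrite inE ?eqxx// js orbT.
Qed.

Lemma dterm_graph n m (f : 'rV[R]_n -> R) (g : 'I_n -> 'I_m) (j : 'I_m) : dterm f ->
  Def [set z : 'rV[R]_m | z 0 j = f (\row_i z 0 (g i))].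
Proof.
move=> df; pose h (i : 'I_(n + 1)) := match fintype.split i with inl i => g i | inr _ => j end.
have := def_subst h df; apply: def_eq => z.
have E a b : rsubmx (\row_i z 0 (h i)) a b = z 0 j.
  by rewrite (ord1 b) !mxE /h (unsplitK (inr 0)).
rewrite /= E.
suff -> : lsubmx (\row_i z 0 (h i)) = \row_i z 0 (g i) by [].
by apply/rowP => i; rewrite !mxE /h (unsplitK (inl i)).
Qed.

Lemma lsubmx_rowE n m (z : 'rV[R]_(n + m)) : lsubmx z = \row_i z 0 (lshift m i).
Proof. by apply/rowP => i; rewrite !mxE. Qed.

Lemma rsubmx_rowE n m (z : 'rV[R]_(n + m)) : rsubmx z = \row_i z 0 (rshift n i).
Proof. by apply/rowP => i; rewrite !mxE. Qed.

(** The value of [h] is quantified over, its coordinates being tied to [x] by their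
graphs. *)
Lemma def_comp n N (A : set 'rV[R]_N) (h : 'rV[R]_n -> 'rV[R]_N) : Def A ->
  dvector h -> Def [set x | A (h x)].
Proof.
move=> dA dh.
apply: (@def_eq n (fun x => exists y, A y /\ forall i, y 0 i = h x 0 i)).
  move=> x; split=> [[y [Ay hy]]|Ah]; last by exists (h x).
  by suff <- : y = h x by []; apply/rowP.
apply: def_ex; apply: def_and.
  have := def_subst (fun i => rshift n i) dA; apply: def_eq => z.
  by rewrite rsubmx_rowE.
apply: def_forall_ord => i.
have := dterm_graph (m := n + N) (fun i => lshift N i) (rshift n i) (dh i).
by apply: def_eq => z; rewrite -lsubmx_rowE mxE.
Qed.

Lemma dterm_subst n m (f : 'rV[R]_n -> R) (g : 'I_n -> 'I_m) : dterm f ->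
  dterm (fun z : 'rV[R]_m => f (\row_i z 0 (g i))).
Proof.
move=> df.
have := dterm_graph (m := m + 1) (fun i => lshift 1 (g i)) (rshift m ord0) df.
apply: def_eq => z; rewrite mxE.
by have -> : \row_i z 0 (lshift 1 (g i)) = \row_i lsubmx z 0 (g i);
  first by apply/rowP => i; rewrite !mxE.
Qed.

Lemma dterm_lsub n m (f : 'rV[R]_n -> R) : dterm f ->
  dterm (fun z : 'rV[R]_(n + m) => f (lsubmx z)).
Proof.
move=> /(dterm_subst (fun i => lshift m i)); congr Def; apply/seteqP; split => z /=;
  by move=> ->; congr f; apply/rowP => i; rewrite !mxE.
Qed.

Lemma dterm_coord n (i : 'I_n) : dterm (fun x => x 0 i).
Proof.
have := def_subst (fun k : 'I_2 => if k == 0 then rshift n (0 : 'I_1) else lshift 1 i)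
  (def_diag omin 1).
apply: def_eq => z /=; rewrite [X in X = _]mxE [X in _ = X]mxE /= mxE [in X in _ <-> X]mxE; by [].
Qed.

Lemma dvector_rsub n m : dvector (fun z : 'rV[R]_(n + m) => rsubmx z).
Proof.
move=> i; have := dterm_coord (rshift n i); congr Def.
by apply/seteqP; split => z /=; rewrite !mxE.
Qed.

Definition row3 (a b c : R) : 'rV[R]_3 := \row_i nth 0 [:: a; b; c] i.
Definition row2 (a b : R) : 'rV[R]_2 := \row_i nth 0 [:: a; b] i.

Section terms.
Variable n : nat.
Implicit Types f g : 'rV[R]_n -> R.

Lemma dvector_row3 f g h : dterm f -> dterm g -> dterm h ->
  dvector (fun x : 'rV[R]_n => row3 (f x) (g x) (h x)).
Proof.
move=> df dg dh [[|[|[|//]]] i3]; [move: df|move: dg|move: dh];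
  by congr Def; apply/seteqP; split => z /= ->; rewrite mxE.
Qed.

Lemma dvector_row2 f g : dterm f -> dterm g ->
  dvector (fun x : 'rV[R]_n => row2 (f x) (g x)).
Proof.
move=> df dg [[|[|//]] i3]; [move: df|move: dg];
  by congr Def; apply/seteqP; split => z /= ->; rewrite mxE.
Qed.

End terms.

Section term_operations.
Variable n : nat.
Implicit Types f g : 'rV[R]_n -> R.

Lemma dterm_cst (c : R) : dterm (fun _ : 'rV[R]_n => c).
Proof.
have d1 : Def [set x : 'rV[R]_1 | x 0 0 = c].
  apply/(def_omin omin); exists [:: `[c, c]%R]; apply/seteqP.
  by split => x /=; rewrite orbF in_itv/= -eq_le eq_sym => /eqP.
by have := def_subst (fun=> rshift n (0 : 'I_1)) d1; apply: def_eq => z; rewrite /= mxE [in X in _ <-> X]mxE.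
Qed.

Lemma def_lt_terms f g : dterm f -> dterm g -> Def [set x | f x < g x].
Proof.
move=> df dg; have := def_comp (def_lt omin) (dvector_row2 df dg).
by apply: def_eq => z; rewrite /= !mxE.
Qed.

Lemma dterm_add f g : dterm f -> dterm g -> dterm (fun x => f x + g x).
Proof.
move=> df dg; have := def_comp (def_add omin) (dvector_row3 (dterm_lsub 1 df)
  (dterm_lsub 1 dg) (dvector_rsub n (0 : 'I_1))).
by apply: def_eq => z; rewrite /= !mxE /= inordK.
Qed.

Lemma dterm_mul f g : dterm f -> dterm g -> dterm (fun x => f x * g x).
Proof.
move=> df dg; have := def_comp (def_mul omin) (dvector_row3 (dterm_lsub 1 df)
  (dterm_lsub 1 dg) (dvector_rsub n (0 : 'I_1))).
by apply: def_eq => z; rewrite /= !mxE /= inordK.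
Qed.

Lemma dterm_opp f : dterm f -> dterm (fun x => - f x).
Proof.
move=> df; have := dterm_mul (dterm_cst (-1)) df.
by apply: def_eq => z; rewrite mulN1r.
Qed.

Lemma dterm_sum (T : finType) (F : T -> 'rV[R]_n -> R) :
  (forall i, dterm (F i)) -> dterm (fun x => \sum_i F i x).
Proof.
move=> dF; elim: (index_enum T) => [|i s IH].
  by have := dterm_cst 0; apply: def_eq => z; rewrite big_nil.
by have := dterm_add (dF i) IH; apply: def_eq => z; rewrite big_cons.
Qed.

Lemma def_le_terms f g : dterm f -> dterm g -> Def [set x | f x <= g x].
Proof.
move=> df dg; have := def_not (def_lt_terms dg df).
by apply: def_eq => x; rewrite leNgt; split => /negP.
Qed.

Lemma def_eq_terms f g : dterm f -> dterm g -> Def [set x | f x = g x].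
Proof.
move=> df dg; have := def_and (def_le_terms df dg) (def_le_terms dg df).
apply: def_eq => x; split=> [[h1 h2]|->] //.
by apply/eqP; rewrite eq_le h1 h2.
Qed.

Lemma dterm_dot N (u v : 'rV[R]_n -> 'rV[R]_N) : dvector u -> dvector v ->
  dterm (fun x => dot (u x) (v x)).
Proof. by move=> du dv; apply: dterm_sum => i; apply: dterm_mul. Qed.

Lemma dvector_sub N (u v : 'rV[R]_n -> 'rV[R]_N) : dvector u -> dvector v ->
  dvector (fun x => u x - v x).
Proof.
move=> du dv i; have := dterm_add (du i) (dterm_opp (dv i)).
by apply: def_eq => z; rewrite !mxE.
Qed.

End term_operations.
End definability.

(** * Germs on the line *)

Section real_functions.
Variable R : realType.
Implicit Types f : R -> R.

Lemma bound_germ_right (p x : R) : exists2 e, 0 < e & forall s, p < s < p + e ->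
  (x < s) = (x <= p) /\ (x <= s) = (x <= p).
Proof.
have [xp|px] := leP x p.
  exists 1 => // s /andP[ps _]; have xs := le_lt_trans xp ps.
  by rewrite xs ltW.
exists (x - p); first by rewrite subr_gt0.
move=> s /andP[_]; rewrite addrC subrK => sx.
by rewrite ltNge (ltW sx) leNgt sx.
Qed.

Lemma bound_germ_left (p x : R) : exists2 e, 0 < e & forall s, p - e < s < p ->
  (x < s) = (x < p) /\ (x <= s) = (x < p).
Proof.
have [xp|px] := ltP x p; last first.
  exists 1 => // s /andP[_ sp]; have sx := lt_le_trans sp px.
  by rewrite ltNge (ltW sx) leNgt sx.
exists (p - x); first by rewrite subr_gt0.
move=> s /andP[+ _]; rewrite opprB addrC subrK => sx.
by rewrite sx ltW.
Qed.

(** Here [near_p e s] stands for [s] lying within [e] of a point, on one fixed side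
of it; the hypotheses are what the two sides have in common. *)
Lemma interval_germ (near_p : R -> R -> Prop) (i : interval R) :
  (forall e e' s, e <= e' -> near_p e s -> near_p e' s) ->
  (forall x, exists2 e, 0 < e & exists c, forall s, near_p e s ->
     (x < s) = c /\ (x <= s) = c) ->
  exists2 e, 0 < e & exists c, forall s, near_p e s -> (s \in i) = c.
Proof.
move=> mono bnd; case: i => l u.
have [e1 e10 [c1 h1]] : exists2 e, 0 < e & exists c, forall s, near_p e s ->
    (l <= BLeft s)%O = c.
  case: l => [[] x|[]].
  - have [e e0 [c h]] := bnd x; exists e => //; exists c => s /h [_ <-].
    by rewrite bnd_simp.
  - have [e e0 [c h]] := bnd x; exists e => //; exists c => s /h [<- _].
    by rewrite bnd_simp.
  - by exists 1 => //; exists true.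
  - by exists 1 => //; exists false.
have [e2 e20 [c2 h2]] : exists2 e, 0 < e & exists c, forall s, near_p e s ->
    (BRight s <= u)%O = c.
  case: u => [[] x|[]].
  - have [e e0 [c h]] := bnd x; exists e => //; exists (~~ c) => s /h [_ <-].
    by rewrite bnd_simp ltNge.
  - have [e e0 [c h]] := bnd x; exists e => //; exists (~~ c) => s /h [<- _].
    by rewrite bnd_simp leNgt.
  - by exists 1 => //; exists false.
  - by exists 1 => //; exists true.
exists (Num.min e1 e2); first by rewrite lt_min e10.
exists (c1 && c2) => s ns.
have s1 : near_p e1 s by apply: mono ns; rewrite ge_min lexx.
have s2 : near_p e2 s by apply: mono ns; rewrite ge_min lexx orbT.
by rewrite -[LHS]/((l <= BLeft s)%O && (BRight s <= u)%O) h1// h2.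
Qed.

Lemma intervals_germ (near_p : R -> R -> Prop) (l : seq (interval R)) :
  (forall e e' s, e <= e' -> near_p e s -> near_p e' s) ->
  (forall x, exists2 e, 0 < e & exists c, forall s, near_p e s ->
     (x < s) = c /\ (x <= s) = c) ->
  exists2 e, 0 < e & exists c, forall s, near_p e s ->
    has (fun i : interval R => s \in i) l = c.
Proof.
move=> mono bnd; elim: l => [|i l [e e0 [c h]]]; first by exists 1 => //; exists false.
have [e' e'0 [c' h']] := interval_germ i mono bnd.
exists (Num.min e e'); first by rewrite lt_min e0.
exists (c' || c) => s ns /=; rewrite h ?h'//.
  by apply: mono ns; rewrite ge_min lexx orbT.
by apply: mono ns; rewrite ge_min lexx.
Qed.

(** A function that is locally nondecreasing at every point of an interval is
nondecreasing: the supremum of the points up to which it stays above its value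
at [x] cannot be smaller than [y]. *)
Lemma local_nondecreasing f (a b : R) :
  (forall t, a < t < b -> exists2 e, 0 < e & forall s, a < s < b ->
     t < s < t + e -> f t <= f s) ->
  (forall t, a < t < b -> exists2 e, 0 < e & forall s, a < s < b ->
     t - e < s < t -> f s <= f t) ->
  forall x y, a < x -> x <= y -> y < b -> f x <= f y.
Proof.
move=> right left x y ax xy yb.
pose S := [set z | x <= z <= y /\ forall w, x <= w <= z -> f x <= f w].
have Sx : S x.
  by split=> [|w]; [rewrite lexx|rewrite -eq_le => /eqP <-].
have supS : has_sup S by split; [exists x|exists y => z [/andP[]]].
pose z := sup S.
have xz : x <= z by apply: sup_upper_bound.
have zy : z <= y by apply: ge_sup => [|w [/andP[]]]; first by exists x.
have below w : x <= w < z -> f x <= f w.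
  move=> /andP[xw wz]; have d0 : 0 < z - w by rewrite subr_gt0.
  have [u [/andP[xu uy] Su] wu] := sup_adherent d0 supS.
  apply: Su; rewrite xw /=; apply/ltW.
  by move: wu; rewrite -/z opprB addrC subrK.
have fz : f x <= f z.
  have [->//|xz'] := eqVneq x z.
  have {}xz' : x < z by rewrite lt_neqAle xz'.
  have [|e e0 he] := left z; first by rewrite (lt_le_trans ax xz) (le_lt_trans zy yb).
  pose w := Num.max x (z - e / 2).
  have wz : w < z by rewrite gt_max xz' /=; lra.
  have xw : x <= w by rewrite le_max lexx.
  apply: (@le_trans _ _ (f w)); first by apply: below; rewrite xw.
  apply: he; first by rewrite (lt_le_trans ax xw) (lt_trans wz) ?(le_lt_trans zy yb).
  rewrite wz andbT; have : z - e / 2 <= w by rewrite le_max lexx orbT.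
  by lra.
have [<-//|zy'] := eqVneq z y.
have {}zy' : z < y by rewrite lt_neqAle zy' zy.
have [|e e0 he] := right z; first by rewrite (lt_le_trans ax xz) (le_lt_trans zy yb).
pose w := Num.min y (z + e / 2).
have zw : z < w by rewrite lt_min zy' /=; lra.
have wy : w <= y by rewrite ge_min lexx.
have wz2 : w <= z + e / 2 by rewrite ge_min lexx orbT.
suff Sw : S w by have := sup_upper_bound supS Sw; rewrite -/z leNgt zw.
split; first by rewrite wy (le_trans xz (ltW zw)).
move=> u /andP[xu uw]; have [uz|zu] := ltP u z; first by apply: below; rewrite xu.
have [->//|uz] := eqVneq u z.
apply: (le_trans fz); apply: he; last by rewrite lt_neqAle eq_sym uz zu /=; lra.
by rewrite (lt_le_trans ax xu) (le_lt_trans (le_trans uw wy) yb).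
Qed.

(** Strict local extrema are countably many, each being isolated from the others by
a rational interval, while an open interval has positive measure. *)
Lemma no_everywhere_strict_extremum f (rel : R -> R -> Prop) (a b : R) : a < b ->
  (forall x y, rel x y -> ~ rel y x) ->
  ~ (forall t, a < t < b -> exists2 e, 0 < e & forall s, a < s < b -> s != t ->
      t - e < s < t + e -> rel (f t) (f s)).
Proof.
move=> ab asym ext.
pose A : set R := [set` `]a, b[%R].
have loc t : exists q : rat * rat, A t -> ratr q.1 < t < ratr q.2 /\
    forall s, A s -> s != t -> ratr q.1 < s < ratr q.2 -> rel (f t) (f s).
  have [At|nAt] := pselect (A t); last by exists (0, 0).
  have [|e e0 he] := ext t; first by move: At; rewrite /A /= in_itv.
  have [|q1 /itvP q1P] := rat_in_itvoo (x := t - e) (y := t); first by lra.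
  have [|q2 /itvP q2P] := rat_in_itvoo (x := t) (y := t + e); first by lra.
  exists (q1, q2) => _; split => [/=|s As st /= /andP[s1 s2]]; first by rewrite q1P q2P.
  apply: he => //.
  have : t - e < ratr q1 by rewrite q1P.
  have : ratr q2 < t + e by rewrite q2P.
  by lra.
have [q hq] := choice loc.
have cA : countable A.
  apply/countable_injP; exists (fun t => pickle (q t)).
  move=> t t' /set_mem At /set_mem At' /(pcan_inj pickleK) qq.
  apply: contrapT => /eqP tt'.
  have [_ h] := hq t At; have [_ h'] := hq t' At'.
  have [I _] := hq t At; have [I' _] := hq t' At'.
  apply: (asym (f t) (f t')).
    by apply: h => //; [rewrite eq_sym|rewrite qq].
  by apply: h' => //; rewrite -qq.
have := countable_lebesgue_measure0 cA.
rewrite lebesgue_measure_itv /= lte_fin ab => /eqP.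
by rewrite eqe subr_eq0 gt_eqF.
Qed.

End real_functions.

Section germs.
Variables (R : realType) (Def : forall n, set (set 'rV[R]_n)).
Hypothesis omin : o_minimal_structure Def.

Definition definable_in_line (A : set R) := Def [set x : 'rV[R]_1 | A (x 0 0)].

Lemma definable_germ (near_p : R -> R -> Prop) (A : set R) : definable_in_line A ->
  (forall e e' s, e <= e' -> near_p e s -> near_p e' s) ->
  (forall x, exists2 e, 0 < e & exists c, forall s, near_p e s ->
     (x < s) = c /\ (x <= s) = c) ->
  exists2 e, 0 < e & (forall s, near_p e s -> A s) \/ (forall s, near_p e s -> ~ A s).
Proof.
move=> /(def_omin omin)[l lE] mono bnd.
have AE s : A s <-> has (fun i : interval R => s \in i) l.
  have : [set x : 'rV[R]_1 | A (x 0 0)] (const_mx s) <->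
      [set x : 'rV[R]_1 | has (fun i : interval R => x 0 0 \in i) l] (const_mx s).
    by rewrite lE.
  by rewrite /= !mxE.
have [e e0 [[] h]] := intervals_germ l mono bnd; exists e => //.
  by left => s /h sl; apply/AE.
by right => s /h sl /AE; rewrite sl.
Qed.

Lemma definable_germ_right (A : set R) p : definable_in_line A ->
  exists2 e, 0 < e & (forall s, p < s < p + e -> A s) \/
    (forall s, p < s < p + e -> ~ A s).
Proof.
move=> dA; apply: (definable_germ (near_p := fun e s => p < s < p + e) dA).
  by move=> e e' s ee' /andP[-> se] /=; lra.
by move=> x; have [e e0 h] := bound_germ_right p x; exists e => //; exists (x <= p).
Qed.

Lemma definable_germ_left (A : set R) p : definable_in_line A ->
  exists2 e, 0 < e & (forall s, p - e < s < p -> A s) \/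
    (forall s, p - e < s < p -> ~ A s).
Proof.
move=> dA; apply: (definable_germ (near_p := fun e s => p - e < s < p) dA).
  by move=> e e' s ee' /andP[se ->] /=; rewrite andbT; lra.
by move=> x; have [e e0 h] := bound_germ_left p x; exists e => //; exists (x < p).
Qed.

End germs.

(** * Monotonicity and definable selection *)

Section more_definability.
Variables (R : realType) (Def : forall n, set (set 'rV[R]_n)).
Hypothesis omin : o_minimal_structure Def.

Lemma def_exR n (P : 'rV[R]_n -> R -> Prop) :
  Def [set z : 'rV[R]_(n + 1) | P (lsubmx z) (rsubmx z 0 0)] ->
  Def [set x | exists y, P x y].
Proof.
move=> dP; have := def_ex omin (P := fun x (y : 'rV[R]_1) => P x (y 0 0)) dP.
apply: def_eq => x; split=> [[y Py]|[y Py]]; first by exists (y 0 0).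
by exists (const_mx y); rewrite mxE.
Qed.

Lemma def_allR n (P : 'rV[R]_n -> R -> Prop) :
  Def [set z : 'rV[R]_(n + 1) | P (lsubmx z) (rsubmx z 0 0)] ->
  Def [set x | forall y, P x y].
Proof.
move=> dP; have := def_all omin (P := fun x (y : 'rV[R]_1) => P x (y 0 0)) dP.
apply: def_eq => x; split=> h y; last exact: h.
by have := h (const_mx y); rewrite mxE.
Qed.

Lemma dterm_is_coord n (f : 'rV[R]_n -> R) (j : 'I_n) : (forall z, f z = z 0 j) ->
  dterm Def f.
Proof. by move=> fE; have := dterm_coord omin j; apply: def_eq => z; rewrite fE. Qed.

Lemma dvector_row_mx n p q (u : 'rV[R]_n -> 'rV[R]_p) (v : 'rV[R]_n -> 'rV[R]_q) :
  dvector Def u -> dvector Def v -> dvector Def (fun x => row_mx (u x) (v x)).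
Proof.
move=> du dv i; rewrite -(splitK i); case: (fintype.split i) => j /=;
  [have := du j|have := dv j]; apply: def_eq => z.
  by rewrite row_mxEl.
by rewrite row_mxEr.
Qed.

Lemma dvector_const_mx n p (f : 'rV[R]_n -> R) : dterm Def f ->
  dvector Def (fun x => const_mx (f x) : 'rV[R]_p).
Proof.
move=> df i.
have -> : (fun x => (const_mx (f x) : 'rV[R]_p) 0 i) = f; last exact: df.
by apply/funext => x; rewrite mxE.
Qed.

End more_definability.

Ltac dcoord omin :=
  apply: (dterm_is_coord omin) => ?; rewrite ?mxE; reflexivity.

Ltac dterms omin := cbv beta; lazymatch goal with
  | |- dterm _ (fun _ => ?c) => apply: (dterm_cst omin)
  | |- dterm _ (fun z => Algebra.add (@?f z) (@?g z)) =>
      apply: (dterm_add omin (f := f) (g := g)); dterms omin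
  | |- dterm _ (fun z => Algebra.opp (@?f z)) =>
      apply: (dterm_opp omin (f := f)); dterms omin
  | |- dterm _ (fun z => GRing.mul (@?f z) (@?g z)) =>
      apply: (dterm_mul omin (f := f) (g := g)); dterms omin
  | |- dterm _ (fun z => dot (@?f z) (@?g z)) =>
      apply: (dterm_dot omin (u := f) (v := g)); dterms omin
  | |- dterm _ _ => first [dcoord omin | idtac]
  | |- dvector _ (fun z => row2 (@?f z) (@?g z)) =>
      apply: (dvector_row2 (f := f) (g := g)); dterms omin
  | |- dvector _ (fun z => row_mx (@?f z) (@?g z)) =>
      apply: (dvector_row_mx (u := f) (v := g)); dterms omin
  | |- dvector _ (fun z => const_mx (@?f z)) =>
      apply: (dvector_const_mx (f := f)); dterms omin
  | |- dvector _ (fun z => Algebra.add (@?f z) (Algebra.opp (@?g z))) =>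
      apply: (dvector_sub omin (u := f) (v := g)); dterms omin
  | |- dvector _ _ => let i := fresh "i" in move=> i; dcoord omin
  end.

(** Recursion over a first-order formula; atoms are comparisons of polynomial terms
and memberships in sets whose definability is a hypothesis. *)
Ltac definable omin := cbv beta; lazymatch goal with
  | |- ?D (mkset (fun z => @?P z /\ @?Q z)) =>
      apply: (def_and omin (P := P) (Q := Q)); definable omin
  | |- ?D (mkset (fun z => @?P z \/ @?Q z)) =>
      apply: (def_or omin (P := P) (Q := Q)); definable omin
  | |- ?D (mkset (fun z => ~ @?P z)) =>
      apply: (def_not omin (P := P)); definable omin
  | |- ?D (mkset (fun z => exists y, @?P z y)) =>
      first [apply: (def_exR omin (P := P)) | apply: (def_ex omin (P := P))];
      definable omin
  | |- ?D (mkset (fun z => @?P z -> @?Q z)) =>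
      apply: (def_imp omin (P := P) (Q := Q)); definable omin
  | |- ?D (mkset (fun z => forall y, @?P z y)) =>
      first [apply: (def_allR omin (P := P)) | apply: (def_all omin (P := P))];
      definable omin
  | |- ?D (mkset (fun z => is_true (Order.lt (@?f z) (@?g z)))) =>
      apply: (def_lt_terms omin (f := f) (g := g)); dterms omin
  | |- ?D (mkset (fun z => is_true (Order.le (@?f z) (@?g z)))) =>
      apply: (def_le_terms omin (f := f) (g := g)); dterms omin
  | |- ?D (mkset (fun z => @eq _ (@?f z) (@?g z))) =>
      apply: (def_eq_terms omin (f := f) (g := g)); dterms omin
  | |- ?D (mkset (fun z => ?A (@?h z))) =>
      first [ apply: (def_comp omin (A := A) (h := h)); [eassumption | dterms omin]
            | idtac ]
  | |- _ => first [eassumption | idtac]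
  end.

Section monotonicity.
Variables (R : realType) (Def : forall n, set (set 'rV[R]_n)).
Hypothesis omin : o_minimal_structure Def.
Variables (f : R -> R) (b : R).
Hypothesis b0 : 0 < b.

Let graph : set 'rV[R]_2 := [set x | [/\ 0 < x 0 0, x 0 0 < b & x 0 1 = f (x 0 0)]].
Hypothesis dgraph : Def graph.

Let graphE s r : graph (row2 s r) <-> [/\ 0 < s, s < b & r = f s].
Proof. by rewrite /graph /= !mxE. Qed.

Definition right_germ (rel : R -> R -> Prop) t := exists e, 0 < e /\
  forall s, 0 < s /\ s < b -> t < s /\ s < t + e -> rel (f t) (f s).

Definition left_germ (rel : R -> R -> Prop) t := exists e, 0 < e /\
  forall s, 0 < s /\ s < b -> t - e < s /\ s < t -> rel (f t) (f s).

Lemma definable_right_germ rel :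
  Def [set x : 'rV[R]_2 | rel (x 0 0) (x 0 1)] ->
  definable_in_line Def (fun t => 0 < t /\ t < b /\ right_germ rel t).
Proof.
set A := mkset _ => dA.
suff : Def [set x : 'rV[R]_1 | exists p, graph (row2 (x 0 0) p) /\
    exists e, 0 < e /\ forall s q, graph (row2 s q) -> x 0 0 < s /\ s < x 0 0 + e ->
      A (row2 p q)].
  apply: def_eq => x; split=> [[p [/graphE[x0 xb ->] [e [e0 h]]]]|[x0 [xb [e [e0 h]]]]].
    split => //; split => //; exists e; split => // s [s0 sb] ts.
    by have := h s (f s); rewrite /A /= !mxE /=; apply => //; apply/graphE.
  exists (f (x 0 0)); split; first exact/graphE.
  exists e; split => // s q /graphE[s0 sb ->] ts.
  by rewrite /A /= !mxE /=; exact: h.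
definable omin.
Qed.

Lemma definable_left_germ rel :
  Def [set x : 'rV[R]_2 | rel (x 0 0) (x 0 1)] ->
  definable_in_line Def (fun t => 0 < t /\ t < b /\ left_germ rel t).
Proof.
set A := mkset _ => dA.
suff : Def [set x : 'rV[R]_1 | exists p, graph (row2 (x 0 0) p) /\
    exists e, 0 < e /\ forall s q, graph (row2 s q) -> x 0 0 - e < s /\ s < x 0 0 ->
      A (row2 p q)].
  apply: def_eq => x; split=> [[p [/graphE[x0 xb ->] [e [e0 h]]]]|[x0 [xb [e [e0 h]]]]].
    split => //; split => //; exists e; split => // s [s0 sb] ts.
    by have := h s (f s); rewrite /A /= !mxE /=; apply => //; apply/graphE.
  exists (f (x 0 0)); split; first exact/graphE.
  exists e; split => // s q /graphE[s0 sb ->] ts.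
  by rewrite /A /= !mxE /=; exact: h.
definable omin.
Qed.

Lemma definable_level rel c :
  Def [set x : 'rV[R]_2 | rel (x 0 0) (x 0 1)] ->
  definable_in_line Def (fun s => 0 < s /\ s < b /\ rel c (f s)).
Proof.
set A := mkset _ => dA.
suff : Def [set x : 'rV[R]_1 | exists q, graph (row2 (x 0 0) q) /\ A (row2 c q)].
  apply: def_eq => x; split=> [[q [/graphE[x0 xb ->]]]|[x0 [xb h]]].
    by rewrite /A /= !mxE.
  by exists (f (x 0 0)); split; [exact/graphE|rewrite /A /= !mxE].
definable omin.
Qed.

(** Less, greater and equal in one family, so that the germs of a function can be
classified by an index. *)
Definition order_rel (c : option bool) (x y : R) : Prop :=
  match c with Some true => x < y | Some false => y < x | None => x = y end.

Lemma definable_order_rel c :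
  Def [set x : 'rV[R]_2 | order_rel c (x 0 0) (x 0 1)].
Proof. case: c => [[]|] /=; definable omin. Qed.

Lemma order_rel_trichotomy (P : option bool -> Prop) :
  (~ P (Some true) -> ~ P (Some false) -> P None) -> exists c, P c.
Proof.
move=> h; have [p|np] := pselect (P (Some true)); first by exists (Some true).
have [q|nq] := pselect (P (Some false)); first by exists (Some false).
by exists None; exact: h.
Qed.

Lemma right_germ_cases t : 0 < t -> t < b -> exists c, right_germ (order_rel c) t.
Proof.
move=> t0 tb; apply: order_rel_trichotomy => n1 n2.
have [e1 e10 [h1|h1]] := definable_germ_right omin t (definable_level (f t) (definable_order_rel (Some true))).
  by case: n1; exists e1; split => // s sb /andP ts; have [_ []] := h1 s ts.
have [e2 e20 [h2|h2]] := definable_germ_right omin t (definable_level (f t) (definable_order_rel (Some false))).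
  by case: n2; exists e2; split => // s sb /andP ts; have [_ []] := h2 s ts.
exists (Num.min e1 e2); split; first by rewrite lt_min e10.
move=> s [s0 sb] [ts se].
have {}se1 : s < t + e1 by apply: lt_le_trans se _; rewrite lerD2l ge_min lexx.
have {}se2 : s < t + e2 by apply: lt_le_trans se _; rewrite lerD2l ge_min lexx orbT.
have [l|g|//] := ltgtP (f t) (f s).
  by case: (h1 s); rewrite ?ts.
by case: (h2 s); rewrite ?ts.
Qed.

Lemma left_germ_cases t : 0 < t -> t < b -> exists c, left_germ (order_rel c) t.
Proof.
move=> t0 tb; apply: order_rel_trichotomy => n1 n2.
have [e1 e10 [h1|h1]] := definable_germ_left omin t (definable_level (f t) (definable_order_rel (Some true))).
  by case: n1; exists e1; split => // s sb /andP ts; have [_ []] := h1 s ts.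
have [e2 e20 [h2|h2]] := definable_germ_left omin t (definable_level (f t) (definable_order_rel (Some false))).
  by case: n2; exists e2; split => // s sb /andP ts; have [_ []] := h2 s ts.
exists (Num.min e1 e2); split; first by rewrite lt_min e10.
move=> s [s0 sb] [se ts].
have {}se1 : t - e1 < s by apply: le_lt_trans se; rewrite lerD2l lerN2 ge_min lexx.
have {}se2 : t - e2 < s by apply: le_lt_trans se; rewrite lerD2l lerN2 ge_min lexx orbT.
have [l|g|//] := ltgtP (f t) (f s).
  by case: (h1 s); rewrite ?ts ?se1.
by case: (h2 s); rewrite ?ts ?se2.
Qed.

(** By o-minimality the type of germ is the same at all points near 0. *)
Lemma constant_germ_type (germ : (R -> R -> Prop) -> R -> Prop) :
  (forall c, definable_in_line Def (fun t => 0 < t /\ t < b /\ germ (order_rel c) t)) ->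
  (forall t : R, 0 < t -> t < b -> exists c, germ (order_rel c) t) ->
  exists c e, [/\ 0 < e, e <= b & forall t, 0 < t -> t < e -> germ (order_rel c) t].
Proof.
move=> dg gc.
have germ0 c : exists e, [/\ 0 < e, e <= b & (forall t, 0 < t -> t < e -> germ (order_rel c) t) \/
    (forall t, 0 < t -> t < e -> ~ germ (order_rel c) t)].
  have [e e0 h] := definable_germ_right omin 0 (dg c).
  exists (Num.min e b); split; rewrite ?lt_min ?e0 ?ge_min ?lexx ?orbT//.
  case: h => h; [left|right] => t t0; rewrite lt_min => /andP[te tb].
    by have [|_ []] := h t; rewrite ?t0 ?add0r.
  by move=> g; apply: (h t); rewrite ?t0 ?add0r.
have [e1 [e10 e1b [h1|h1]]] := germ0 (Some true); first by exists (Some true), e1.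
have [e2 [e20 e2b [h2|h2]]] := germ0 (Some false); first by exists (Some false), e2.
exists None, (Num.min e1 e2); split; rewrite ?lt_min ?e10// ?ge_min ?e1b//.
move=> t t0; rewrite lt_min => /andP[te1 te2].
have [[[]|] g] := gc t t0 (lt_le_trans te1 e1b) => //.
  by have := h1 t t0 te1.
by have := h2 t t0 te2.
Qed.

(** Near 0 all the right germs of [f] have one type, and so have all the left germs.
If the two types fit together, then [f] is locally monotone at every point, hence
monotone; if they do not, then every point is a strict local extremum. *)
Lemma monotone_germ : exists e, [/\ 0 < e, e <= b &
  (forall x y, 0 < x -> x <= y -> y < e -> f x <= f y) \/
  (forall x y, 0 < x -> x <= y -> y < e -> f y <= f x)].
Proof.
have [c1 [e1 [e10 e1b h1]]] := constant_germ_type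
  (fun c => definable_right_germ (definable_order_rel c)) right_germ_cases.
have [c2 [e2 [e20 e2b h2]]] := constant_germ_type
  (fun c => definable_left_germ (definable_order_rel c)) left_germ_cases.
pose e := Num.min e1 e2.
have e0 : 0 < e by rewrite lt_min e10.
have eb : e <= b by rewrite ge_min e1b.
exists e; split => //.
have r1 t : 0 < t < e -> exists2 d, 0 < d & forall s, 0 < s < e -> t < s < t + d ->
    order_rel c1 (f t) (f s).
  rewrite lt_min => /andP[t0 /andP[te1 _]]; have [d [d0 hd]] := h1 t t0 te1.
  exists d => // s /andP[s0 se] /andP ts; apply: hd => //.
  by rewrite s0 (lt_le_trans se).
have r2 t : 0 < t < e -> exists2 d, 0 < d & forall s, 0 < s < e -> t - d < s < t ->
    order_rel c2 (f t) (f s).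
  rewrite lt_min => /andP[t0 /andP[_ te1]]; have [d [d0 hd]] := h2 t t0 te1.
  exists d => // s /andP[s0 se] /andP ts; apply: hd => //.
  by rewrite s0 (lt_le_trans se).
have up : (forall x y, order_rel c1 x y -> x <= y) ->
    (forall x y, order_rel c2 x y -> y <= x) ->
    forall x y, 0 < x -> x <= y -> y < e -> f x <= f y.
  move=> o1 o2; apply: local_nondecreasing => t te.
    by have [d d0 hd] := r1 t te; exists d => // s se /hd h; apply/o1/h.
  by have [d d0 hd] := r2 t te; exists d => // s se /hd h; apply/o2/h.
have down : (forall x y, order_rel c1 x y -> y <= x) ->
    (forall x y, order_rel c2 x y -> x <= y) ->
    forall x y, 0 < x -> x <= y -> y < e -> f y <= f x.
  move=> o1 o2 x y x0 xy ye; rewrite -lerN2.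
  apply: (@local_nondecreasing _ (fun t => - f t) 0 e) => // t te.
    by have [d d0 hd] := r1 t te; exists d => // s se /hd h; rewrite lerN2; apply/o1/h.
  by have [d d0 hd] := r2 t te; exists d => // s se /hd h; rewrite lerN2; apply/o2/h.
have ext : c1 = c2 -> (forall x y, order_rel c1 x y -> ~ order_rel c1 y x) -> False.
  move=> c12 asym; apply: (no_everywhere_strict_extremum (f := f) e0 asym) => t te.
  have [d1 d10 hd1] := r1 t te; have [d2 d20 hd2] := r2 t te.
  exists (Num.min d1 d2); first by rewrite lt_min d10.
  move=> s se st /andP[l g].
  have l2 : t - d2 < s by apply: le_lt_trans l; rewrite lerD2l lerN2 ge_min lexx orbT.
  have g1 : s < t + d1 by apply: lt_le_trans g _; rewrite lerD2l ge_min lexx.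
  have [ts|ts] := ltP t s; first by apply: hd1; rewrite ?ts.
  by rewrite c12; apply: hd2; rewrite ?l2 //= lt_neqAle st.
move: up down ext; case: (c1) => [[]|]; case: (c2) => [[]|] /= up down ext.
- by case: ext => // x y xy yx; have := lt_trans xy yx; rewrite ltxx.
- by left; apply: up => x y /ltW.
- by left; apply: up => x y; [move=> /ltW|move=> ->].
- by right; apply: down => x y /ltW.
- by case: ext => // x y xy yx; have := lt_trans xy yx; rewrite ltxx.
- by right; apply: down => x y; [move=> /ltW|move=> ->].
- by right; apply: down => x y; [move=> ->|move=> /ltW].
- by left; apply: up => x y; [move=> ->|move=> /ltW].
- by left; apply: up => x y ->.
Qed.

End monotonicity.

Section selection.
Variables (R : realType) (Def : forall n, set (set 'rV[R]_n)).
Hypothesis omin : o_minimal_structure Def.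
Variable N : nat.
Local Notation E := 'rV[R]_N.

Definition fiber (B : set 'rV[R]_(1 + N)) (t : R) : set E :=
  [set y | B (row_mx (const_mx t) y)].

Definition monotone_coord (B : set 'rV[R]_(1 + N)) (b : R) (i : 'I_N) :=
  (forall t s y z, 0 < t -> t <= s -> s < b -> fiber B t y -> fiber B s z ->
     y 0 i <= z 0 i) \/
  (forall t s y z, 0 < t -> t <= s -> s < b -> fiber B t y -> fiber B s z ->
     z 0 i <= y 0 i).

(** Cutting a definable family of compact sets down to the points with least
[i]-th coordinate makes that coordinate a function of the parameter. *)
Lemma select_coord (B : set 'rV[R]_(1 + N)) (b : R) (i : 'I_N) : 0 < b -> Def B ->
  (forall t : R, 0 < t -> t < b -> compact (fiber B t) /\ fiber B t !=set0) ->
  exists B' b', [/\ 0 < b', b' <= b, Def B', B' `<=` B &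
    (forall t : R, 0 < t -> t < b' -> compact (fiber B' t) /\ fiber B' t !=set0) /\
    monotone_coord B' b' i].
Proof.
move=> b0 dB hB.
have minB t : exists r, 0 < t -> t < b ->
    (exists2 y, fiber B t y & y 0 i = r) /\ forall y, fiber B t y -> r <= y 0 i.
  have [t0|t0] := ltP 0 t; last by exists 0.
  have [tb|tb] := ltP t b; last by exists 0.
  have [cB nB] := hB t t0 tb.
  have [y /set_mem By ymin] := compact_EVT_min nB cB
    (continuous_subspaceT (@coord_continuous _ 1 N 0 i)).
  exists (y 0 i) => _ _; split; first by exists y.
  by move=> z Bz; apply: ymin; exact: mem_set.
have [f hf] := choice minB.
pose B' := [set z : 'rV[R]_(1 + N) | B z /\ forall y : E,
  B (row_mx (const_mx (z 0 (lshift N 0))) y) -> rsubmx z 0 i <= y 0 i].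
have dB' : Def B' by rewrite /B'; definable omin.
have B'E t y : 0 < t -> t < b -> fiber B' t y <-> fiber B t y /\ y 0 i = f t.
  move=> t0 tb; have [[y0 By0 y0f] fmin] := hf t t0 tb.
  rewrite /fiber /B' /=; rewrite row_mxEl mxE row_mxKr.
  split=> [[By h]|[By yf]]; split => //.
    by apply/eqP; rewrite eq_le fmin// andbT -y0f; exact: h.
  by move=> z Bz; rewrite yf; exact: fmin.
have dgraph : Def [set x : 'rV[R]_2 | [/\ 0 < x 0 0, x 0 0 < b & x 0 1 = f (x 0 0)]].
  have : Def [set x : 'rV[R]_2 | 0 < x 0 0 /\ x 0 0 < b /\ exists y : E,
      B' (row_mx (const_mx (x 0 0)) y) /\ x 0 1 = y 0 i] by definable omin.
  apply: def_eq => x; split=> [[x0 [xb [y [/(B'E _ _ x0 xb)[_ yf] ->]]]]|[x0 xb xf]] //.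
  do 2 split => //; have [[y By yf] _] := hf _ x0 xb.
  by exists y; split; [apply/(B'E _ _ x0 xb)|rewrite yf].
have [b' [b'0 b'b mono]] := monotone_germ omin b0 dgraph.
exists B', b'; split => //; first by move=> z [].
split=> [t t0 tb'|].
  have tb := lt_le_trans tb' b'b.
  have [cB _] := hB t t0 tb; have [[y By yf] _] := hf t t0 tb.
  split; last by exists y; apply/(B'E _ _ t0 tb).
  have -> : fiber B' t = fiber B t `&` [set y | y 0 i = f t].
    by apply/seteqP; split => z; rewrite (B'E _ _ t0 tb).
  apply: compact_closedI cB _.
  have : closed ((fun z : E => z 0 i) @^-1` [set f t]).
    by apply: preimage_closed; [move=> z _; exact: coord_continuous|exact: closed_eq].
  by [].
case: mono => mono; [left|right] => t s y z t0 ts sb'.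
  have sb := lt_le_trans sb' b'b; have tb := le_lt_trans ts sb.
  move=> /(B'E _ _ t0 tb)[_ ->] /(B'E _ _ (lt_le_trans t0 ts) sb)[_ ->]; exact: mono.
have sb := lt_le_trans sb' b'b; have tb := le_lt_trans ts sb.
move=> /(B'E _ _ t0 tb)[_ ->] /(B'E _ _ (lt_le_trans t0 ts) sb)[_ ->]; exact: mono.
Qed.

(** Cutting down one coordinate after the other; monotonicity of a coordinate
survives further cuts because it is a condition on all points of the fibers. *)
Lemma monotone_selection (B : set 'rV[R]_(1 + N)) (b : R) : 0 < b -> Def B ->
  (forall t : R, 0 < t -> t < b -> compact (fiber B t) /\ fiber B t !=set0) ->
  exists b' (y : R -> E), [/\ 0 < b', b' <= b,
    forall t, 0 < t -> t < b' -> fiber B t (y t) &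
    forall i, (forall t s, 0 < t -> t <= s -> s < b' -> y t 0 i <= y s 0 i) \/
              (forall t s, 0 < t -> t <= s -> s < b' -> y s 0 i <= y t 0 i)].
Proof.
move=> b0 dB hB.
have : forall s : seq 'I_N, exists B' b', [/\ 0 < b', b' <= b, Def B', B' `<=` B &
    (forall t : R, 0 < t -> t < b' -> compact (fiber B' t) /\ fiber B' t !=set0) /\
    forall i, i \in s -> monotone_coord B' b' i].
  elim=> [|i s [B1 [b1 [b10 b1b dB1 B1B [hB1 m1]]]]]; first by exists B, b; split.
  have [B2 [b2 [b20 b21 dB2 B21 [hB2 m2]]]] := select_coord i b10 dB1 hB1.
  exists B2, b2; split => //; first exact: le_trans b21 b1b.
    exact: subset_trans B21 B1B.
  split => // j; rewrite inE => /orP[/eqP -> //|/m1 mj].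
  case: mj => mj; [left|right] => t t' y z t0 tt' t'b /B21 By /B21 Bz;
    by apply: (mj t t') => //; exact: lt_le_trans b21.
move=> /(_ (enum 'I_N))[B' [b' [b'0 b'b dB' B'B [hB' m]]]].
have sel t : exists y, 0 < t -> t < b' -> fiber B' t y.
  have [[t0 tb]|n] := pselect (0 < t /\ t < b').
    by have [_ [y By]] := hB' t t0 tb; exists y.
  by exists 0 => t0 tb; case: n.
have [y hy] := choice sel.
exists b', y; split => //; first by move=> t t0 tb; exact/B'B/hy.
move=> i; have [|mi|mi] := m i; first by rewrite mem_enum.
  left=> t s t0 ts sb; apply: (mi t s) => //; apply: hy => //.
    exact: le_lt_trans sb.
  exact: lt_le_trans ts.
right=> t s t0 ts sb; apply: (mi t s) => //; apply: hy => //.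
  exact: le_lt_trans sb.
exact: lt_le_trans ts.
Qed.

End selection.

(** * A slope inequality for the distance *)

Section kurdyka_lojasiewicz.
Variables (R : realType) (Def : forall n, set (set 'rV[R]_n)).
Hypothesis omin : o_minimal_structure Def.
Variable N : nat.
Local Notation E := 'rV[R]_N.
Variable K : set E.
Hypotheses (dK : Def K) (cK : compact K) (K0 : K !=set0).
Implicit Types (x y w : E) (t c m : R).

(** First-order forms of [edist K y = t] and of the failure of [slope_gt K y c], in
which the distance to [K] does not occur. *)
Definition level t y := exists x, K x /\ dot (x - y) (x - y) = t * t /\
  forall x', K x' -> t * t <= dot (x' - y) (x' - y).

Definition bad t c y := level t y /\ forall w, dot w w <= 1 ->
  exists x, K x /\ dot (x - y) (x - y) = t * t /\ dot w (y - x) <= c.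

Definition least_bad t m := 0 <= m /\ (exists y, bad t m y) /\
  forall c, 0 <= c -> c < m -> ~ exists y, bad t c y.

Lemma levelE t y : 0 <= t -> level t y <-> edist K y = t.
Proof.
move=> t0; split=> [[x [Kx [xt xmin]]]|yt].
  have Ext : enorm (x - y) = t by rewrite enormE xt -expr2 sqrtr_sqr ger0_norm.
  apply/eqP; rewrite eq_le -{1}Ext edist_le//=.
  have [x' Kx' <-] := edist_attained cK K0 y.
  by rewrite -Ext ler_enorm xt xmin.
have [x Kx xy] := edist_attained cK K0 y.
exists x; split => //; rewrite -sqr_enorm xy yt expr2; split => // x' Kx'.
by rewrite -sqr_enorm -expr2 ler_sqr ?nnegrE ?enorm_ge0// -yt edist_le.
Qed.

Lemma badE t c y : 0 <= t -> bad t c y <-> edist K y = t /\ ~ slope_gt K y c.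
Proof.
move=> t0.
have nE x : edist K y = t -> (dot (x - y) (x - y) = t * t) <-> enorm (x - y) = edist K y.
  move=> ->; rewrite -sqr_enorm -expr2; split=> [/eqP|->//].
  by rewrite eqrXn2 ?enorm_ge0// => /eqP.
split=> [[/(levelE _ t0) yt h]|[yt h]].
  split => // -[w [w1 hw]]; have [x [Kx [xt wx]]] := h w w1.
  have := hw x (conj Kx (iffLR (nE x yt) xt)).
  by rewrite ltNge wx.
split; first exact/levelE.
move=> w w1; apply: contrapT => nx; apply: h; exists w; split => // x [Kx xy].
rewrite ltNge; apply/negP => wx; apply: nx; exists x; split => //.
by split => //; apply/nE.
Qed.

Lemma slope_gt_dist y : ~ slope_gt K y (edist K y).
Proof.
move=> [w [w1 hw]]; have [x Kx xy] := edist_attained cK K0 y.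
have := hw x (conj Kx xy); rewrite ltNge -xy => /negP; apply.
apply: le_trans (dot_le_enorm _ _) _; rewrite enormB ler_piMl ?enorm_ge0//.
by rewrite enorm_le// expr1n.
Qed.

(** The infimum of the bad rates at a level is attained because slopes above it
would be uniformly above it, the level being compact. *)
Lemma least_bad_exists t : 0 <= t -> (exists y, edist K y = t) ->
  exists2 m, least_bad t m & m <= t.
Proof.
move=> t0 [y yt].
pose S := [set c : R | 0 <= c /\ exists y, bad t c y].
have St : S t by split => //; exists y; apply/badE => //; split => //; rewrite -yt; exact: slope_gt_dist.
have infS : has_inf S by split; [exists t|exists 0 => c []].
have m0 : 0 <= inf S by apply: lb_le_inf => [|c []]; first by exists t.
exists (inf S); last by apply: ge_inf => //; have [] := infS.
split => //; split; last first.
  move=> c c0 cm [z zb]; have : inf S <= c by apply: ge_inf; [have [] := infS|split => //; exists z].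
  by rewrite leNgt cm.
apply: contrapT => nb.
have [|e e0 he] := uniform_slope cK K0 (C := [set z | t <= edist K z <= t]) (c := inf S)
    (compact_edist_band cK K0 (a := t) (b := t)).
  move=> z /= ; rewrite -eq_le => /eqP/esym zt; apply: contrapT => nz; apply: nb; exists z.
  by apply/badE.
have [c [c0 [z /(badE _ _ t0)[zt nz]]] cm] := inf_adherent e0 infS.
apply: nz; apply: (slope_gtW (ltW cm)); apply: he.
by rewrite /= zt lexx.
Qed.

Lemma least_bad_unique t m m' : least_bad t m -> least_bad t m' -> m = m'.
Proof.
move=> [m0 [b h]] [m'0 [b' h']]; have [l|l|//] := ltgtP m m'.
  by case: (h' m m0 l).
by case: (h m' m'0 l).
Qed.

(** Moving from a worst point of level [t] to a point of level [s], seen from a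
nearest point of the former against which the displacement makes progress at
most [m]. *)
Lemma worst_displacement t s m y z : 0 <= t -> t < s -> bad t m y ->
  edist K z = s ->
  2 * t * (s - t) <= enorm (z - y) * (2 * m + enorm (z - y)).
Proof.
move=> t0 ts /[dup] /(badE _ _ t0)[yt _] [_ h] zs.
have d0 : 0 < enorm (z - y).
  rewrite lt_def enorm_ge0 andbT; apply/eqP => /enorm_eq0/eqP.
  by rewrite subr_eq0 => /eqP zy; move: ts; rewrite -zs zy yt ltxx.
have [|x [Kx [xt wx]]] := h ((enorm (z - y))^-1 *: (z - y)).
  by rewrite -(expr1n R 2) -enorm_le// enormZ gtr0_norm ?invr_gt0// mulVf ?gt_eqF.
have {}wx : dot (z - y) (y - x) <= enorm (z - y) * m.
  by move: wx; rewrite dotZl mulrC ler_pdivrMr// mulrC.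
have : s ^+ 2 <= dot (x - z) (x - z).
  by rewrite -sqr_enorm ler_sqr ?nnegrE ?enorm_ge0 -?zs ?edist_ge0 ?edist_le.
have -> : x - z = (x - y) - (z - y) by apply/rowP => i; rewrite !mxE; ring.
have dotB (p q : E) : dot (p - q) (p - q) = dot p p - 2 * dot q p + dot q q.
  by rewrite !dotE (dotC p q); ring.
rewrite dotB xt.
have -> : dot (z - y) (x - y) = - dot (z - y) (y - x) by rewrite -dotNr opprB.
rewrite -(sqr_enorm (z - y)); move: wx => /=.
set d := dot _ _; set e := enorm _; rewrite expr2 (expr2 e).
have : 0 <= (s - t) * (s - t) by rewrite -expr2 sqr_ge0.
by lra.
Qed.

(** When the displacement is shorter than [c (s - t)], both summands on the right
of [worst_displacement] are too small. *)
Lemma worst_displacement_ge t s m c y z : 0 < t -> t < s -> bad t m y ->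
  edist K z = s -> 0 < c -> c * m <= t / 2 -> c ^+ 2 * (s - t) < t ->
  c * (s - t) <= enorm (z - y).
Proof.
move=> t0 ts bt zs c0 cm ch.
have := worst_displacement (ltW t0) ts bt zs; set d := enorm _ => hd.
rewrite leNgt; apply/negP => dc.
have d0 : 0 <= d by exact: enorm_ge0.
have h0 : 0 < s - t by rewrite subr_gt0.
set h := s - t in dc h0 ch hd *; clearbody h d.
have m1 : c * m * h <= t / 2 * h by rewrite ler_pM2r.
have m2 : c ^+ 2 * h * h < t * h by rewrite ltr_pM2r.
have m3 : d * d <= c * h * (c * h) by apply: ler_pM => //; exact: ltW.
have [m0|m0] := leP 0 m.
  have m4 : d * m <= c * h * m by apply: ler_wpM2r => //; exact: ltW.
  nra.
have m5 : d * m <= 0 by rewrite mulr_ge0_le0// ltW.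
nra.
Qed.

Section worst_curve.
Variables (b : R) (y : R -> E) (M : R -> R).
Hypothesis badM : forall t, 0 < t -> t < b -> bad t (M t) (y t).
Hypothesis M0 : forall t, 0 < t -> t < b -> 0 <= M t.
Hypothesis ndM : forall t s, 0 < t -> t <= s -> s < b -> M t <= M s.
Hypothesis mono : forall i,
  (forall t s, 0 < t -> t <= s -> s < b -> y t 0 i <= y s 0 i) \/
  (forall t s, 0 < t -> t <= s -> s < b -> y s 0 i <= y t 0 i).

(** The curve of worst points has finite length: its coordinates are monotone and
bounded, so that their sum with suitable signs increases at least as fast as the
points move. *)
Lemma curve_length : exists (u : R -> R) (B : R),
  (forall t, 0 < t -> t < b -> `|u t| <= B) /\
  (forall t s, 0 < t -> t <= s -> s < b -> enorm (y s - y t) <= u s - u t).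
Proof.
have sgn i : exists e : R, `|e| = 1 /\ forall t s, 0 < t -> t <= s -> s < b ->
    `|y s 0 i - y t 0 i| = e * y s 0 i - e * y t 0 i.
  have [m|m] := mono i; [exists 1|exists (-1)]; split; rewrite ?normrN ?normr1// => t s t0 ts sb;
    have := m t s t0 ts sb => h.
    by rewrite !mul1r ger0_norm// subr_ge0.
  by rewrite !mulN1r ler0_norm ?subr_le0// opprB opprK addrC.
have [e he] := choice sgn.
pose u t := \sum_i e i * y t 0 i.
have [Bd hBd] : exists Bd : R, forall t, 0 < t -> t < b -> enorm (y t) <= Bd.
  have cband := compact_edist_band cK K0 (a := 0) (b := b).
  have [|B [_ hB]] := @compact_bounded _ _ ((fun y : E => enorm y) @` [set z | 0 <= edist K z <= b]).
    by apply: continuous_compact cband; apply: continuous_subspaceT; vcont.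
  exists (B + 1) => t t0 tb.
  have := hB (B + 1); rewrite ltrDl ltr01 => /(_ isT (enorm (y t))) /=.
  rewrite ger0_norm ?enorm_ge0//; apply; exists (y t) => //.
  by have /(badE _ _ (ltW t0))[-> _] := badM t0 tb; rewrite !ltW.
exists u, (\sum_(i < N) Bd); split=> [t t0 tb|t s t0 ts sb].
  apply: le_trans (ler_norm_sum _ _ _) _; apply: ler_sum => i _.
  rewrite normrM; have [-> _] := he i; rewrite mul1r.
  exact: le_trans (coord_le_enorm _ _) (hBd t t0 tb).
rewrite /u -sumrB.
have -> : \sum_i (e i * y s 0 i - e i * y t 0 i) = \sum_i `|(y s - y t) 0 i|.
  by apply: eq_bigr => i _; rewrite !mxE; have [_ <-] := he i.
rewrite enorm_le; last exact: sumr_ge0.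
move: (y s - y t) => v; rewrite expr2 mulr_suml; apply: ler_sum => i _.
have -> : v 0 i * v 0 i = `|v 0 i| * `|v 0 i|.
  by rewrite -normrM ger0_norm// -expr2 sqr_ge0.
apply: ler_wpM2l => //.
by rewrite (bigD1 i)//= lerDl; exact: sumr_ge0.
Qed.

(** Consecutive points of a subdivision of [[a, 2 a]] are at distance at least [c]
times the difference of their levels, once the subdivision is so fine that the
quadratic term of [worst_displacement_ge] is negligible. *)
Lemma curve_length_growth (u : R -> R) :
  (forall t s, 0 < t -> t <= s -> s < b -> enorm (y s - y t) <= u s - u t) ->
  forall a c, 0 < a -> 2 * a < b -> 0 < c -> c * M (2 * a) <= a / 2 ->
  c * a <= u (2 * a) - u a.
Proof.
move=> hu a c a0 ab c0 cM.
pose n := (Num.truncn (c ^+ 2)).+1.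
have n0 : 0 < n%:R :> R by rewrite ltr0n.
have nc : c ^+ 2 < n%:R.
  by have /andP[] := truncn_itv (sqr_ge0 c).
pose p k : R := a + k%:R * (a / n%:R).
have h0 : 0 < a / n%:R by rewrite divr_gt0.
have pS k : p k.+1 - p k = a / n%:R.
  by rewrite /p -natr1 mulrDl mul1r; ring.
have pa k : a <= p k by rewrite lerDl mulr_ge0// ltW.
have p2a k : (k <= n)%N -> p k <= 2 * a.
  move=> kn; rewrite /p (_ : 2 * a = a + a); last by ring.
  rewrite lerD2l mulrA ler_pdivrMr// mulrC ler_pM2l// ler_nat//.
have step k : (k < n)%N -> c * (a / n%:R) <= u (p k.+1) - u (p k).
  move=> kn; have pk0 : 0 < p k := lt_le_trans a0 (pa k).
  have pk1 : p k < p k.+1 by rewrite -subr_gt0 pS.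
  have pkb : p k.+1 < b := le_lt_trans (p2a k.+1 kn) ab.
  apply: le_trans (hu _ _ pk0 (ltW pk1) pkb); rewrite -(pS k).
  have pkb' := lt_trans pk1 pkb.
  apply: (worst_displacement_ge (t := p k) (m := M (p k))) => //.
  - exact: badM.
  - have pk10 := lt_trans pk0 pk1.
    by have /(badE _ _ (ltW pk10))[] := badM pk10 pkb.
  - have MM : M (p k) <= M (2 * a) by apply: ndM => //; apply: p2a; exact: ltnW.
    have : c * M (p k) <= c * M (2 * a) by rewrite ler_pM2l.
    by have := pa k; lra.
  - rewrite pS; apply: lt_le_trans (pa k).
    by rewrite mulrA ltr_pdivrMr// mulrC ltr_pM2l.
have all k : (k <= n)%N -> k%:R * (c * (a / n%:R)) <= u (p k) - u a.
  elim: k => [|k IH] kn; first by rewrite mul0r /p mul0r addr0 subrr.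
  rewrite -natr1 mulrDl mul1r.
  by have := IH (ltnW kn); have := step k kn; lra.
have := all n (leqnn n).
have -> : p n = 2 * a by rewrite /p mulrCA divff ?gt_eqF// mulr1; ring.
by rewrite mulrCA [n%:R * _]mulrCA divff ?gt_eqF// mulr1.
Qed.

(** The growth of [u] over [[a, 2 a]] is at least [c a] for every [c] up to
[a / (2 M (2 a))]: were [M (2 a)] zero, then [c] could be arbitrarily large although
[u] is bounded; and the largest such [c] bounds the terms of the sum by increments of
[u], which telescope. *)
Lemma curve_conclusion :
  (forall t, 0 < t -> t < b -> 0 < M t) /\
  exists B, forall a, 0 < a -> 2 * a < b -> forall n,
    \sum_(k < n) (a / 2 ^+ k) ^+ 2 / M (2 * (a / 2 ^+ k)) <= B.
Proof.
have [u [B [uB hu]]] := curve_length.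
have growth := curve_length_growth hu.
have Mpos t : 0 < t -> t < b -> 0 < M t.
  move=> t0 tb; rewrite lt_def M0// andbT; apply/eqP => Mt.
  pose a := t / 2; have a0 : 0 < a by rewrite divr_gt0.
  have ta : 2 * a = t by rewrite /a; lra.
  have tb2 : 2 * a < b by rewrite ta.
  have B0 : 0 <= B := le_trans (normr_ge0 _) (uB t t0 tb).
  have C0 : 0 < (2 * B + 1) / a by rewrite divr_gt0//; lra.
  have C1 : (2 * B + 1) / a * M (2 * a) <= a / 2.
    by rewrite ta Mt mulr0 divr_ge0// ltW.
  have := growth a _ a0 tb2 C0 C1; rewrite ta divfK ?gt_eqF//.
  have at_ : a < b by rewrite /a; lra.
  have := uB t t0 tb; have := uB a a0 at_.
  by rewrite !ler_norml => /andP[? ?] /andP[? ?]; lra.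
split => //; exists (2 * (2 * B)) => a a0 ab n.
pose q k := a / 2 ^+ k.
have q0 k : 0 < q k by rewrite divr_gt0// exprn_gt0.
have qS k : 2 * q k.+1 = q k.
  have -> : q k.+1 = q k / 2 by rewrite /q exprS invfM mulrCA mulrC.
  by lra.
have qb k : 2 * q k < b.
  elim: k => [|k IH]; first by rewrite /q expr0 divr1.
  by rewrite qS; have := q0 k; lra.
have term k : q k ^+ 2 / M (2 * q k) <= 2 * (u (2 * q k) - u (q k)).
  have Mk : 0 < M (2 * q k) by apply: Mpos => //; rewrite mulr_gt0.
  have := growth (q k) (q k / (2 * M (2 * q k))) (q0 k) (qb k).
  rewrite divr_gt0 ?mulr_gt0// => /(_ isT).
  have -> : q k / (2 * M (2 * q k)) * M (2 * q k) = q k / 2.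
    by field; rewrite gt_eqF.
  rewrite lexx => /(_ isT).
  have -> : q k / (2 * M (2 * q k)) * q k = q k ^+ 2 / M (2 * q k) / 2.
    by field; rewrite gt_eqF.
  by lra.
have tele : \sum_(k < n) q k ^+ 2 / M (2 * q k) <= 2 * (u (2 * q 0%N) - u (2 * q n)).
  elim: n => [|n IH]; first by rewrite big_ord0 subrr mulr0.
  by rewrite big_ord_recr /=; have := term n; rewrite qS; move: IH; lra.
apply: le_trans tele _.
have p1 : 0 < 2 * q 0%N by rewrite mulr_gt0.
have p2 : 0 < 2 * q n by rewrite mulr_gt0.
have := uB _ p1 (qb 0%N); have := uB _ p2 (qb n).
by rewrite !ler_norml => /andP[? ?] /andP[? ?]; lra.
Qed.

End worst_curve.

(** A Kurdyka-Lojasiewicz inequality for the distance to [K]: [M t] bounds the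
slopes at the level [t] from below, well enough for the lengths of the descents
through the levels [a / 2 ^ k] to be summable. *)
Theorem distance_slope_bound : exists (b : R) (M : R -> R),
  [/\ 0 < b, forall t s, 0 < t -> t <= s -> s < b -> M t <= M s,
      forall t, 0 < t -> t < b -> 0 < M t <= t,
      forall y c, 0 < edist K y -> edist K y < b -> c < M (edist K y) -> slope_gt K y c &
      exists B, forall a, 0 < a -> 2 * a < b -> forall n,
        \sum_(k < n) (a / 2 ^+ k) ^+ 2 / M (2 * (a / 2 ^+ k)) <= B].
Proof.
have dT : definable_in_line Def (fun t => exists y, level t y).
  by rewrite /definable_in_line /level; definable omin.
have [b1 b10 [hT|hT]] := definable_germ_right omin 0 dT; last first.
  (* There are no points at small positive distance from [K]. *)
  exists b1, id; split => //.
  - by move=> t t0 _; rewrite t0 lexx.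
  - move=> y c y0 yb; case: (hT (edist K y)); first by rewrite y0 add0r.
    by exists y; apply/levelE => //; exact: ltW.
  exists b1 => a a0 ab n.
  have t1 k : (a / 2 ^+ k) ^+ 2 / (2 * (a / 2 ^+ k)) = a / 2 ^+ k - a / 2 ^+ k.+1.
    have -> : a / 2 ^+ k.+1 = a / 2 ^+ k / 2 by rewrite exprS invfM mulrCA mulrC.
    have q0 : a / 2 ^+ k != 0 by rewrite mulf_neq0 ?gt_eqF// invr_gt0 exprn_gt0.
    by move: (a / 2 ^+ k) q0 => q q0; field.
  have -> : \sum_(k < n) (a / 2 ^+ k) ^+ 2 / (2 * (a / 2 ^+ k)) = a - a / 2 ^+ n.
    elim: n => [|n IH]; first by rewrite big_ord0 expr0 divr1 subrr.
    by rewrite big_ord_recr /= IH t1 addrA subrK.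
  have : 0 < a / 2 ^+ n by rewrite divr_gt0// exprn_gt0.
  by lra.
have exM t : exists m, 0 < t -> t < b1 -> least_bad t m /\ m <= t.
  have [[t0 tb]|n] := pselect (0 < t /\ t < b1); last by exists 0 => t0 tb; case: n.
  have [|y /(levelE _ (ltW t0)) yt] := hT t; first by rewrite t0 add0r.
  have [|m lm mt] := least_bad_exists (ltW t0); first by exists y.
  by exists m.
have [M hM] := choice exM.
have dgraph : Def [set x : 'rV[R]_2 | [/\ 0 < x 0 0, x 0 0 < b1 & x 0 1 = M (x 0 0)]].
  have : Def [set x : 'rV[R]_2 | 0 < x 0 0 /\ x 0 0 < b1 /\ least_bad (x 0 0) (x 0 1)].
    by rewrite /least_bad /bad /level; definable omin.
  apply: def_eq => x; split=> [[x0 [xb lb]]|[x0 xb ->]]; last first.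
    by split => //; split => //; have [] := hM _ x0 xb.
  by split => //; apply: least_bad_unique lb _; have [] := hM _ x0 xb.
have [b2 [b20 b21 mM]] := monotone_germ omin b10 dgraph.
have M0 t : 0 < t -> t < b2 -> 0 <= M t.
  by move=> t0 tb; have [[]] := hM t t0 (lt_le_trans tb b21).
have Mt t : 0 < t -> t < b2 -> M t <= t.
  by move=> t0 tb; have [] := hM t t0 (lt_le_trans tb b21).
have ndM t s : 0 < t -> t <= s -> s < b2 -> M t <= M s.
  case: mM => mM; first exact: mM.
  move=> t0 ts sb; have s0 := lt_le_trans t0 ts.
  apply: (@le_trans _ _ 0); last exact: M0.
  apply/ler_addgt0Pr => e e0; rewrite add0r.
  pose r := Num.min e t; have r0 : 0 < r by rewrite lt_min e0.
  have rt : r <= t by rewrite ge_min lexx orbT.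
  have tb := le_lt_trans ts sb.
  apply: le_trans (mM r t r0 rt tb) _.
  apply: le_trans (Mt r r0 (le_lt_trans rt tb)) _.
  by rewrite ge_min lexx.
pose Bs : set 'rV[R]_(1 + N) := [set z : 'rV[R]_(1 + N) |
  exists m, least_bad (z 0 (lshift N 0)) m /\ bad (z 0 (lshift N 0)) m (rsubmx z)].
have dB : Def Bs by rewrite /Bs /least_bad /bad /level; definable omin.
have fibE t y : 0 < t -> t < b2 -> fiber Bs t y <-> bad t (M t) y.
  move=> t0 tb; have [lM _] := hM t t0 (lt_le_trans tb b21).
  rewrite /fiber /Bs /= row_mxEl mxE row_mxKr; split=> [[m [lm]]|]; last by exists (M t).
  by rewrite (least_bad_unique lm lM).
have [|b3 [y [b30 b32 By mono]]] := monotone_selection omin b20 dB.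
  move=> t t0 tb; have [[_ [[y0 hy0] _]] _] := hM t t0 (lt_le_trans tb b21).
  split; last by exists y0; apply/fibE.
  have -> : fiber Bs t = [set z | t <= edist K z <= t] `&` [set z | ~ slope_gt K z (M t)].
    apply/seteqP; split=> z; rewrite (fibE _ _ t0 tb) (badE _ _ (ltW t0)) /=.
      by move=> [-> ?]; rewrite lexx.
    by rewrite -eq_le => -[/eqP -> ?].
  apply: (compact_closedI (compact_edist_band cK K0 (a := t) (b := t))).
  rewrite -[X in closed X]setCK; apply: open_closedC.
  rewrite openE => z /= /contrapT[w aw].
  have [[A C] /= [nA nC] AC] := ascent_near cK K0 aw.
  apply: (filterS _ nA) => z' Az' /=; apply => //; exists w.
  by apply: (AC (z', M t)); split => //=; exact: nbhs_singleton.
have badM t : 0 < t -> t < b3 -> bad t (M t) (y t).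
  by move=> t0 tb; have := By t t0 tb; rewrite fibE// (lt_le_trans tb).
have M0' t : 0 < t -> t < b3 -> 0 <= M t by move=> t0 tb; apply: M0 => //; exact: lt_le_trans b32.
have ndM' t s : 0 < t -> t <= s -> s < b3 -> M t <= M s.
  by move=> t0 ts tb; apply: ndM => //; exact: lt_le_trans b32.
have [Mpos sumM] := curve_conclusion badM M0' ndM' mono.
exists b3, M; split => //.
- by move=> t t0 tb; rewrite Mpos//= Mt// (lt_le_trans tb).
- move=> z c z0 zb cM.
  have [c0|c0] := ltP c 0.
    have [[_ [_ h]] _] := hM _ z0 (lt_le_trans zb (le_trans b32 b21)).
    apply: (slope_gtW (ltW c0)); apply: contrapT => nz.
    by apply: (h 0 (lexx _) (Mpos _ z0 zb)); exists z; apply/badE => //; exact: ltW.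
  have [[_ [_ h]] _] := hM _ z0 (lt_le_trans zb (le_trans b32 b21)).
  apply: contrapT => nz; apply: (h c c0 cM).
  by exists z; apply/badE => //; exact: ltW.
Qed.

End kurdyka_lojasiewicz.

(** * Thickenings below the weak feature size *)

Section weak_feature.
Variables (R : realType) (N : nat).
Local Notation E := 'rV[R]_N.
Local Notation I := (@unitI R).
Local Notation i0 := (unitI_zero R).
Local Notation i1 := (unitI_one R).

Section nonempty.
Variable K : set E.
Hypotheses (cK : compact K) (K0 : K !=set0).
Implicit Types (x y w : E).

Lemma nearestE y : [set x | K x /\ (enorm (x - y))%:E = set_dist y K] = nearest K y.
Proof.
by apply/seteqP; split => x /= [Kx]; rewrite /nearest (set_distE cK K0);
  [move=> [->]|move=> ->].
Qed.

Lemma slope_gt_noncritical y : ~ K y -> ~ critical K y -> slope_gt K y 0.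
Proof.
move=> nKy ncrit.
have cG : compact (nearest K y).
  have -> : nearest K y = K `&` [set x | enorm (x - y) = edist K y] by [].
  apply: (compact_closedI cK).
  have : closed ((fun x => enorm (x - y)) @^-1` [set edist K y]).
    apply: preimage_closed; last exact: closed_eq.
    by have : continuous (fun x => enorm (x - y)) by [vcont|]; move=> h x _; exact: h.
  by [].
have [||w [w1 hw]] := separation_compact (y := y) cG.
- by have [x Kx xy] := edist_attained cK K0 y; exists x.
- by move=> h; apply: ncrit; split => //; rewrite nearestE.
by exists w.
Qed.

(** An open half-space is convex and cannot contain its boundary point [y]. *)
Lemma critical_not_slope_gt y : critical K y -> ~ slope_gt K y 0.
Proof.
move=> [nKy]; rewrite nearestE => hull [w [w1 hw]].
suff : 0 < dot w (y - y) by rewrite dotDr dotNr subrr ltxx.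
suff : [set z | 0 < dot w (y - z)] y by [].
apply: hull; split; last by move=> x /hw.
move=> p q l /set_mem /= hp /set_mem /= hq; apply/mem_set => /=.
have -> : y - conv l p q = l%:num *: (y - p) + (1 - l%:num) *: (y - q).
  by apply/rowP => i; rewrite /conv /= !mxE /unstable.onem; ring.
rewrite dotDr !dotZr.
have [l0|l0] := ltP 0 l%:num.
  by apply: ltr_pwDl; [rewrite mulr_gt0|rewrite mulr_ge0 ?subr_ge0// ltW].
have -> : l%:num = 0 by apply/eqP; rewrite eq_le l0 /=.
by rewrite mul0r add0r subr0 mul1r.
Qed.

Lemma slope_gt_below_feature y : 0 < edist K y ->
  ((edist K y)%:E < weak_feature_size K)%E -> slope_gt K y 0.
Proof.
move=> y0 yw; apply: slope_gt_noncritical => [Ky|crit].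
  by move: y0; rewrite edist_mem// ltxx.
move: yw; rewrite ltNge => /negP; apply.
by apply: ereal_inf_lbound; exists y => //; rewrite set_distE.
Qed.

Lemma above_real (b : R) (e : \bar R) : (b%:E < e)%E -> exists2 b', b < b' & (b'%:E < e)%E.
Proof.
case: e => [r| |] //; last by exists (b + 1); [lra|exact: ltry].
rewrite lte_fin => br; exists ((b + r) / 2); first by lra.
by rewrite lte_fin; lra.
Qed.

Lemma deform_thickening (a b : R) : 0 < a -> a <= b ->
  (b%:E < weak_feature_size K)%E ->
  exists G : E * I -> E,
    [/\ continuous G, forall y, G (y, i0) = y,
        forall y t, edist K (G (y, t)) <= edist K y &
        forall y, edist K y <= b -> edist K (G (y, i1)) <= a].
Proof.
move=> a0 ab /above_real[b' bb' b'w].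
apply: (descent_noncritical cK K0 a0 ab bb') => y /andP[y0 yb].
by apply: slope_gt_below_feature => //; apply: le_lt_trans b'w; rewrite lee_fin.
Qed.

Section definable.
Variable Def : forall n, set (set 'rV[R]_n).
Hypotheses (omin : o_minimal_structure Def) (dK : Def K).

Lemma weak_feature_size_gt0_nonempty : (0 < weak_feature_size K)%E.
Proof.
have [b [M [b0 _ Mpos sl _]]] := distance_slope_bound omin dK cK K0.
apply: (@lt_le_trans _ _ b%:E); first by rewrite lte_fin.
apply/ereal_infP => _ [y crit <-]; rewrite set_distE// lee_fin leNgt.
apply/negP => yb; have [nKy _] := crit.
have y0 : 0 < edist K y by exact: edist_gt0.
apply: (critical_not_slope_gt crit); apply: sl => //.
by have /andP[] := Mpos _ y0 yb.
Qed.

(** Small neighbourhoods of [K] retract onto [K], by descents of total length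
bounded through the Kurdyka-Lojasiewicz inequality. *)
Lemma collapse_small : exists2 b : R, 0 < b & exists G : E * I -> E,
    [/\ continuous G, forall y, G (y, i0) = y,
        forall y t, edist K (G (y, t)) <= edist K y &
        forall y, edist K y <= b -> edist K (G (y, i1)) <= 0].
Proof.
have [b [M [b0 ndM Mpos sl [B hB]]]] := distance_slope_bound omin dK cK K0.
pose q : R := b / 3; have q0 : 0 < q by rewrite divr_gt0.
pose a k := q / 2 ^+ k.
have a0 k : 0 < a k by rewrite divr_gt0// exprn_gt0.
have aS k : a k.+1 = a k / 2 by rewrite /a exprS invfM mulrCA mulrC.
have aq k : a k <= q.
  elim: k => [|k IH]; first by rewrite /a expr0 divr1.
  by rewrite aS; have := a0 k; lra.
have ab k : 2 * a k < b by have := aq k; rewrite /q; lra.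
have ab' k : a k < b by have := ab k; have := a0 k; lra.
have M0 k : 0 < M (a k) by have /andP[] := Mpos _ (a0 k) (ab' k).
exists q => //.
apply: (collapse_onto cK K0 (B := 128 * B + 2 * q) (c := fun k => M (a k.+2) / 2)) => //.
- by move=> k; rewrite divr_gt0.
- move=> k y /andP[y1 y2].
  have y0 : 0 < edist K y := lt_le_trans (a0 k.+2) y1.
  have yb : edist K y < b := le_lt_trans y2 (ab k).
  apply: sl => //; apply: (@lt_le_trans _ _ (M (a k.+2))); last exact: ndM.
  by have := M0 k.+2; lra.
move=> n.
(* The slope at stage [k] is at least [M (a k.+2)], and [a k.+2] is the argument of
[M] in the summability bound for [q / 8] in place of [a]. *)
have s1 k : (q / 2 ^+ k) ^+ 2 - (q / 2 ^+ k.+1) ^+ 2 <= 64 * (q / 8 / 2 ^+ k) ^+ 2.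
  have -> : q / 8 / 2 ^+ k = a k / 8 by rewrite /a mulrAC.
  have -> : 64 * (a k / 8) ^+ 2 = (a k) ^+ 2 by rewrite exprMn; field.
  by rewrite gerBl sqr_ge0.
have s2 k : 2 * (q / 8 / 2 ^+ k) = a k.+2.
  by rewrite !aS /a mulrAC; lra.
apply: (@le_trans _ _ (\sum_(k < n) (128 * ((q / 8 / 2 ^+ k) ^+ 2 / M (2 * (q / 8 / 2 ^+ k)))
    + (a k - a k.+1)))).
  apply: ler_sum => k _; rewrite s2; apply: lerD.
    have -> : 128 * ((q / 8 / 2 ^+ k) ^+ 2 / M (a k.+2)) =
        64 * (q / 8 / 2 ^+ k) ^+ 2 / (M (a k.+2) / 2).
      move: (M (a k.+2)) (M0 k.+2) ((q / 8 / 2 ^+ k) ^+ 2) => m m0 X.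
      by field; rewrite gt_eqF.
    by apply: ler_wpM2r; [rewrite invr_ge0 divr_ge0// ltW|exact: s1].
  have /andP[_] := Mpos _ (a0 k.+2) (ab' k.+2).
  by rewrite !aS; have := a0 k; lra.
rewrite big_split /= -mulr_sumr; apply: lerD.
  by rewrite ler_pM2l//; apply: hB; [rewrite divr_gt0|rewrite /q; lra].
have -> : \sum_(k < n) (a k - a k.+1) = a 0%N - a n.
  elim: (n) => [|m IH]; first by rewrite big_ord0 subrr.
  by rewrite big_ord_recr /= IH addrA subrK.
by have := aq 0%N; have := a0 n; lra.
Qed.

(** The descent away from critical points reaches any small positive level; from
there [collapse_small] reaches [K]. *)
Lemma deform_thickening0 (a b : R) : 0 <= a -> a <= b ->
  (b%:E < weak_feature_size K)%E ->
  exists G : E * I -> E,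
    [/\ continuous G, forall y, G (y, i0) = y,
        forall y t, edist K (G (y, t)) <= edist K y &
        forall y, edist K y <= b -> edist K (G (y, i1)) <= a].
Proof.
rewrite le_eqVlt => /orP[/eqP <- b0 bw|a0]; last exact: deform_thickening.
have [q q0 [G [cG G0 Gle G1]]] := collapse_small.
have [b00|bpos] := leP b 0.
  exists fst; split => //; first by cont.
  by move=> y yb; exact: le_trans yb b00.
have m0 : 0 < Num.min q b by rewrite lt_min q0.
have mb : Num.min q b <= b by rewrite ge_min lexx orbT.
have [D [cD D0 Dle D1]] := deform_thickening m0 mb bw.
exists (fun p => G (D p, p.2)); split.
- by apply: continuous_fun_comp cG; apply: continuous_pair => //; cont.
- by move=> y; rewrite /= D0 G0.
- by move=> y t; apply: le_trans (Gle _ _) (Dle _ _).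
- move=> y yb; apply: G1; apply: le_trans (D1 y yb) _.
  by rewrite ge_min lexx.
Qed.

End definable.
End nonempty.

Section main.
Variable Def : forall n, set (set 'rV[R]_n).
Hypothesis omin : o_minimal_structure Def.
Variable K : set E.
Hypotheses (cK : compact K) (dK : Def K).

Lemma weak_feature_size_gt0 : (0 < weak_feature_size K)%E.
Proof.
have [->|/set0P K0] := eqVneq K set0; last exact: weak_feature_size_gt0_nonempty dK.
suff -> : weak_feature_size (set0 : set E) = +oo%E by exact: ltry.
apply/eqP; rewrite -leye_eq; apply/ereal_infP => z [y [nKy h] zE].
have : (set0 : set E) y.
  apply: h; split; last by move=> x [].
  by move=> x x' l /set_mem.
by [].
Qed.

Lemma thickening_incl_weak_equivalence (a b : R) (ab : a <= b) : 0 <= a ->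
  (b%:E < weak_feature_size K)%E ->
  weak_homotopy_equivalence R (set_incl (@thickening_leS R N K a b ab)).
Proof.
move=> a0 bw.
have [H [cH H0 Hle H1]] : exists H : E * I -> E,
    [/\ continuous H, forall y, H (y, i0) = y,
        forall y t c, thickening K c y -> thickening K c (H (y, t)) &
        forall y, thickening K b y -> thickening K a (H (y, i1))].
  have [K00|/set0P K0] := eqVneq K set0.
    exists fst; split => //; first by cont.
    by move=> y [x Kx _]; exfalso; move: Kx; rewrite K00.
  have [H [cH H0 Hle H1]] := deform_thickening0 cK K0 omin dK a0 ab bw.
  exists H; split => //.
    by move=> y t c /(thickeningE cK K0) h; apply/(thickeningE cK K0); exact: le_trans (Hle y t) h.
  by move=> y /(thickeningE cK K0) h; apply/(thickeningE cK K0); exact: H1.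
apply: (@weak_equivalence_incl R _ _ _ _ (fun p : thickening K b * I => H (val p.1, p.2))).
- by apply: continuous_fun_comp cH; cont.
- by move=> y t; apply: Hle; exact: set_mkP.
- by move=> y; rewrite H0.
- by move=> y; apply: H1; exact: set_mkP.
- by move=> y t /Hle; apply.
Qed.

End main.
End weak_feature.

(** * The cone deformation of a teardrop *)

Section finite_intersections.
Import finmap.

Lemma open_finite_bigcap (T : topologicalType) (I : choiceType) (F : {fset I})
    (g : I -> set T) : (forall i, i \in F -> open (g i)) ->
  open (\bigcap_(i in [set` F]) g i).
Proof.
move=> og; rewrite bigcap_fset big_seq.
by elim/big_ind: _ => //; [exact: openT|exact: openI].
Qed.

End finite_intersections.

Lemma open_in_open (T : topologicalType) (U W : set T) : open U -> W `<=` U ->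
  open ((fun u : U => val u) @^-1` W) -> open W.
Proof.
move=> oU WU [V oV VE].
have -> : W = V `&` U; last exact: openI.
apply/seteqP; split=> [x Wx|x [Vx Ux]].
  split; last exact: WU.
  have : ((fun u : U => val u) @^-1` W) (set_mk (WU x Wx)) by [].
  by rewrite -VE.
have : (set_val @^-1` V) (set_mk Ux) by [].
by rewrite VE.
Qed.

Lemma compact_set_type (T : topologicalType) (A : set T) :
  compact A -> compact [set: A].
Proof.
move=> /compact_near_coveringP cA; apply/compact_near_coveringP => J F P FF h.
have : \near F, A `<=` (fun x => forall Ax : A x, P F (set_mk Ax)).
  apply: (cA J F (fun i x => forall Ax : A x, P i (set_mk Ax))) => x Ax.
  have [[U V] /= [nU nV] UV] := h (set_mk Ax) I.
  have [W [[W' oW' W'E] Wx WU]] : exists W : set A, [/\ open W, W (set_mk Ax) & W `<=` U].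
    by move: nU; rewrite nbhsE => -[W [oW Wx] WU]; exists W.
  exists (W', V); first split => //=.
    apply: open_nbhs_nbhs; split => //.
    have : W (set_mk Ax) by []. by rewrite -W'E.
  move=> [x' i] /= [W'x' Vi] Ax'; apply: (UV (set_mk Ax', i)); split => //=.
  by apply: WU; rewrite -W'E.
apply: filterS => i hi x _.
have := hi (val x) (set_mkP x) (set_mkP x).
by congr (P i _); apply: val_inj.
Qed.

Lemma compact_unitI (R : realType) : compact [set: @unitI R].
Proof.
apply: compact_set_type.
have -> : @unitI R = [set` `[0, 1]%R]; last exact: segment_compact.
by apply/seteqP; split => x /=; rewrite in_itv.
Qed.

Section teardrop_topology.
Variables (R : realType) (L T : topologicalType) (r : L -> T).
Local Notation TD := (teardrop R r).
Local Notation I := (@unitI R).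
Local Notation i0 := (unitI_zero R).
Local Notation i1 := (unitI_one R).
Local Notation H := (@half_open_unit R).

Lemma teardrop_open_subbase (U : set TD) : teardrop_subbase U -> open U.
Proof.
move=> sU; exists [set U]; last by rewrite bigcup_set1.
by move=> _ ->; exact: (finI_from1 id).
Qed.

Lemma continuous_to_teardrop (Z : topologicalType) (f : Z -> TD) :
  (forall U, teardrop_subbase U -> open (f @^-1` U)) -> continuous f.
Proof.
move=> hf; apply/continuousP => _ [D DF <-].
rewrite preimage_bigcup; apply: bigcup_open => A /DF[F FD <-].
rewrite preimage_bigcap; apply: open_finite_bigcap => U /FD /set_mem; exact: hf.
Qed.

Lemma continuous_teardrop_proj : continuous (@teardrop_proj R L T r).
Proof.
apply/continuousP => V oV; apply: teardrop_open_subbase; right.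
by exists V.
Qed.

Definition teardrop_height (z : TD) : R := val (teardrop_proj z).2.

Lemma continuous_teardrop_height : continuous teardrop_height.
Proof.
by have c := continuous_teardrop_proj; rewrite /teardrop_height; cont.
Qed.

Lemma cone_subproof (t : H) (b : I) : 0 < (val b : R) -> H (val b * val t).
Proof.
move=> b0; have /andP[t0 t1] := set_mkP t; have /andP[_ b1] := unitIP b.
by rewrite /half_open_unit /= mulr_gt0//= mulr_ile1// ltW.
Qed.

(** The deformation of the mapping cylinder along its rays; at time 0 it is the
projection to the base. *)
Definition cone (p : TD * I) : TD :=
  match p.1 with
  | inl (l, t) => if pselect (0 < (val p.2 : R)) is left b0
                  then inl (l, set_mk (cone_subproof t b0)) else inr (r l)
  | inr y => inr y
  end.

Lemma cone1 z : cone (z, i1) = z.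
Proof.
case: z => [[l t]|y] //; rewrite /cone /=; case: pselect => [b0|]; last by case; exact: ltr01.
by congr (inl (l, _)); apply: val_inj; rewrite /= mul1r.
Qed.

Lemma cone0 z : exists y, cone (z, i0) = inr y.
Proof.
case: z => [[l t]|y]; last by exists y.
by exists (r l); rewrite /cone /=; case: pselect => // b0; have := b0; rewrite ltxx.
Qed.

Lemma cone_inl q b : 0 < (val b : R) -> exists q', cone (inl q, b) = inl q'.
Proof.
case: q => l t b0; rewrite /cone /=; case: pselect => // b0'.
by exists (l, set_mk (cone_subproof t b0')).
Qed.

Lemma cone_proj p : teardrop_proj (cone p) =
  ((teardrop_proj p.1).1, clamp (val p.2 * teardrop_height p.1)).
Proof.
case: p => [[[l t]|y] b]; rewrite /cone /teardrop_height /=; last first.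
  by rewrite mulr0 clamp_le0.
have /andP[b0 b1] := unitIP b; have /andP[t0 t1] := set_mkP t.
case: pselect => [b0'|nb0] /=; congr (_, _); apply: val_inj.
  by rewrite val_clamp//= mulr_ge0 ?(ltW t0)//= mulr_ile1// ltW.
suff -> : val b = 0 by rewrite mul0r clamp_le0.
by apply/eqP; rewrite eq_le b0 andbT leNgt; apply/negP.
Qed.

Hypothesis cr : continuous r.

(** For the subbasic sets pulled back from the base this is [cone_proj]; an open set
of the open cylinder has its preimage in the open set [W] where both the height and
the time are positive, and there the deformation is computed in [L * H]. *)
Lemma continuous_cone : continuous cone.
Proof.
have ch := continuous_teardrop_height; have cp := continuous_teardrop_proj.
apply: continuous_to_teardrop => U [[V oV ->]|[V oV ->]]; last first.
  have c : continuous (fun p : TD * I =>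
      ((teardrop_proj p.1).1, clamp (val p.2 * teardrop_height p.1))).
    apply: continuous_pair.
      by apply: continuous_fst; apply: continuous_fun_comp cp; cont.
    apply: continuous_clamp; apply: continuous_mul; first by cont.
    by apply: continuous_fun_comp ch; cont.
  move/continuousP: c => /(_ V oV); congr open.
  by apply/seteqP; split => p /=; rewrite cone_proj.
pose W := [set p : TD * I | 0 < teardrop_height p.1 /\ 0 < (val p.2 : R)].
have oW : open W.
  have -> : W = (fun p => teardrop_height p.1) @^-1` [set x | 0 < x] `&`
    (fun p => val p.2 : R) @^-1` [set x | 0 < x] by [].
  apply: openI; apply: open_comp; try exact: open_gt; move=> p _.
    by apply: (continuous_fun_comp (f := fst) (g := teardrop_height)) => //; cont.
  have c : continuous (fun p : TD * I => val p.2 : R) by cont.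
  exact: c.
have WU : cone @^-1` (inl @` V) `<=` W.
  move=> [[[l t]|y] b] /= [q Vq]; rewrite /cone /=; last by [].
  case: pselect => // b0 _; split => //=; rewrite /teardrop_height /=.
  by have /andP[] := set_mkP t.
apply: (open_in_open oW WU).
have unl (u : W) : {q : L * H | (val u).1 = inl q}.
  apply: cid; case: u => -[[q|y] b] /= Wu; first by exists q.
  by have /= [] := set_mem Wu; rewrite /teardrop_height /= ltxx.
pose ul (u : W) := sval (unl u).
have ulE u : (val u).1 = inl (ul u) by exact: svalP (unl u).
have cul : continuous ul.
  apply/continuousP => A oA.
  have c : continuous (fun u : W => (val u).1) by cont.
  move/continuousP: c => /(_ (inl @` A)) h.
  have : open ((fun u : W => (val u).1) @^-1` (inl @` A)).
    by apply: h; apply: teardrop_open_subbase; left; exists A.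
  congr open; apply/seteqP; split => u /=; rewrite ulE.
    by move=> [q Aq [<-]].
  by exists (ul u).
have b0 (u : W) : 0 < (val (val u).2 : R) by have [] := set_mkP u.
pose g (u : W) : L * H := ((ul u).1, set_mk (cone_subproof (ul u).2 (b0 u))).
have cg : continuous g.
  apply: continuous_pair; first by cont.
  by apply: continuous_to_set_type => /=; cont.
have gE u : cone (val u) = inl (g u).
  rewrite /cone ulE /g; case: (ul u) => l t /=.
  case: pselect => [b0'|nb0]; last by case: (nb0 (b0 u)).
  by congr (inl (l, _)); apply: val_inj.
have : open (g @^-1` V) by move/continuousP: cg; apply.
congr open; apply/seteqP; split => u /=; rewrite gE.
  by exists (g u).
by move=> [q Vq [<-]].
Qed.

End teardrop_topology.

(** * The distance to the p-stratum *)

Section strat.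
Variables (R : realType) (N : nat) (S : Sam R N).
Local Notation E := 'rV[R]_N.
Local Notation X := (total_set S).
Local Notation P := (pstratum S).
Local Notation s := (strat_dist S).
Hypotheses (cX : compact X) (strS : stratified S).
Implicit Types x y : E.

Lemma compact_pstratum : compact P.
Proof. by have [C cC ->] := strS; exact: compact_closedI. Qed.

Let cP := compact_pstratum.

Lemma strat_dist_set0 x : P = set0 -> s x = 1.
Proof.
move=> P0; rewrite /strat_dist P0 /set_dist image_set0 ereal_inf0.
by rewrite (min_idPr _)// leey.
Qed.

Lemma strat_distE x : P !=set0 -> s x = Num.min (edist P x) 1.
Proof.
move=> P0; rewrite /strat_dist (set_distE cP P0) -EFin_min//.
Qed.

Lemma continuous_strat_dist : continuous s.
Proof.
have [P0|/set0P P0] := eqVneq P set0.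
  have -> : s = fun=> 1 by apply/funext => x; exact: strat_dist_set0.
  exact: continuous_cst.
have -> : s = fun x => Num.min (edist P x) 1 by apply/funext => x; exact: strat_distE.
by have c := continuous_edist cP P0; cont.
Qed.

Lemma strat_dist_eq0 x : s x = 0 <-> P x.
Proof.
have [P0|/set0P P0] := eqVneq P set0.
  by rewrite (strat_dist_set0 x P0) P0; split => // /eqP; rewrite oner_eq0.
rewrite (strat_distE x P0); split=> [m0|Px].
  apply: (edist_eq0 cP P0); move: m0; rewrite minElt; case: ifP => _; first by move->.
  by move=> /eqP; rewrite oner_eq0.
by rewrite (edist_mem cP P0 Px) (min_idPl ler01).
Qed.

Lemma strat_dist_gt0 x : ~ P x -> 0 < s x.
Proof.
move=> nP; rewrite lt_def strat_dist_ge0 andbT; apply/eqP => /strat_dist_eq0.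
exact: nP.
Qed.

Lemma closed_strat_preimage (J : set R) : closed J ->
  compact (strat_preimage S J).
Proof.
move=> cJ; apply: (compact_closedI cX (B := s @^-1` J)).
by apply: preimage_closed => // x _; exact: continuous_strat_dist.
Qed.

(** Entries given by distances to the p-stratum, without the cut-off at 1. *)
Lemma entry_pE v x : Omega v ->
  entry_p S v x <-> X x /\ exists y, P y /\ dot (y - x) (y - x) <= v.2 * v.2.
Proof.
move=> [v0 v12 v1]; rewrite /entry_p /strat_preimage /= in_itv/= strat_dist_ge0 /=.
have v2 : 0 < v.2 := lt_trans v0 v12.
have [P0|/set0P P0] := eqVneq P set0.
  rewrite (strat_dist_set0 x P0) P0; split=> -[_].
    by rewrite leNgt v1.
  by move=> [y []].
rewrite (strat_distE x P0) ge_min (lt_geF v1) orbF.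
split=> -[Xx].
  have [y Py yx] := edist_attained cP P0 x => h; split => //; exists y; split => //.
  by rewrite -expr2 -enorm_le ?yx// ltW.
move=> [y [Py yx]]; split => //; apply: le_trans (edist_le P0 x Py) _.
by rewrite enorm_le ?expr2// ltW.
Qed.

Lemma entry_qE v x : Omega v ->
  entry_q S v x <-> X x /\ forall y, P y -> v.1 * v.1 <= dot (y - x) (y - x).
Proof.
move=> [v0 v12 v2]; rewrite /entry_q /strat_preimage /= in_itv/= strat_dist_le1 andbT.
have v1 : v.1 < 1 := lt_trans v12 v2.
have [P0|/set0P P0] := eqVneq P set0.
  by rewrite (strat_dist_set0 x P0) P0; split=> -[Xx _]; split => //; exact: ltW.
rewrite (strat_distE x P0) le_min (ltW v1) andbT.
have E (y : E) : (v.1 <= enorm (y - x)) = (v.1 * v.1 <= dot (y - x) (y - x)).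
  by rewrite -sqr_enorm -expr2 ler_sqr ?nnegrE ?enorm_ge0// ltW.
split=> -[Xx h]; split => //.
  by move=> y Py; rewrite -E; apply: le_trans h _; exact: edist_le.
by have [y Py <-] := edist_attained cP P0 x; rewrite E; exact: h.
Qed.

Lemma entry_pqE v : Omega v -> entry_pq S v = entry_p S v `&` entry_q S v.
Proof.
move=> vO; apply/seteqP; split=> [x e|x [[Xx] + [_]]].
  by split; [exact: entry_pq_sub_p|exact: entry_pq_sub_q].
by rewrite /entry_pq /strat_preimage /= !in_itv /= => /andP[_ ->] /andP[-> _].
Qed.

(** [push (x, a)] is the point at height [a] on the generator of the open cylinder
through [x]. Being defined on all of [E * R] by an arbitrary extension, it has its
continuity expressed by maps into the set where it is meaningful. *)
Lemma push_exists : cylinder_interior S -> exists push : E * R -> E,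
  let A := strat_preimage S `]0, 1[%classic in
  [/\ forall (Z : topologicalType) (f : Z -> E) (g : Z -> R),
        continuous f -> continuous g -> (forall z, A (f z) /\ 0 < g z < 1) ->
        continuous (fun z => push (f z, g z)),
      forall x a, A x -> 0 < a < 1 -> A (push (x, a)) /\ s (push (x, a)) = a &
      forall x, A x -> push (x, s x) = x].
Proof.
move=> [h [[ch [k [ck hK kH]]] hs]].
set A := strat_preimage S _ in h ch k ck hK kH hs *.
have gJ (a : R) : 0 < a < 1 -> [set` `]0, 1[%R : interval R] a by rewrite /= in_itv.
pose push (p : E * R) : E := match pselect (A p.1), pselect (0 < p.2 < 1) with
  | left a, left b => val (k ((h (set_mk a)).1, set_mk (gJ _ b)))
  | _, _ => p.1 end.
have pushE x a (Ax : A x) (a01 : 0 < a < 1) :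
    push (x, a) = val (k ((h (set_mk Ax)).1, set_mk (gJ _ a01))).
  rewrite /push /=; case: pselect => // Ax'; case: pselect => // a01'.
  by congr (val (k ((h _).1, _))); apply: val_inj.
exists push; split=> [Z f g cf cg fg|x a Ax a01|x Ax].
- have -> : (fun z => push (f z, g z)) = fun z =>
      val (k ((h (set_mk (proj1 (fg z)))).1, set_mk (gJ _ (proj2 (fg z))))).
    by apply/funext => z; rewrite (pushE _ _ (proj1 (fg z)) (proj2 (fg z))).
  apply: continuous_fun_comp _ (@continuous_set_val _ _).
  apply: (continuous_fun_comp (g := k)); last exact: ck.
  apply: continuous_pair; last exact: continuous_set_mk.
  apply: continuous_fst; apply: (continuous_fun_comp (g := h)) => //.
  exact: continuous_set_mk.
- rewrite (pushE _ _ Ax a01); split; first exact: set_mkP.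
  by rewrite -hs kH.
- have s01 : 0 < s x < 1 by have [_] := Ax; rewrite /= in_itv.
  rewrite (pushE _ _ Ax s01).
  have -> : ((h (set_mk Ax)).1, set_mk (gJ _ s01)) = h (set_mk Ax).
    by rewrite [RHS]surjective_pairing; congr pair; apply: val_inj; rewrite /= hs.
  by rewrite hK.
Qed.

(** [ray (x, b)] is the point of the mapping cylinder at the fraction [b] of the way
to [x] from its projection to the p-stratum. *)
Lemma ray_exists : cylinder_neighborhood S -> exists (Nb : set E) (ray : E * R -> E),
  [/\ Nb `<=` X,
      exists O, [/\ open O, P `<=` O & O `&` X `<=` Nb],
      forall (Z : topologicalType) (f : Z -> E) (g : Z -> R),
        continuous f -> continuous g -> (forall z, Nb (f z)) ->
        continuous (fun z => ray (f z, g z)) &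
      forall x, Nb x -> [/\ forall b, Nb (ray (x, b)), ray (x, 1) = x, P (ray (x, 0)),
        P x -> forall b, ray (x, b) = x &
        ~ P x -> forall b, 0 < b -> ~ P (ray (x, b))]].
Proof.
move=> [Nb [NbX hO [L [r [h [cr [ch [k [ck hK kH]]] hP]]]]]].
have Pk z : P (val (k z)) <-> exists y : P, z = inr y by rewrite hP kH.
pose ray (p : E * R) : E := if pselect (Nb p.1) is left n
  then val (k (cone (h (set_mk n), clamp p.2))) else p.1.
have rayE x b (n : Nb x) : ray (x, b) = val (k (cone (h (set_mk n), clamp b))).
  rewrite /ray /=; case: pselect => // n'.
  by congr (val (k (cone (h _, _)))); apply: val_inj.
exists Nb, ray; split => // [Z f g cf cg fN|x Nx].
  have -> : (fun z => ray (f z, g z)) =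
      fun z => val (k (cone (h (set_mk (fN z)), clamp (g z)))).
    by apply/funext => z; rewrite (rayE _ _ (fN z)).
  apply: continuous_fun_comp _ (@continuous_set_val _ _).
  apply: (continuous_fun_comp (g := k)) => //.
  apply: (continuous_fun_comp (g := @cone _ _ _ r)); last exact: continuous_cone.
  apply: continuous_pair; last exact: continuous_clamp.
  by apply: (continuous_fun_comp (g := h)) => //; exact: continuous_set_mk.
split=> [b||| Px b|nPx b b0].
- by rewrite (rayE _ _ Nx); exact: set_mkP.
- by rewrite (rayE _ _ Nx) clamp_ge1// cone1 hK.
- rewrite (rayE _ _ Nx) clamp_le0//; apply/Pk; exact: cone0.
- rewrite (rayE _ _ Nx).
  have [y hy] : exists y : P, h (set_mk Nx) = inr y by apply/hP.
  by rewrite hy /cone /= -hy hK.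
- rewrite (rayE _ _ Nx); have [q hq] : exists q, h (set_mk Nx) = inl q.
    case hE : (h (set_mk Nx)) => [q|y]; first by exists q.
    by case: nPx; apply/(hP (set_mk Nx)); exists y.
  have cb0 : 0 < (val (clamp b) : R) by rewrite /= lt_max lt_min ltr01 b0 orbT.
  by rewrite hq; have [q' ->] := cone_inl r q cb0; move=> /Pk[].
Qed.

End strat.

(** * Deformations along the cylinders *)

Section cylinder_deformations.
Variables (R : realType) (N : nat) (S : Sam R N).
Local Notation E := 'rV[R]_N.
Local Notation I := (@unitI R).
Local Notation i0 := (unitI_zero R).
Local Notation i1 := (unitI_one R).
Local Notation X := (total_set S).
Local Notation P := (pstratum S).
Local Notation s := (strat_dist S).
Hypotheses (cX : compact X) (strS : stratified S).

Let PX : P `<=` X := @pstratum_sub _ _ S.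
Let s0P x : s x = 0 <-> P x. Proof. exact: strat_dist_eq0. Qed.

Lemma continuous_strat_dist_comp (Z : topologicalType) (f : Z -> E) :
  continuous f -> continuous (fun z => s (f z)).
Proof. by move=> cf; apply: continuous_fun_comp cf (continuous_strat_dist cX strS). Qed.

(** Along the generators of the open cylinder, the points of small height rise until
time 1, when they have reached height [v1]. *)
Lemma push_up_exists (v1 : R) : 0 < v1 -> v1 < 1 -> cylinder_interior S ->
  exists U : qstratum S * I -> E,
    [/\ continuous U, forall x u, qstratum S (U (x, u)),
        forall x, U (x, i0) = val x,
        forall x u, s (U (x, u)) = Num.max (s (val x)) (val u * v1) &
        forall x u, v1 <= s (val x) -> U (x, u) = val x].
Proof.
move=> v10 v11 /push_exists[push [cpush pushA push_id]].
pose a (p : qstratum S * I) : R := Num.max (s (val p.1)) (val p.2 * v1).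
pose U (p : qstratum S * I) := if s (val p.1) < 1 then push (val p.1, a p) else val p.1.
have sx0 (x : qstratum S) : 0 < s (val x).
  by have [_ nP] := set_mkP x; exact: strat_dist_gt0.
have uv (u : I) : val u * v1 <= v1.
  by have /andP[u0 u1] := unitIP u; rewrite ler_piMl// ltW.
have aA p : s (val p.1) < 1 -> strat_preimage S `]0, 1[%classic (val p.1) /\ 0 < a p < 1.
  move=> s1; split.
    by split; [have [] := set_mkP p.1|rewrite /= in_itv/= sx0].
  by rewrite /a lt_max sx0 gt_max s1 /= (le_lt_trans (uv _)).
have Uid x u : v1 <= s (val x) -> U (x, u) = val x.
  move=> vx; rewrite /U /a /=; case: ifPn => // s1.
  rewrite (max_idPl _); last exact: le_trans (uv u) vx.
  by apply: push_id; have [] := aA (x, u) s1.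
have sU x u : s (U (x, u)) = a (x, u).
  rewrite /U /=; case: ifPn => [s1|]; last first.
    rewrite -leNgt => s1; rewrite /a (max_idPl _)//.
    by apply: le_trans s1; exact: le_trans (uv u) (ltW v11).
  by have [Ax a01] := aA (x, u) s1; have [] := pushA _ _ Ax a01.
exists U; split => //.
- have cs1 : continuous (fun p : qstratum S * I => s (val p.1)).
    by apply: continuous_strat_dist_comp; cont.
  apply: continuous_open_cover => p; have [s1|s1] := ltP (s (val p.1)) 1.
    exists [set p : qstratum S * I | s (val p.1) < 1].
      split => //; apply: (open_comp (f := fun p : qstratum S * I => s (val p.1))
        (D := [set r | r < 1])); [by move=> q _; exact: cs1|exact: open_lt].
    have -> : (fun u : [set p : qstratum S * I | s (val p.1) < 1] => U (val u)) =
        fun u => push (val (val u).1, a (val u)).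
      by apply/funext => u; rewrite /U ifT//; exact: (set_mkP u).
    apply: cpush.
    + by cont.
    + rewrite /a; apply: continuous_max; last by cont.
      by apply: continuous_strat_dist_comp; cont.
    + by move=> u; apply: aA; exact: (set_mkP u).
  exists [set p : qstratum S * I | v1 < s (val p.1)].
    split; last exact: lt_le_trans s1.
    apply: (open_comp (f := fun p : qstratum S * I => s (val p.1))
      (D := [set r | v1 < r])); [by move=> q _; exact: cs1|exact: open_gt].
  have -> : (fun u : [set p : qstratum S * I | v1 < s (val p.1)] => U (val u)) =
      fun u => val (val u).1.
    apply/funext => u; have : v1 < s (val (val u).1) := set_mkP u.
    by case: (val u) => x t /ltW; exact: Uid.
  by cont.
- move=> x u; split; last by move=> /s0P; rewrite sU => /eqP; rewrite gt_eqF// lt_max sx0.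
  rewrite /U /=; case: ifPn => s1; last by have [] := set_mkP x.
  by have [Ax a01] := aA (x, u) s1; have [[]] := pushA _ _ Ax a01.
- move=> x; rewrite /U /a /= mul0r (max_idPl _); last by apply/ltW/sx0.
  by case: ifPn => // s1; apply: push_id; have [] := aA (x, i0) s1.
Qed.

(** The homeomorphism of the mapping cylinder need not respect the distance to the
p-stratum; but its rays are constant on that compact stratum, hence short near it. *)
Lemma short_rays (v2 : R) (Nb : set E) (ray : E * R -> E) : 0 < v2 ->
  (exists O, [/\ open O, P `<=` O & O `&` X `<=` Nb]) ->
  (forall (Z : topologicalType) (f : Z -> E) (g : Z -> R),
     continuous f -> continuous g -> (forall z, Nb (f z)) ->
     continuous (fun z => ray (f z, g z))) ->
  (forall x b, Nb x -> P x -> ray (x, b) = x) ->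
  exists d, [/\ 0 < d, d <= v2 & forall x, X x -> s x <= d ->
    Nb x /\ forall b, 0 <= b <= 1 -> s (ray (x, b)) <= v2].
Proof.
move=> v20 [V [oV PV VN]] cray rayP.
pose good (x : E) : Prop := X x -> Nb x /\ forall b, 0 <= b <= 1 -> s (ray (x, b)) <= v2.
have goodP y : P y -> nbhs y good.
  move=> Py; have Ny : Nb y by apply: VN; split; [exact: PV|exact: PX].
  pose q (p : R * Nb) : R := s (ray (val p.2, p.1)).
  have cq : continuous q.
    apply: continuous_strat_dist_comp; apply: cray; try by cont.
    by move=> z; exact: set_mkP.
  have : nbhs (set_mk Ny) [set n | forall b, `[0, 1]%classic b -> q (b, n) < v2].
    apply: (compact_forall_near (P := fun b n => q (b, n) < v2) (@segment_compact R 0 1)).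
    move=> b b01; apply: (@nbhs_preimage _ _ q [set r | r < v2]) => //.
    by rewrite /q /= rayP//; have -> := iffRL (s0P y) Py.
  rewrite nbhsE => -[_ [[W oW <-] Wy] hW].
  apply: (filterS (P := W `&` V)); last first.
    by apply: filterI; apply: open_nbhs_nbhs; split => //; exact: PV.
  move=> x [Wx Vx] Xx; have Nx : Nb x by exact: VN.
  split => // b b01; apply/ltW.
  have := hW (set_mk Nx) Wx b; apply; by rewrite /= in_itv.
pose bd := X `&` ~` (good^°).
have cbd : compact bd by apply: compact_closedI => //; exact/open_closedC/open_interior.
have done d : 0 < d -> d <= v2 -> (forall x, bd x -> d < s x) ->
    exists d, [/\ 0 < d, d <= v2 & forall x, X x -> s x <= d ->
      Nb x /\ forall b, 0 <= b <= 1 -> s (ray (x, b)) <= v2].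
  move=> d0 dv hd; exists d; split => // x Xx sd.
  have : good^° x.
    by apply: contrapT => ng; have := hd x (conj Xx ng); rewrite ltNge sd.
  by move=> /nbhs_singleton; apply.
have [[z bz]|nbd] := pselect (bd !=set0); last first.
  by apply: (done v2) => // x bx; case: nbd; exists x.
have [m /set_mem bm mmin] := compact_EVT_min (ex_intro _ z bz) cbd
  (continuous_subspaceT (continuous_strat_dist cX strS)).
have sm : 0 < s m.
  by apply: (strat_dist_gt0 cX strS) => Pm; have [_] := bm; apply; exact: goodP.
apply: (done (Num.min v2 (s m / 2))).
- by rewrite lt_min v20 divr_gt0.
- by rewrite ge_min lexx.
- move=> x bx; apply: (@le_lt_trans _ _ (s m / 2)); first by rewrite ge_min lexx orbT.
  by have := mmin x (mem_set bx); lra.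
Qed.

(** A deformation of the p-entry onto the p-stratum, with time running backwards so
that the track of a point outside the p-stratum is a homotopy link: the second half
compresses the entry along the generators of the open cylinder to height at most
[d], where [short_rays] applies; the first half follows the rays of the mapping
cylinder. *)
Lemma collapse_exists v : Omega v -> cylindrically_stratified S ->
  exists J : entry_p S v * I -> E,
    [/\ continuous J, forall x b, entry_p S v (J (x, b)),
        forall x, J (x, i1) = val x, forall x, P (J (x, i0)) &
        (forall x b, P (val x) -> J (x, b) = val x) /\
        forall x b, ~ P (val x) -> 0 < (val b : R) -> ~ P (J (x, b))].
Proof.
move=> [v0 v12 v1] [/(ray_exists)[Nb [ray [NX hO cray hray]]] /push_exists[push [cpush pushA push_id]]].
have v20 : 0 < v.2 := lt_trans v0 v12.
have [|d [d0 dv hd]] := short_rays v20 hO cray.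
  by move=> x b /hray[_ _ _ + _] Px; apply.
set D := entry_p S v.
have DX (x : D) : X (val x) /\ 0 <= s (val x) <= v.2.
  by have [? +] := set_mkP x; rewrite /= in_itv.
pose a (x : E) (b : R) : R := Num.min (s x) (Num.max d b).
have aA (x : D) b : ~ P (val x) ->
    strat_preimage S `]0, 1[%classic (val x) /\ 0 < a (val x) b < 1.
  move=> /(strat_dist_gt0 cX strS) sx; have [Xx /andP[_ sv]] := DX x.
  have s1 := le_lt_trans sv v1.
  by split; [split => //=; rewrite in_itv/= sx|rewrite /a lt_min sx lt_max d0 /= gt_min s1].
pose C x b := if pselect (P x) is left _ then x else push (x, a x b).
have CP x b : P x -> C x b = x by rewrite /C; case: pselect.
have CnP x b : ~ P x -> C x b = push (x, a x b) by rewrite /C; case: pselect.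
have Cid (x : D) b : s (val x) <= Num.max d b -> C (val x) b = val x.
  move=> sx; have [Px|nPx] := pselect (P (val x)); first exact: CP.
  by rewrite CnP// /a (min_idPl sx) push_id//; have [] := aA x b nPx.
have sC (x : D) b : s (C (val x) b) = a (val x) b.
  have [Px|nPx] := pselect (P (val x)).
    rewrite CP// /a; have -> := iffRL (s0P _) Px.
    by apply/esym/min_idPl; rewrite le_max (ltW d0).
  by rewrite CnP//; have [Ax a01] := aA x b nPx; have [] := pushA _ _ Ax a01.
have CX (x : D) b : X (C (val x) b).
  have [Px|nPx] := pselect (P (val x)); first by rewrite CP//; exact: PX.
  by rewrite CnP//; have [Ax a01] := aA x b nPx; have [[]] := pushA _ _ Ax a01.
have CnotP (x : D) b : ~ P (val x) -> ~ P (C (val x) b).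
  move=> nPx /s0P; rewrite sC; have [_ /andP[a0 _]] := aA x b nPx.
  by move=> a00; rewrite a00 ltxx in a0.
have cC (g : D * I -> R) : continuous g -> continuous (fun p : D * I => C (val p.1) (g p)).
  move=> cg; have cs1 : continuous (fun p : D * I => s (val p.1)).
    by apply: continuous_strat_dist_comp; cont.
  apply: continuous_open_cover => p; have [sp|sp] := ltP (s (val p.1)) d.
    exists [set p : D * I | s (val p.1) < d].
      split => //; apply: (open_comp (f := fun p : D * I => s (val p.1))
        (D := [set r | r < d])); [by move=> q _; exact: cs1|exact: open_lt].
    have -> : (fun u : [set p : D * I | s (val p.1) < d] => C (val (val u).1) (g (val u))) =
        fun u => val (val u).1.
      by apply/funext => u; apply: Cid; rewrite le_max ltW//; exact: (set_mkP u).
    by cont.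
  exists [set p : D * I | 0 < s (val p.1)].
    split; last exact: lt_le_trans sp.
    apply: (open_comp (f := fun p : D * I => s (val p.1))
      (D := [set r | 0 < r])); [by move=> q _; exact: cs1|exact: open_gt].
  have nPu (u : [set p : D * I | 0 < s (val p.1)]) : ~ P (val (val u).1).
    by move=> /s0P u0; have := set_mkP u; rewrite /= u0 ltxx.
  have -> : (fun u : [set p : D * I | 0 < s (val p.1)] => C (val (val u).1) (g (val u))) =
      fun u => push (val (val u).1, a (val (val u).1) (g (val u))).
    by apply/funext => u; apply: CnP; exact: nPu.
  apply: cpush; first by cont.
    rewrite /a; apply: continuous_min; first by apply: continuous_strat_dist_comp; cont.
    apply: continuous_max; first by cont.
    by apply: (continuous_fun_comp (g := g)) => //; cont.
  by move=> u; apply: aA; exact: nPu.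
have CN (x : D) : Nb (C (val x) 0) /\ forall b, 0 <= b <= 1 -> s (ray (C (val x) 0, b)) <= v.2.
  apply: hd; first exact: CX.
  by rewrite sC /a (max_idPl (ltW d0)) ge_min lexx orbT.
pose J (p : D * I) := if val p.2 <= 2^-1 :> R then ray (C (val p.1) 0, 2 * val p.2)
  else C (val p.1) (2 * val p.2 - 1).
have Jhalf (b : I) : (val b : R) <= 2^-1 -> 0 <= 2 * (val b : R) <= 1.
  by move=> b2; have /andP[b0 _] := unitIP b; apply/andP; split; lra.
exists J; split.
- rewrite /J; apply: continuous_if.
  + by cont.
  + by apply: cray; [apply: cC; cont|cont|move=> p; have [] := CN p.1].
  + by apply: cC; cont.
  + move=> [x b] /= ->; rewrite mulfV ?pnatr_eq0// subrr.
    by have [Nx _] := CN x; have [_ -> _ _ _] := hray _ Nx.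
- move=> x b; rewrite /J /=; case: ifPn => b2.
    have [Nx hx] := CN x; split; first by apply: NX; have [] := hray _ Nx.
    by rewrite /= in_itv/= strat_dist_ge0 hx// Jhalf.
  split; first exact: CX.
  rewrite /= in_itv/= strat_dist_ge0 sC /a /= ge_min.
  by have [_ /andP[_ ->]] := DX x.
- move=> x; rewrite /J /= ifF; last by apply/negbTE; rewrite -ltNge; lra.
  apply: Cid; rewrite le_max; apply/orP; right.
  by have [_ /andP[_ sv]] := DX x; lra.
- move=> x; rewrite /J /= mulr0 invr_ge0 ler0n.
  by have [Nx _] := CN x; have [_ _ ? _ _] := hray _ Nx.
split=> [x b Px|x b nPx b0]; rewrite /J /=.
  have [Nx _] := CN x; rewrite !CP// in Nx *; case: ifP => // _.
  by have [_ _ _ h _] := hray _ Nx; exact: h.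
case: ifPn => b2; last exact: CnotP.
have [Nx _] := CN x; have [_ _ _ _ h] := hray _ Nx.
by apply: h; [exact: CnotP|rewrite mulr_gt0].
Qed.

End cylinder_deformations.

(** * Isomorphisms of constant diagrams, and the entries *)

Section isomorphisms.
Variable D : category.
Implicit Types X Y Z : D.

Lemma isomorphic_sym X Y : isomorphic X Y -> isomorphic Y X.
Proof. by move=> [f [g [gf fg]]]; exists g, f. Qed.

Lemma hcomp_cancel X Y Z W (f : mor X Y) (h : mor Y Z) (k : mor Z Y) (g : mor Y W) :
  mor_eq (hcomp k h) (idm Y) -> mor_eq (hcomp (hcomp g k) (hcomp h f)) (hcomp g f).
Proof.
move=> kh; apply: mor_eq_trans (mor_eq_sym (hcomp_assoc _ _ _)) _.
apply: hcomp_eq; first exact: mor_eq_refl.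
apply: mor_eq_trans (hcomp_assoc _ _ _) _.
apply: mor_eq_trans (hcomp_eq kh (mor_eq_refl f)) _; exact: hcomp_idl.
Qed.

Lemma isomorphic_trans X Y Z : isomorphic X Y -> isomorphic Y Z -> isomorphic X Z.
Proof.
move=> [f [g [gf fg]]] [h [k [kh hk]]]; exists (hcomp h f), (hcomp g k); split.
  exact: mor_eq_trans (hcomp_cancel _ _ kh) gf.
exact: mor_eq_trans (hcomp_cancel _ _ fg) hk.
Qed.

Lemma isomorphic_localization (W : forall X Y, mor X Y -> Prop) X Y (w : mor X Y) :
  W X Y w -> isomorphic (C := localization W) X Y.
Proof.
by move=> ww; exists (loc_of W w), (loc_inv ww); split; [exact: loc_invl|exact: loc_invr].
Qed.

End isomorphisms.

Section diagrams.
Variable R : realType.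

Definition span_diagram (X Y Z : topologicalType) (f : Y -> X) (g : Y -> Z)
    (cf : continuous f) (cg : continuous g) : DiagP R :=
  StratDiagram (dg_map R cf) (dg_map R cg).

Lemma span_weq (X Y Z X' Y' Z' : topologicalType) (f : Y -> X) (g : Y -> Z)
    (f' : Y' -> X') (g' : Y' -> Z') (cf : continuous f) (cg : continuous g)
    (cf' : continuous f') (cg' : continuous g')
    (a : X -> X') (b : Y -> Y') (c : Z -> Z') :
  (forall y, a (f y) = f' (b y)) -> (forall y, c (g y) = g' (b y)) ->
  weak_homotopy_equivalence R a -> weak_homotopy_equivalence R b ->
  weak_homotopy_equivalence R c ->
  exists m : mor (span_diagram cf cg) (span_diagram cf' cg'), diag_weq m.
Proof.
move=> af cgE wa wb wc; have [ca _ _] := wa; have [cb _ _] := wb; have [cc _ _] := wc.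
exists (@DiagHom R (span_diagram cf cg) (span_diagram cf' cg')
  (dg_map R ca) (dg_map R cb) (dg_map R cc) af cgE).
by split; exact: weak_equivalence_deltaification.
Qed.

Lemma weak_equivalence_id (X : topologicalType) :
  weak_homotopy_equivalence R (fun x : X => x).
Proof.
apply: (@weak_equivalence_of_homotopy_inverse R X X (fun x => x) (fun x => x)
  (fun p => p.1) (fun p => p.1)) => //; by cont.
Qed.

Definition const_nt (U : category) (D E : DiagP R) (m : mor D E) :
    nattrans (const_functor U D) (const_functor U E).
Proof.
exists (fun=> m) => X Y f.
by apply: mor_eq_trans (hcomp_idr m) _; exact/mor_eq_sym/hcomp_idl.
Defined.

Definition const_isomorphic (U : category) (D E : DiagP R) : Prop :=
  isomorphic (C := HoDiagP R U) (const_functor U D) (const_functor U E).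

Lemma const_isomorphic_sym (U : category) (D E : DiagP R) :
  const_isomorphic U D E -> const_isomorphic U E D.
Proof. exact: isomorphic_sym. Qed.

Lemma const_isomorphic_trans (U : category) (D E F : DiagP R) :
  const_isomorphic U D E -> const_isomorphic U E F -> const_isomorphic U D F.
Proof. exact: isomorphic_trans. Qed.

Lemma const_isomorphic_weq (U : category) (D E : DiagP R) :
  (exists m : mor D E, diag_weq m) -> const_isomorphic U D E.
Proof.
move=> [m wm]; apply: (@isomorphic_localization (functor_cat U (DiagP R)) _ _ _
  (const_nt U m)).
by move=> x; exact: wm.
Qed.

End diagrams.

Arguments span_weq {R X Y Z X' Y' Z' f g f' g' cf cg cf' cg'} a b c.

Section entries.
Variables (R : realType) (N : nat) (S : Sam R N).
Local Notation E := 'rV[R]_N.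
Hypotheses (cX : compact (total_set S)) (strS : stratified S).

Lemma compact_entry_p v : compact (entry_p S v).
Proof. by apply: closed_strat_preimage => //; exact: interval_closed. Qed.

Lemma compact_entry_pq v : compact (entry_pq S v).
Proof. by apply: closed_strat_preimage => //; exact: interval_closed. Qed.

Lemma compact_entry_q v : compact (entry_q S v).
Proof. by apply: closed_strat_preimage => //; exact: interval_closed. Qed.

Lemma thickening0 (A : set E) : thickening A 0 = A.
Proof.
apply/seteqP; split=> [y [x Ax xy]|y Ay]; last by exists y; rewrite ?subrr ?enorm0.
have : enorm (x - y) = 0 by apply/le_anti; rewrite xy enorm_ge0.
by move=> /enorm_eq0 /subr0_eq <-.
Qed.

Variable Def : forall n, set (set 'rV[R]_n).
Hypotheses (omin : o_minimal_structure Def) (dS : definable Def S).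

Lemma definable_total_set : Def (total_set S).
Proof.
have -> : total_set S = pstratum S `|` qstratum S.
  by rewrite /qstratum setDUK//; exact: pstratum_sub.
by have [? ?] := dS; exact: def_setU.
Qed.

Lemma definable_entry_p v : Omega v -> Def (entry_p S v).
Proof.
move=> vO; have dX := definable_total_set; have [dP _] := dS.
have -> : entry_p S v = [set x | total_set S x /\
    exists y : E, pstratum S y /\ dot (y - x) (y - x) <= v.2 * v.2].
  by apply/funext => x; apply/propext; exact: entry_pE.
definable omin.
Qed.

Lemma definable_entry_q v : Omega v -> Def (entry_q S v).
Proof.
move=> vO; have dX := definable_total_set; have [dP _] := dS.
have -> : entry_q S v = [set x | total_set S x /\
    forall y : E, pstratum S y -> v.1 * v.1 <= dot (y - x) (y - x)].
  by apply/funext => x; apply/propext; exact: entry_qE.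
definable omin.
Qed.

Lemma definable_entry_pq v : Omega v -> Def (entry_pq S v).
Proof.
move=> vO; have dp := definable_entry_p vO; have dq := definable_entry_q vO.
rewrite entry_pqE//; suff : Def [set x | entry_p S v x /\ entry_q S v x] by [].
definable omin.
Qed.

End entries.

(** * Spaces of paths *)

Section minimum_over_interval.
Variables (R : realType) (Z : topologicalType).
Local Notation I := (@unitI R).

Lemma continuous_minimum (m : Z * I -> R) : continuous m ->
  exists c : Z -> R, [/\ continuous c, forall z t, c z <= m (z, t) &
    forall z, exists t, c z = m (z, t)].
Proof.
move=> cm; have cmf (Z' : topologicalType) (f : Z' -> Z) (g : Z' -> I) :
    continuous f -> continuous g -> continuous (fun w => m (f w, g w)).
  by move=> cf cg; apply: (continuous_fun_comp (g := m)) => //; exact: continuous_pair.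
have hmin z : exists t, forall u, m (z, t) <= m (z, u).
  have [|t _ mt] := compact_EVT_min (f := fun t => m (z, t)) (ex_intro _ (unitI_zero R) Logic.I)
      (@compact_unitI R).
    by apply: continuous_subspaceT; apply: cmf; cont.
  by exists t => u; apply: mt; exact: mem_set.
have [t ht] := choice hmin; exists (fun z => m (z, t z)); split => // [z|z]; last by exists (t z).
apply/cvgrPdist_lt => e e0.
have : nbhs z [set y | forall u, [set: I] u -> `|m (y, u) - m (z, u)| < e].
  apply: (compact_forall_near (P := fun u y => `|m (y, u) - m (z, u)| < e) (@compact_unitI R)).
  move=> u _; pose q (p : I * Z) := `|m (p.2, p.1) - m (z, p.1)|.
  have cq : continuous q by apply: continuous_abs; apply: continuous_add; [apply: cmf|apply: continuous_opp; apply: cmf]; cont.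
  by apply: (@nbhs_preimage _ _ q [set r | r < e]) => //; rewrite /q /= subrr normr0.
apply: filterS => y hy; rewrite ltr_norml.
have := hy (t z) Logic.I; have := hy (t y) Logic.I; rewrite !ltr_norml.
have := ht z (t y); have := ht y (t z).
by move=> h1 h2 /andP[h3 h4] /andP[h5 h6]; apply/andP; split; lra.
Qed.

End minimum_over_interval.

Section holinks.
Variables (R : realType) (N : nat) (S : Sam R N).
Local Notation E := 'rV[R]_N.
Local Notation I := (@unitI R).
Local Notation X := (total_set S).

Let locI : locally_compact [set: I].
Proof.
by move=> x _; exists setT; [exact: filterT|split; [exact: compact_unitI|exact: closedT]].
Qed.

Let hausI : hausdorff_space I.
Proof.
have := @Rhausdorff R; rewrite !open_hausdorff => hR x y xy.
have [|[A B] /= [xA yB] [oA oB AB0]] := hR (val x) (val y).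
  by apply: contra_neq xy; exact: val_inj.
exists (val @^-1` A, val @^-1` B); first by rewrite !inE in xA yB *.
split; [by exists A|by exists B|].
by rewrite /= -preimage_setI (eqP AB0) preimage_set0.
Qed.

Lemma continuous_path_eval (G : set (path_space S)) (Z : topologicalType) (f : Z -> G)
    (t : Z -> I) : (forall g : path_space S, G g -> continuous (g : I -> X)) ->
  continuous f -> continuous t ->
  continuous (fun z => val ((val (f z) : path_space S) (t z))).
Proof.
move=> Gc cf ct; apply: continuous_fun_comp _ (@continuous_set_val _ _).
pose F (g : G) : I -> X := (val g : path_space S).
have cF : continuous (uncurry F).
  apply: continuous_uncurry => //.
    exact: (@continuous_set_val _ G).
  by move=> g; apply: Gc; exact: set_mkP.
have : continuous (fun z => (uncurry F) (f z, t z)).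
  by apply: (continuous_fun_comp (g := uncurry F)) => //; exact: continuous_pair.
by [].
Qed.

Lemma continuous_path_family (Z : topologicalType) (f : Z * I -> E)
    (fX : forall p, X (f p)) : continuous f ->
  continuous (fun z => (fun t => set_mk (fX (z, t))) : path_space S).
Proof.
move=> cf; have : continuous (fun p => set_mk (fX p)) by exact: continuous_set_mk.
by move=> /continuous_curry_fun.
Qed.

End holinks.

(** * Short homotopy links *)

Section short_holinks.
Variables (R : realType) (N : nat) (S : Sam R N) (v : R * R).
Local Notation E := 'rV[R]_N.
Local Notation I := (@unitI R).
Local Notation i0 := (unitI_zero R).
Local Notation i1 := (unitI_one R).
Local Notation X := (total_set S).
Local Notation P := (pstratum S).
Local Notation s := (strat_dist S).
Local Notation D := (entry_p S v).
Hypotheses (cX : compact X) (strS : stratified S) (vO : Omega v).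

(** The homotopy links within reach of the deformation of the p-entry. *)
Definition short_holink : set (path_space S) :=
  [set gamma : path_space S | @holink R N S gamma /\ forall t, D (val (gamma t))].
Local Notation HL := (@holink R N S).
Local Notation HL' := short_holink.

Lemma short_holink_sub : HL' `<=` HL. Proof. by move=> g []. Qed.

Lemma holink_continuous (g : path_space S) : HL g -> continuous (g : I -> X).
Proof. by case. Qed.

Let val_clamp_gt0 (b : R) : 0 < b -> 0 < (val (clamp b) : R).
Proof. by move=> b0; rewrite /= lt_max lt_min ltr01 b0 orbT. Qed.

Definition punctured_entry_p : set E := [set x | D x /\ ~ P x].

Lemma path_holink (f : I -> E) (fX : forall t, X (f t)) : continuous f -> P (f i0) ->
  (forall t : I, 0 < (val t : R) -> ~ P (f t)) -> HL ((fun t => set_mk (fX t)) : path_space S).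
Proof.
move=> cf P0 Pt; split; first exact: continuous_set_mk.
- exact: P0.
- by move=> t t0; split; [exact: fX|exact: Pt].
Qed.

(** Every homotopy link begins within the p-entry, and a length [c] of such a
beginning can be chosen continuously: the minimum over [t] of the larger of [t] and a
function that vanishes outside the entry. Homotopy links are shrunk to this part. *)
Lemma weak_equivalence_short_holink :
  weak_homotopy_equivalence R (set_incl short_holink_sub).
Proof.
have v20 : 0 < v.2 by have [v0 v12 _] := vO; exact: lt_trans v0 v12.
pose phi (x : E) := Num.max 0 (1 - s x / v.2).
pose at_ (g : HL) (t : I) : E := val ((val g : path_space S) t).
have cat (Z : topologicalType) (f : Z -> HL) (t : Z -> I) : continuous f -> continuous t ->
    continuous (fun z => at_ (f z) (t z)).
  by apply: continuous_path_eval => g; exact: holink_continuous.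
have [|c [cc cle catt]] := @continuous_minimum R HL
    (fun p => Num.max (val p.2) (phi (at_ p.1 p.2))).
  apply: continuous_max; first by cont.
  apply: continuous_max; first by cont.
  apply: continuous_add; first by cont.
  apply: continuous_opp; apply: continuous_mul; last by cont.
  by apply: continuous_strat_dist_comp => //; apply: cat; cont.
have Pat0 (g : HL) : P (at_ g i0) by have [_ h _] := set_mkP g.
have nPat (g : HL) (t : I) : 0 < (val t : R) -> ~ P (at_ g t).
  by move=> t0; have [_ _ h] := set_mkP g; have [] := h t t0.
have c0 g : 0 < c g.
  have [t ->] := catt g; rewrite lt_max; have /andP[t0 _] := unitIP t.
  have [->|tn0] := eqVneq t i0; last first.
    rewrite lt_def t0 andbT; apply/orP; left; apply: contra_neq tn0 => t00.
    exact: val_inj.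
  apply/orP; right; rewrite /phi; have /(strat_dist_eq0 cX strS) -> := Pat0 g.
  by rewrite mul0r subr0 lt_max ltr01 orbT.
have short g (t : I) : (val t : R) < c g -> D (at_ g t).
  move=> tc; split; first by have := set_mkP ((val g : path_space S) t).
  rewrite /= in_itv/= strat_dist_ge0 /=.
  have := cle g t; rewrite le_max => /orP[|]; first by rewrite leNgt tc.
  move=> cp; have : 0 < phi (at_ g t) by exact: lt_le_trans cp.
  rewrite /phi lt_max ltxx /= subr_gt0 ltr_pdivrMr// mul1r; exact: ltW.
(* Halving [c g] makes all the times of the shrunk link strictly smaller than
[c g], as [short] requires. *)
pose sc (g : HL) (u t : I) : I := clamp (((1 - val u) + val u * (c g / 2)) * val t).
have csc (Z : topologicalType) (f : Z -> HL) (u t : Z -> I) : continuous f ->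
    continuous u -> continuous t -> continuous (fun z => sc (f z) (u z) (t z)).
  move=> cf cu ct; apply: continuous_clamp.
  have ccf : continuous (fun z => c (f z)) by exact: continuous_fun_comp cf cc.
  have cvu : continuous (fun z => val (u z) : R).
    by apply: continuous_fun_comp _ (@continuous_set_val _ _).
  have cvt : continuous (fun z => val (t z) : R).
    by apply: continuous_fun_comp _ (@continuous_set_val _ _).
  by cont.
have sc0 g u : sc g u i0 = i0 by rewrite /sc mulr0 clamp_le0.
have sc_gt0 g (u t : I) : 0 < (val t : R) -> 0 < (val (sc g u t) : R).
  move=> t0; apply: val_clamp_gt0; rewrite mulr_gt0//.
  have /andP[u0 u1] := unitIP u; have := c0 g.
  have [->|un0] := eqVneq (val u) 0; first by lra.
  move=> cg; rewrite ltr_wpDl ?subr_ge0// mulr_gt0 ?divr_gt0//.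
  by rewrite lt_def un0.
have scX (p : HL * I * I) : X (at_ p.1.1 (sc p.1.1 p.1.2 p.2)).
  exact: (set_mkP ((val p.1.1 : path_space S) _)).
have cpath : continuous (fun p : HL * I * I => at_ p.1.1 (sc p.1.1 p.1.2 p.2)).
  by apply: cat; [cont|apply: csc; cont].
pose HP (p : HL * I) : path_space S := fun t => set_mk (scX (p, t)).
have cHP : continuous HP := continuous_path_family (fX := scX) cpath.
have HPL p : HL (HP p).
  apply: path_holink => [||t t0].
  - by apply: cat; [cont|apply: csc; cont].
  - by rewrite /= sc0; exact: Pat0.
  - by apply: nPat; exact: sc_gt0.
have HPid g : HP (g, i0) = val g.
  apply/funext => t; apply: val_inj; rewrite /= /at_ /sc /=.
  by rewrite subr0 mul0r addr0 mul1r clamp_val.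
have HP1 g : HL' (HP (g, i1)).
  split; first exact: HPL.
  move=> t; apply: short; have /andP[t0 t1] := unitIP t; have cg := c0 g.
  rewrite /sc /= subrr add0r mul1r gt_max cg gt_min; apply/orP; right.
  apply: (@le_lt_trans _ _ (c g / 2)); last by lra.
  by rewrite ler_piMr// ltW// divr_gt0.
have HPS (g : HL) u : HL' (val g) -> HL' (HP (g, u)).
  by move=> [_ gD]; split; [exact: HPL|move=> t; exact: gD].
by apply: (@weak_equivalence_incl R _ _ _ short_holink_sub HP).
Qed.

Lemma pstratum_sub_entry_p : P `<=` D.
Proof.
move=> x Px; split; first exact: pstratum_sub.
have -> : s x = 0 by exact/(strat_dist_eq0 cX strS).
by rewrite /= in_itv/= lexx; have [v0 v12 _] := vO; rewrite ltW// (lt_trans v0).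
Qed.

Definition short_path_at (g : HL') (t : I) : D := set_mk (proj2 (set_mkP g) t).

Lemma continuous_short_path_at (Z : topologicalType) (f : Z -> HL') (t : Z -> I) : continuous f -> continuous t ->
  continuous (fun z => short_path_at (f z) (t z)).
Proof.
move=> cf ct; apply: continuous_to_set_type.
have h (g : path_space S) : HL' g -> continuous (g : I -> X) by move=> [[]].
exact: (continuous_path_eval h cf ct).
Qed.

Lemma short_path_at0 (g : HL') : P (val (short_path_at g i0)).
Proof. by have [[_ h _] _] := set_mkP g. Qed.

Lemma short_path_at_gt0 (g : HL') (t : I) : 0 < (val t : R) -> ~ P (val (short_path_at g t)).
Proof. by move=> t0; have [[_ _ h] _] := set_mkP g; have [] := h t t0. Qed.

Lemma short_holink_end (g : HL') :
  punctured_entry_p (val ((val g : path_space S) i1)).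
Proof. by split; [exact: (set_mkP (short_path_at g i1))|apply: (short_path_at_gt0 (t := i1)); exact: ltr01]. Qed.

Definition short_holink_eval1 (g : HL') : punctured_entry_p := set_mk (short_holink_end g).

Variable J : D * I -> E.
Hypotheses (cJ : continuous J) (JD : forall p, D (J p)) (J1 : forall x, J (x, i1) = val x)
  (J0 : forall x, P (J (x, i0))) (JP : forall x b, P (val x) -> J (x, b) = val x)
  (JnP : forall x (b : I), ~ P (val x) -> 0 < (val b : R) -> ~ P (J (x, b))).

Lemma weak_equivalence_pstratum : weak_homotopy_equivalence R (set_incl pstratum_sub_entry_p).
Proof.
apply: (@weak_equivalence_incl R _ _ _ pstratum_sub_entry_p (fun p => J (p.1, clamp (1 - val p.2)))).
- apply: (continuous_fun_comp (g := J)) => //; apply: continuous_pair; first by cont.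
  by apply: continuous_clamp; cont.
- by move=> b t; exact: JD.
- by move=> b; rewrite /= subr0 clamp_ge1.
- by move=> b; rewrite /= subrr clamp_le0.
- by move=> b t Pb; rewrite /= JP.
Qed.

(** The inverse sends a point to its track under [J]. A homotopy link [g] is deformed
into the track of its end point through the paths [t |-> J (g t', t'')], where first
[t''] comes down from 1 to [t] and then [t'] goes up from [t] to 1. *)
Lemma weak_equivalence_short_holink_eval1 :
  weak_homotopy_equivalence R short_holink_eval1.
Proof.
have punD (x : punctured_entry_p) : D (val x) by have [] := set_mkP x.
have JX (p : D * I) : X (J p) by have [] := JD p.
(* the path of collapse through a point of the punctured entry *)
have cray : continuous (fun p : punctured_entry_p * I => J (set_mk (punD p.1), p.2)).
  apply: (continuous_fun_comp (g := J)) => //; apply: continuous_pair; last by cont.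
  by apply: continuous_set_mk; cont.
have rayX (p : punctured_entry_p * I) : X (J (set_mk (punD p.1), p.2)) by exact: JX.
pose ray (x : punctured_entry_p) : path_space S := fun t => set_mk (rayX (x, t)).
have rayHL x : HL' (ray x).
  have [Dx nPx] := set_mkP x; split; last by move=> t; exact: JD.
  apply: path_holink => [||t t0].
  - by apply: (continuous_fun_comp (f := pair x)) cray; cont.
  - exact: J0.
  - exact: JnP.
pose H (p : HL' * I * I) : E :=
  J (short_path_at p.1.1 (clamp (Num.max (val p.2) (2 * val p.1.2 - 1))),
     clamp (Num.max (val p.2) (1 - 2 * val p.1.2))).
have cH : continuous H.
  apply: (continuous_fun_comp (g := J)) => //; apply: continuous_pair.
    by apply: continuous_short_path_at; [cont|apply: continuous_clamp; cont].
  by apply: continuous_clamp; cont.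
have HX p : X (H p) by exact: JX.
pose HP (p : HL' * I) : path_space S := fun t => set_mk (HX (p, t)).
have HPL p : HL' (HP p).
  split; last by move=> t; exact: JD.
  apply: path_holink => [||t t0].
  - by apply: (continuous_fun_comp (g := H)) => //; cont.
  - have [w1|w1] := leP (2 * val p.2) (1 : R).
      rewrite /H /= [X in short_path_at _ X]clamp_le0; first by rewrite JP; exact: short_path_at0.
      by rewrite ge_max lexx subr_le0.
    rewrite /H /= [X in J (_, X)]clamp_le0; first exact: J0.
    by rewrite ge_max lexx subr_le0 ltW.
  - apply: JnP; last by apply: val_clamp_gt0; rewrite lt_max t0.
    by apply: short_path_at_gt0; apply: val_clamp_gt0; rewrite lt_max t0.
apply: (@weak_equivalence_of_homotopy_inverse R _ _ short_holink_eval1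
  (fun x => set_mk (rayHL x)) (fun p => set_mk (HPL p)) (fun p => p.1)).
- apply: continuous_to_set_type.
  have : continuous (fun g : HL' => val (short_path_at g i1)).
    by apply: continuous_fun_comp _ (@continuous_set_val _ _); apply: continuous_short_path_at; cont.
  by [].
- by apply: continuous_set_mk; exact: (continuous_path_family (fX := rayX) cray).
- by apply: continuous_set_mk; exact: (continuous_path_family (fX := HX) cH).
- by cont.
- move=> g; apply: val_inj; apply/funext => t; apply: val_inj => /=.
  have /= /andP[t0 t1] := unitIP t.
  rewrite /H /= mulr0 subr0 sub0r (max_idPl _) ?clamp_val; last by lra.
  by rewrite clamp_ge1 ?J1// le_max lexx orbT.
- move=> g; apply: val_inj; apply/funext => t; apply: val_inj => /=.
  have /= /andP[t0 t1] := unitIP t.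
  rewrite /H /= mulr1 clamp_ge1; last by rewrite le_max; apply/orP; right; lra.
  rewrite (max_idPl _) ?clamp_val; last by lra.
  by congr (J (_, _)); apply: val_inj.
- by [].
- by move=> x; apply: val_inj => /=; rewrite J1.
- move=> g t; apply: val_inj => /=; rewrite /H /=.
  by rewrite !clamp_ge1 ?J1// le_max lexx.
Qed.

End short_holinks.

(** * From the entries to the homotopy link *)

Section cylinder_ends.
Variables (R : realType) (Z : topologicalType).
Local Notation I := (@unitI R).

Lemma weak_equivalence_cylinder_end0 :
  weak_homotopy_equivalence R (fun z : Z => (z, unitI_zero R)).
Proof.
apply: (@weak_equivalence_of_homotopy_inverse R Z (Z * I)%type _ (fun p => p.1)
  (fun p => p.1) (fun p => (p.1.1, clamp (Num.min (val p.1.2) (1 - val p.2))))) => //.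
- by cont.
- by cont.
- by cont.
- by apply: continuous_pair; [cont|apply: continuous_clamp; cont].
- move=> [z t] /=; have /= /andP[t0 t1] := unitIP t.
  by rewrite subr0 (min_idPl t1) clamp_val.
- by move=> [z t] /=; rewrite subrr clamp_le0// ge_min lexx orbT.
- by move=> z t /=; rewrite clamp_le0// ge_min lexx.
Qed.

Lemma weak_equivalence_cylinder_end1 :
  weak_homotopy_equivalence R (fun z : Z => (z, unitI_one R)).
Proof.
apply: (@weak_equivalence_of_homotopy_inverse R Z (Z * I)%type _ (fun p => p.1)
  (fun p => p.1) (fun p => (p.1.1, clamp (Num.max (val p.1.2) (val p.2))))) => //.
- by cont.
- by cont.
- by cont.
- by apply: continuous_pair; [cont|apply: continuous_clamp; cont].
- move=> [z t] /=; have /= /andP[t0 t1] := unitIP t.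
  by rewrite (max_idPl t0) clamp_val.
- by move=> [z t] /=; rewrite clamp_ge1// le_max lexx orbT.
- by move=> z t /=; rewrite clamp_ge1// le_max lexx.
Qed.

End cylinder_ends.

Section zigzag.
Variables (R : realType) (N : nat) (S : Sam R N) (v : R * R).
Local Notation E := 'rV[R]_N.
Local Notation I := (@unitI R).
Local Notation i0 := (unitI_zero R).
Local Notation i1 := (unitI_one R).
Local Notation X := (total_set S).
Local Notation P := (pstratum S).
Local Notation D := (entry_p S v).
Local Notation D' := (punctured_entry_p S v).
Local Notation HL' := (@short_holink R N S v).
Hypotheses (cX : compact X) (strS : stratified S) (vO : Omega v)
  (cylS : cylindrically_stratified S).
Variable U : category.

Let subD : D' `<=` D. Proof. by move=> x []. Qed.
Let subq : D' `<=` qstratum S. Proof. by move=> x [[Xx _] nPx]. Qed.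

Let span_of_inclusions : DiagP R :=
  span_diagram R (set_incl_continuous subD) (set_incl_continuous subq).

(** The generators of the open cylinder push the q-stratum up into the q-entry, and
the punctured p-entry up into the middle entry. *)
Lemma entries_const_isomorphic :
  const_isomorphic U (thickened_diagram S v 0) span_of_inclusions.
Proof.
have [v0 v12 v21] := vO; have v11 := lt_trans v12 v21.
have [push [cpush pushq push0 spush push_id]] := push_up_exists cX strS v0 v11 (proj2 cylS).
have tp : thickening D 0 `<=` D by rewrite thickening0.
have tpq : thickening (entry_pq S v) 0 `<=` D'.
  rewrite thickening0 => x xpq; split; first exact: entry_pq_sub_p.
  move=> /(strat_dist_eq0 cX strS) s0; have [_] := xpq.
  by rewrite /= in_itv/= s0 leNgt v0.
have tq : thickening (entry_q S v) 0 `<=` qstratum S.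
  rewrite thickening0 => x [Xx xq]; split => //.
  move=> /(strat_dist_eq0 cX strS) s0; move: xq.
  by rewrite /= in_itv/= s0 leNgt v0.
apply: const_isomorphic_weq.
apply: (span_weq (set_incl tp) (set_incl tpq) (set_incl tq)).
- by move=> y; exact: val_inj.
- by move=> y; exact: val_inj.
- apply: (@weak_equivalence_incl R _ _ _ tp (fun p => val p.1)) => //.
  + by cont.
  + by move=> b t; exact: set_mkP.
  + by move=> b; rewrite thickening0; exact: set_mkP.
- pose H (p : D' * I) := push (set_incl subq p.1, p.2).
  apply: (@weak_equivalence_incl R _ _ _ tpq H).
  + apply: (continuous_fun_comp (g := push)) => //; apply: continuous_pair; last by cont.
    by apply: (continuous_fun_comp (f := fst) (g := set_incl subq));
      [cont|exact: set_incl_continuous].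
  + move=> b t; have [Xb nPb] := pushq (set_incl subq b) t.
    split => //; split => //=; rewrite in_itv/= strat_dist_ge0 spush ge_max /=.
    have [[_] + _] := set_mkP b; rewrite /= in_itv/= => /andP[_ ->] /=.
    have /andP[t0 t1] := unitIP t; apply: le_trans (ltW v12).
    by rewrite ler_piMl// ltW.
  + by move=> b; exact: push0.
  + move=> b; rewrite thickening0; split; first by have [] := pushq (set_incl subq b) i1.
    rewrite /= in_itv/= spush mul1r le_max lexx orbT ge_max (ltW v12) andbT.
    by have [[_] + _] := set_mkP b; rewrite /= in_itv/= => /andP[_ ->].
  + move=> b t; rewrite thickening0 => bpq; rewrite /H push_id//.
    by have [_] := bpq; rewrite /= in_itv/= => /andP[].
- apply: (@weak_equivalence_incl R _ _ _ tq push) => //.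
  + by move=> b; rewrite thickening0; split; [have [] := pushq b i1|
      rewrite /= in_itv/= strat_dist_le1 spush mul1r le_max lexx orbT].
  + move=> b t; rewrite thickening0 => bq; rewrite push_id//.
    by have [_] := bq; rewrite /= in_itv/= => /andP[].
Qed.

(** The punctured p-entry is replaced by the short homotopy links that end there.
Then their starting points are joined to their end points through the diagram of all
evaluations at all times, whose middle space is a cylinder over them; the p-stratum
is a deformation retract of the p-entry, and short homotopy links are equivalent to
all homotopy links. *)
Lemma holink_const_isomorphic :
  const_isomorphic U span_of_inclusions (stratification_diagram S).
Proof.
have [J [cJ JD J1 J0 [JP JnP]]] := collapse_exists cX strS vO cylS.
have JD' p : D (J p) by case: p.
have ev1_weq := weak_equivalence_short_holink_eval1 cJ JD' J1 J0 JP JnP.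
have PD_weq := weak_equivalence_pstratum cX strS vO cJ JD' J1 J0 JP.
have HL_weq := weak_equivalence_short_holink cX strS vO.
have [cev1 _ _] := ev1_weq.
pose ev0 (g : HL') : P := set_mk (short_path_at0 g).
pose at_ (p : HL' * I) : D := short_path_at p.1 p.2.
pose ev1q (g : HL') : qstratum S := set_incl subq (short_holink_eval1 g).
have cev0 : continuous ev0.
  apply: continuous_set_mk; apply: continuous_fun_comp _ (@continuous_set_val _ _).
  by apply: continuous_short_path_at; cont.
have cat : continuous at_ by apply: continuous_short_path_at; cont.
have cev1q : continuous ev1q.
  by apply: continuous_fun_comp cev1 _; exact: set_incl_continuous.
have cev1D : continuous (fun g : HL' => set_incl subD (short_holink_eval1 g)).
  by apply: continuous_fun_comp cev1 _; exact: set_incl_continuous.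
have cev1p : continuous (fun p : HL' * I => ev1q p.1).
  by apply: (continuous_fun_comp (g := ev1q)) => //; cont.
pose ends_in_entries := span_diagram R cev1D cev1q.
pose evaluation := span_diagram R cat cev1p.
pose short_holinks := span_diagram R cev0 cev1q.
apply: (const_isomorphic_trans (E := ends_in_entries)).
  apply: const_isomorphic_sym; apply: const_isomorphic_weq.
  apply: (span_weq (fun x => x) (@short_holink_eval1 R N S v)
    (fun x => x)) => //; exact: weak_equivalence_id.
apply: (const_isomorphic_trans (E := evaluation)).
  apply: const_isomorphic_weq.
  apply: (span_weq (fun x => x) (fun g : HL' => (g, i1)) (fun x => x)) => //.
  - by move=> g; exact: val_inj.
  - exact: weak_equivalence_id.
  - exact: weak_equivalence_cylinder_end1.
  - exact: weak_equivalence_id.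
apply: (const_isomorphic_trans (E := short_holinks)).
  apply: const_isomorphic_sym; apply: const_isomorphic_weq.
  apply: (span_weq (set_incl (pstratum_sub_entry_p cX strS vO))
    (fun g : HL' => (g, i0)) (fun x => x)) => //.
  - by move=> g; exact: val_inj.
  - exact: weak_equivalence_cylinder_end0.
  - exact: weak_equivalence_id.
apply: const_isomorphic_weq.
apply: (span_weq (fun x => x) (set_incl (@short_holink_sub R N S v))
  (fun x => x)) => //; try exact: weak_equivalence_id.
- by move=> g; exact: val_inj.
- by move=> g; exact: val_inj.
Qed.

Lemma zigzag_const_isomorphic :
  const_isomorphic U (thickened_diagram S v 0) (stratification_diagram S).
Proof. exact: const_isomorphic_trans entries_const_isomorphic holink_const_isomorphic. Qed.

End zigzag.

(** * The persistent stratified homotopy type *)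

Section persistent_type.
Variables (R : realType) (Def : forall n, set (set 'rV[R]_n)).
Hypothesis omin : o_minimal_structure Def.
Variables (N : nat) (S : Sam R N) (v : R * R).
Hypotheses (cX : compact (total_set S)) (strS : stratified S) (dS : definable Def S)
  (cylS : cylindrically_stratified S) (vO : Omega v).
Local Notation wfs := (min_weak_feature_size S v).

Lemma min_weak_feature_size_gt0 : (0 < wfs)%E.
Proof.
rewrite !lt_min; apply/and3P; split; apply: (weak_feature_size_gt0 omin).
- exact: compact_entry_p.
- exact: definable_entry_p.
- exact: compact_entry_pq.
- exact: definable_entry_pq.
- exact: compact_entry_q.
- exact: definable_entry_q.
Qed.

Lemma thickened_diagram_map_weq (a b : R) (ab : a <= b) : 0 <= a -> (b%:E < wfs)%E ->
  diag_weq (thickened_diagram_map S v ab).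
Proof.
move=> a0; rewrite !lt_min => /and3P[bp bpq bq].
split; apply: weak_equivalence_deltaification;
  apply: (thickening_incl_weak_equivalence omin) => //.
- exact: compact_entry_p.
- exact: definable_entry_p.
- exact: compact_entry_pq.
- exact: definable_entry_pq.
- exact: compact_entry_q.
- exact: definable_entry_q.
Qed.

Variable e : \bar R.
Hypothesis ewfs : (e <= wfs)%E.

Lemma structure_maps_weq : structure_maps_weq_below S v e.
Proof.
move=> a b ab be.
exact: (@thickened_diagram_map_weq (val a) (val b) ab (set_mkP a) (lt_le_trans be ewfs)).
Qed.

Lemma persistent_type_recovers : persistent_type_below_recovers S v e.
Proof.
pose U := poset_cat (Rplus_below e).
have U0 (a : U) : 0 <= (val a : R) by have [] := set_mkP a.
have nat (a b : U) (ab : mor a b) :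
    mor_eq (hcomp (thickened_diagram_map S v (U0 b)) (idm (thickened_diagram S v 0)))
      (hcomp (Defs.fmap (persistent_type_below S v e) ab) (thickened_diagram_map S v (U0 a))).
  by split=> x; exact: val_inj.
apply: isomorphic_trans (zigzag_const_isomorphic cX strS vO cylS U).
apply: isomorphic_sym.
apply: (@isomorphic_localization (functor_cat U (DiagP R)) _ _ _
  (@NatTrans _ _ (const_functor U (thickened_diagram S v 0)) (persistent_type_below S v e)
    (fun a => thickened_diagram_map S v (U0 a)) nat)).
move=> a; apply: thickened_diagram_map_weq => //.
by have [_ ae] := set_mkP a; exact: lt_le_trans ewfs.
Qed.

End persistent_type.

Theorem proposition3p21 (R : realType)
    (Def : forall n, set (set 'rV[R]_n)) (omin : o_minimal_structure Def)
    (N : nat) (S : Sam R N) (S_compact : compact (total_set S))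
    (S_stratified : stratified S) (S_definable : definable Def S)
    (S_cylindrical : cylindrically_stratified S)
    (v : R * R) (v_Omega : Omega v) :
  (exists eps : R,
     [/\ 0 < eps,
         structure_maps_weq_below S v eps%:E &
         persistent_type_below_recovers S v eps%:E]) /\
  [/\ (0 < min_weak_feature_size S v)%E,
      structure_maps_weq_below S v (min_weak_feature_size S v) &
      persistent_type_below_recovers S v (min_weak_feature_size S v)].
Proof.
have wfs_gt0 := min_weak_feature_size_gt0 omin S_compact S_stratified S_definable v_Omega.
have maps e (le : (e <= min_weak_feature_size S v)%E) :=
  structure_maps_weq omin S_compact S_stratified S_definable v_Omega le.
have recovers e (le : (e <= min_weak_feature_size S v)%E) :=
  persistent_type_recovers omin S_compact S_stratified S_definable S_cylindrical v_Omega le.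
split; last by split; [exact: wfs_gt0|exact: maps|exact: recovers].
have [eps eps0 le] : exists2 eps : R, 0 < eps & (eps%:E <= min_weak_feature_size S v)%E.
  move: wfs_gt0; case: (min_weak_feature_size S v) => [r| |] //; last by exists 1; rewrite ?leey.
  by rewrite lte_fin => r0; exists r.
by exists eps; split; [exact: eps0|exact: maps|exact: recovers].
Qed.
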